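(* Let $M$ be a smooth manifold endowed with a Finsler metric $F$ whose fundamental tensor is $C^{1,1}_{\rm loc}$ on $TM\setminus 0$, and let $D\subset M$ be a $C^{2,1}_{\rm loc}$ domain. Then the following are equivalent: (a) $\partial D$ is infinitesimally convex; (b) $\partial D$ is geometrically convex; (c) $\partial D$ is locally convex.
   Context: Finsler metric. A Finsler metric on a smooth finite-dimensional manifold $M$ is a continuous function $F:TM\to[0,+\infty)$, vanishing only on the zero section, with $F(x,\lambda y)=\lambda F(x,y)$ for $\lambda>0$, regular on $TM\setminus 0$ and such that the fundamental tensor $g(x,y)=\big[\tfrac12\frac{\partial^2(F^2)}{\partial y^i\partial y^j}(x,y)\big]$ is positive definite for all $(x,y)\in TM\setminus 0$. Here the regularity required is that $g$ is $C^{1,1}_{\rm loc}$ on $TM\setminus 0$ (components $C^1$ with locally Lipschitz derivatives). $F$ need not be reversible; the reversed metric is $\tilde F(x,y)=F(x,-y)$. Geodesics. Geodesics are parameterized with constant speed, i.e. in local coordinates they solve $\ddot\gamma^i+\Gamma^i_{jk}(\gamma,\dot\gamma)\dot\gamma^j\dot\gamma^k=0$, where $\Gamma^i_{jk}$ are the components of the Chern connection, which satisfy $\Gamma^i_{jk}(x,y)y^jy^k=g^{ij}(x,y)\big(\tfrac12\partial_{y^jx^k}F^2(x,y)y^k-\tfrac12\partial_{x^j}F^2(x,y)\big)$. Let $\exp$ and $\widetilde{\exp}$ denote the exponential maps associated to the geodesics of $F$ and $\tilde F$ respectively. Domain. A $C^{2,1}_{\rm loc}$ domain $D\subset M$ is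 a connected open subset for which there is a $C^{2,1}_{\rm loc}$ function $\phi:M\to\mathbb R$ with $\phi^{-1}(0)=\partial D$, $\phi>0$ on $D$, and $d\phi(x)\ne0$ for every $x\in\partial D$. Finslerian Hessian. For $(x,y)\in TM\setminus0$, $H_\phi(x,y)[y,y]=\frac{d^2}{ds^2}(\phi\circ\gamma)(0)$, where $\gamma$ is the geodesic of $(M,F)$ with $\gamma(0)=x$, $\dot\gamma(0)=y$. Convexity notions for $\partial D$. - $\partial D$ is infinitesimally convex if for every $x\in\partial D$ and every nonzero $y\in T_x\partial D$ one has $H_\phi(x,y)[y,y]\le0$ (equivalently, the normal curvature with respect to the normal pointing into $D$ is non-negative; independent of the choice of $\phi$). - $\partial D$ is geometrically convex if for any $p,q\in D$, every geodesic $\gamma:[a,b]\to\overline D$ of $(M,F)$ with $\gamma(a)=p$, $\gamma(b)=q$ satisfies $\gamma([a,b])\subset D$. - $\partial D$ is locally convex if for every $x\in\partial D$ there is a neighborhood $O$ of $0$ in $T_x\partial D$ such that $\exp_x(O)\cap D=\emptyset$ and $\widetilde{\exp}_x(O)\cap D=\emptyset$. *)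

(* Defs.v *)
From HB Require Import structures.
From mathcomp Require Import all_boot all_order all_algebra.
From mathcomp Require Import boolp classical_sets functions reals interval_inference.
From mathcomp Require Import topology normedtype landau derive.
From mathcomp Require Import set_interval.
Set Implicit Arguments.
Unset Strict Implicit.
Unset Printing Implicit Defensive.
Import Order.TTheory GRing.Theory Num.Theory.
Import numFieldNormedType.Exports.
Local Open Scope ring_scope.
Local Open Scope classical_set_scope.

Fixpoint Ck (R : realType) (V W : normedModType R) (k : nat)
    (U : set V) (f : V -> W) : Prop :=
  if k is k'.+1 then
    (forall x, U x -> differentiable f x) /\ (forall v, Ck k' U ('D_v f))
  else forall x, U x -> {for x, continuous f}.

Definition locally_lipschitz (R : realType) (V W : normedModType R)
    (U : set V) (f : V -> W) : Prop :=
  forall x, U x -> exists2 A, nbhs x A & [lipschitz f y | y in A `&` U].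

(* [Ck1 k] is the class C^{k,1}_loc. *)
Fixpoint Ck1 (R : realType) (V W : normedModType R) (k : nat)
    (U : set V) (f : V -> W) : Prop :=
  if k is k'.+1 then
    (forall x, U x -> differentiable f x) /\ (forall v, Ck1 k' U ('D_v f))
  else locally_lipschitz U f.

(* The maps are total; [cto] is meaningful on [cdom] only and [cinv] on [ccod]
   only. *)
Record chart (R : realType) (n : nat) (M : topologicalType) := Chart {
  cdom : set M ;
  ccod : set 'rV[R]_n ;
  cto : M -> 'rV[R]_n ;
  cinv : 'rV[R]_n -> M ;
  cdom_open : open cdom ;
  ccod_open : open ccod ;
  cto_cod : forall p, cdom p -> ccod (cto p) ;
  cinv_dom : forall x, ccod x -> cdom (cinv x) ;
  ctoK : forall p, cdom p -> cinv (cto p) = p ;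
  cinvK : forall x, ccod x -> cto (cinv x) = x ;
  cto_continuous : forall p, cdom p -> {for p, continuous cto} ;
  cinv_continuous : forall x, ccod x -> {for x, continuous cinv} }.

(* The atlas need not be maximal.  [chart_at p] is a preferred chart at [p]; it
   serves only to represent tangent vectors at [p], see below. *)
Record smoothManifold (R : realType) (n : nat) := SmoothManifold {
  mcarrier :> topologicalType ;
  mhausdorff : hausdorff_space mcarrier ;
  msecond_countable : @second_countable mcarrier ;
  atlas : set (chart R n mcarrier) ;
  atlas_smooth : forall c d, atlas c -> atlas d -> forall k,
    Ck k (ccod c `&` cinv c @^-1` cdom d) (cto d \o cinv c) ;
  chart_at : mcarrier -> chart R n mcarrier ;
  chart_at_atlas : forall p, atlas (chart_at p) ;
  chart_at_dom : forall p, cdom (chart_at p) p }.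

Section Manifold.
Variables (R : realType) (n : nat) (M : smoothManifold R n).
Implicit Types (p x : M) (v y : 'rV[R]_n) (c : chart R n M).

(* T_pM is 'rV[R]_n: a tangent vector at [p] is given by its components in the
   chart [chart_at p].  A function on TM is thus a function M -> 'rV[R]_n -> _.
   [tangent_of c z w] is the tangent vector at [cinv c z] whose components in
   the chart [c] are [w]. *)
Definition tangent_of c (z w : 'rV[R]_n) : 'rV[R]_n :=
  'D_w (cto (chart_at (cinv c z)) \o cinv c) z.

(* The velocity at time [t] of a curve, as an element of T_{gamma t}M. *)
Definition velocity (gamma : R -> M) (t : R) : 'rV[R]_n :=
  derive1 (cto (chart_at (gamma t)) \o gamma) t.

Definition differential (phi : M -> R) p v : R :=
  'd (phi \o cinv (chart_at p)) (cto (chart_at p) p) v.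

Definition C21_function (phi : M -> R) : Prop :=
  forall c, atlas c -> Ck1 2 (ccod c) (phi \o cinv c).

(* T_xS for a subset [S] of [M]: velocities at [x] of curves in [S]; this is the
   tangent space when [S] is an embedded submanifold. *)
Definition tangent_space (S : set M) x : set 'rV[R]_n :=
  [set v | exists gamma : R -> M,
     [/\ gamma 0 = x,
         {for (0 : R), continuous gamma},
         \forall t \near (0 : R), S (gamma t) &
         is_derive (0 : R) (1 : R) (cto (chart_at x) \o gamma) v]].

Definition basis_vec (i : 'I_n) : 'rV[R]_n := delta_mx 0 i.

Definition local_sq (F : M -> 'rV[R]_n -> R) c (q : 'rV[R]_n * 'rV[R]_n) : R :=
  F (cinv c q.1) (tangent_of c q.1 q.2) ^+ 2.

Definition fundamental_tensor (F : M -> 'rV[R]_n -> R) c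
    (q : 'rV[R]_n * 'rV[R]_n) : 'M[R]_n :=
  \matrix_(i, j)
    (2^-1 * 'D_(0, basis_vec i) ('D_(0, basis_vec j) (local_sq F c)) q).

(* TM \ 0 over the domain of [c], in coordinates *)
Definition slit_domain c : set ('rV[R]_n * 'rV[R]_n) :=
  [set q | ccod c q.1 /\ q.2 != 0].

Record finsler_metric (F : M -> 'rV[R]_n -> R) : Prop := FinslerMetric {
  finsler_ge0 : forall p v, 0 <= F p v ;
  finsler_eq0 : forall p v, F p v = 0 <-> v = 0 ;
  finsler_homogeneous : forall p v (lambda : R), 0 < lambda ->
    F p (lambda *: v) = lambda * F p v ;
  finsler_continuous : forall c, atlas c -> forall z w, ccod c z ->
    {for (z, w), continuous
      (fun q : 'rV[R]_n * 'rV[R]_n => F (cinv c q.1) (tangent_of c q.1 q.2))} ;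
  (* [derive] is total: the second fibre derivatives defining the fundamental
     tensor have to be required to exist. *)
  finsler_fibre_C2 : forall c, atlas c -> forall z, ccod c z ->
    Ck 2 [set w | w != 0] (fun w => local_sq F c (z, w)) ;
  finsler_C11 : forall c, atlas c -> forall i j,
    Ck1 1 (slit_domain c) (fun q => fundamental_tensor F c q i j) ;
  finsler_posdef : forall c, atlas c -> forall q, slit_domain c q ->
    forall v, v != 0 -> 0 < (v *m fundamental_tensor F c q *m v^T) 0 0 }.

Definition reverse (F : M -> 'rV[R]_n -> R) : M -> 'rV[R]_n -> R :=
  fun p v => F p (- v).

(* The components in the chart [c] of Gamma^i_{jk}(x,y) y^j y^k, for the Chern
   connection, at q = (x,y):
     g^{ij} (1/2 d_{y^j x^k} F^2 y^k - 1/2 d_{x^j} F^2).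
   At y = 0 this vanishes (F^2(., 0) = 0), so the geodesic equation below admits
   constant geodesics. *)
Definition geodesic_coef (F : M -> 'rV[R]_n -> R) c
    (q : 'rV[R]_n * 'rV[R]_n) : 'rV[R]_n :=
  let L := local_sq F c in
  \row_i \sum_j invmx (fundamental_tensor F c q) i j *
    (2^-1 * (\sum_k 'D_(basis_vec k, 0) ('D_(0, basis_vec j) L) q * q.2 0 k)
     - 2^-1 * 'D_(basis_vec j, 0) L q).

Definition geodesic_eq_at (F : M -> 'rV[R]_n -> R) (gamma : R -> M) (t : R) :
    Prop :=
  {for t, continuous gamma} /\
  forall c, atlas c -> cdom c (gamma t) ->
    let z := cto c \o gamma in
    [/\ \forall s \near t, derivable z s 1,
        derivable (derive1 z) t 1 &
        derive1n 2 z t + geodesic_coef F c (z t, derive1 z t) = 0].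

(* As usual for curves on a non-open set [J], the equation is required on a
   neighbourhood of [J]. *)
Definition geodesic_on (F : M -> 'rV[R]_n -> R) (J : set R) (gamma : R -> M) :
    Prop :=
  forall t, J t -> \forall s \near t, geodesic_eq_at F gamma s.

Definition geodesics_from (F : M -> 'rV[R]_n -> R) (J : set R) x y :
    set (R -> M) :=
  [set gamma | [/\ geodesic_on F J gamma, gamma 0 = x & velocity gamma 0 = y]].

(* "The" geodesic on [J] with initial data (x, y), when there is one *)
Definition the_geodesic (F : M -> 'rV[R]_n -> R) (J : set R) x y : R -> M :=
  xget (cst x) (geodesics_from F J x y).

Definition exp_domain (F : M -> 'rV[R]_n -> R) x : set 'rV[R]_n :=
  [set y | geodesics_from F `[0, 1] x y !=set0].

Definition finsler_exp (F : M -> 'rV[R]_n -> R) x y : M :=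
  the_geodesic F `[0, 1] x y 1.

(* H_phi(x,y)[y,y] *)
Definition finsler_hessian (F : M -> 'rV[R]_n -> R) (phi : M -> R) x y : R :=
  derive1n 2 (phi \o the_geodesic F [set 0] x y) 0.

Definition bd (D : set M) : set M := closure D `\` interior D.

Record C21_domain (D : set M) (phi : M -> R) : Prop := C21Domain {
  domain_open : open D ;
  domain_connected : connected D ;
  domain_C21 : C21_function phi ;
  domain_bd : phi @^-1` [set 0] = bd D ;
  domain_gt0 : forall x, D x -> 0 < phi x ;
  domain_regular : forall x, bd D x -> exists v, differential phi x v != 0 }.

Definition infinitesimally_convex (F : M -> 'rV[R]_n -> R) (D : set M)
    (phi : M -> R) : Prop :=
  forall x, bd D x -> forall y, tangent_space (bd D) x y -> y != 0 ->
    finsler_hessian F phi x y <= 0.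

Definition geometrically_convex (F : M -> 'rV[R]_n -> R) (D : set M) : Prop :=
  forall (a b : R) (gamma : R -> M), a <= b ->
    geodesic_on F `[a, b] gamma ->
    (forall t, t \in `[a, b] -> closure D (gamma t)) ->
    D (gamma a) -> D (gamma b) ->
    forall t, t \in `[a, b] -> D (gamma t).

Definition locally_convex (F : M -> 'rV[R]_n -> R) (D : set M) : Prop :=
  forall x, bd D x -> exists2 U, nbhs (0 : 'rV[R]_n) U &
    let O := U `&` tangent_space (bd D) x in
    [/\ O `<=` exp_domain F x, O `<=` exp_domain (reverse F) x,
        (finsler_exp F x @` O) `&` D = set0 &
        (finsler_exp (reverse F) x @` O) `&` D = set0].

End Manifold.

(* Main.v *)
(** Both (b) and (c) are compared with (a).  Around a boundary point, in a chart,
    let f be the function phi and H (z, w) the second derivative of f along the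
    geodesic through z with velocity w.  If H <= 0 on the vectors tangent to
    {f = 0}, then, H being locally Lipschitz and homogeneous of degree 2 in w,
      H (z, w) <= C (|f z| |w|^2 + |df_z w| |w|)
    for z near the boundary point.  So rho = f o gamma satisfies
    rho'' <= C' (|rho| + |rho'|) along a geodesic gamma, and if rho and rho'
    vanish at 0 then rho <= 0 for a short time.  This yields (c) for short
    geodesics tangent to the boundary, of F and of its reverse, and (b) at the
    last contact of a geodesic with the boundary.  Conversely, if H (x, y) > 0
    for a vector y tangent to the boundary at x, the geodesics with initial
    velocity a small positive multiple of y lie in D except at x, which
    contradicts (b) and (c).
    The geodesic equation is Lipschitz also at zero velocity, by homogeneity, so
    Picard iteration provides the geodesics; that they solve the equation in
    every chart follows from its Euler-Lagrange form. *)

Require Import Defs.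
From mathcomp Require Import all_boot all_order all_algebra.
From mathcomp Require Import boolp classical_sets functions reals interval_inference.
From mathcomp Require Import topology prodnormedzmodule normedtype landau derive realfun.
From mathcomp Require constructive_ereal measure lebesgue_measure lebesgue_integral ftc.
From mathcomp Require Import ring lra.
(* Repeated because mathcomp-analysis also has a [locally_convex]. *)
Require Import Defs.
Set Implicit Arguments.
Unset Strict Implicit.
Unset Printing Implicit Defensive.
Import Order.TTheory GRing.Theory Num.Theory.
Import numFieldNormedType.Exports.
Local Open Scope ring_scope.
Local Open Scope classical_set_scope.

(** * Mean values and a comparison principle *)

(** The regularity hypotheses shape the coordinate part. A metric comes with base derivatives of its
    fundamental tensor g only; F^2 and its fibre derivatives get theirs from Euler's relations F^2 =
    g_ij w^i w^j and d_{w^j} F^2 = 2 g_ij w^i. The spray is then locally Lipschitz at nonzero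
    velocities. Since the exponential map is evaluated at time 1, existence is proved on a fixed
    time interval for small velocities, and slow geodesics must be shown to stay in one chart up to
    time 1. Statements on geodesics are proved for every solution with the given initial data, so
    they hold for whichever one [the_geodesic] selects. The set {f = 0} is never straightened: f
    grows at a definite rate along a transverse direction v, so points and curves can be pushed
    along v onto {f = 0} with a displacement O(|f|). Finally, phi is positive on D but its sign off
    the closure of D is not prescribed, so that near a boundary point {phi > 0} lies in D requires
    an argument of its own. *)

Lemma derive_line (R : numFieldType) (V W : normedModType R) (f : V -> W) x v :
  'D_v f x = 'D_1 (fun h : R => f (h *: v + x)) 0.
Proof.
rewrite /derive; set g1 := fun h => h^-1 *: _; set g2 := fun h => h^-1 *: _.
suff -> : g1 = g2 by [].
by rewrite funeqE /g1 /g2 => h /=; rewrite addr0 scale0r add0r [_%:A]mulr1.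
Qed.

(** [g] has only a derivative along [v], so the chain rule is applied to its restriction to the line
    through [x], a function of a real variable, for which derivable and differentiable agree. *)
Lemma is_derive_comp (R : numFieldType) (U V W : normedModType R)
    (f : V -> W) (g : U -> V) x v dg :
  differentiable f (g x) -> is_derive x v g dg ->
  is_derive x v (f \o g) ('D_dg f (g x)).
Proof.
move=> df [gv gdg].
pose k (h : R) := g (h *: v + x).
have k0 : k 0 = g x by rewrite /k scale0r add0r.
have g1 : differentiable k 0.
  by apply/derivable1_diffP; move/derivable1P : gv.
have df' : differentiable f (k 0) by rewrite k0.
have fg1 := differentiable_comp g1 df'.
split; first by apply/derivable1P; move/derivable1_diffP : fg1.
rewrite derive_line (deriveE _ fg1) diff_comp//=.
by rewrite k0 -(deriveE _ df) -(deriveE _ g1) -gdg (derive_line g).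
Qed.

Lemma mean_value_lt (R : realType) (f df : R -> R) (a b : R) : a < b ->
  (forall t, a <= t <= b -> is_derive t (1 : R) f (df t)) ->
  exists2 c, a < c < b & f b - f a = df c * (b - a).
Proof.
move=> ab fd.
have fc : {within `[a, b], continuous f}.
  by apply: derivable_within_continuous => t; rewrite in_itv/= => /fd[].
have fd' t : t \in `]a, b[%R -> is_derive t (1 : R) f (df t).
  by rewrite in_itv/= => /andP[ta tb]; apply: fd; rewrite !ltW.
have [c cab ->] := MVT ab fd' fc.
by exists c => //; rewrite in_itv/= in cab.
Qed.

Lemma mean_value (R : realType) (f df : R -> R) (a b : R) : a <= b ->
  (forall t, a <= t <= b -> is_derive t (1 : R) f (df t)) ->
  exists2 c, a <= c <= b & f b - f a = df c * (b - a).
Proof.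
rewrite le_eqVlt => /predU1P[<- _|ab fd].
  by exists a; rewrite ?lexx// !subrr mulr0.
have [c /andP[ac cb] E] := mean_value_lt ab fd.
by exists c => //; rewrite !ltW.
Qed.

Section rowvectors.
Context {R : realType} {n : nat}.
Local Notation E := 'rV[R]_n.

Lemma coord_norm_le (v : E) i : `|v 0 i| <= `|v|.
Proof.
rewrite [leRHS]/Num.Def.normr/= mx_normrE.
exact: (le_bigmax _ _ (0, i)).
Qed.

Lemma row_norm_le (v : E) (c : R) : 0 <= c ->
  (forall i, `|v 0 i| <= c) -> `|v| <= c.
Proof.
move=> c0 vc; rewrite [leLHS]/Num.Def.normr/= mx_normrE bigmax_le// => -[i j] _.
by rewrite /= ord1.
Qed.

Lemma row_basis (v : E) : v = \sum_i v 0 i *: basis_vec R i.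
Proof. exact: row_sum_delta. Qed.

Lemma is_derive_coord (V : normedModType R) (f : V -> E) x v df i :
  is_derive x v f df -> is_derive x v (fun p => f p 0 i) (df 0 i).
Proof.
move=> [fv <-]; split; first by move/derivable_mxP : fv.
by rewrite (derive_mx fv) mxE.
Qed.

Lemma is_derive_row (V : normedModType R) (f : V -> E) x v (df : E) :
  (forall i, is_derive x v (fun p => f p 0 i) (df 0 i)) -> is_derive x v f df.
Proof.
move=> H.
have fv : derivable f x v.
  by apply/derivable_mxP => i j; rewrite ord1; case: (H j).
split=> //; rewrite (derive_mx fv); apply/rowP => i; rewrite mxE.
by case: (H i).
Qed.

Lemma derive_basis (W : normedModType R) (f : E -> W) x v :
  differentiable f x -> 'D_v f x = \sum_i v 0 i *: 'D_(basis_vec R i) f x.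
Proof.
move=> df; rewrite deriveE// [in LHS](row_basis v) linear_sum.
by apply: eq_bigr => i _; rewrite linearZ deriveE.
Qed.

Lemma deriveDv (V W : normedModType R) (f : V -> W) x u v :
  differentiable f x -> 'D_(u + v) f x = 'D_u f x + 'D_v f x.
Proof. by move=> df; rewrite !deriveE// linearD. Qed.

Lemma deriveZv (V W : normedModType R) (f : V -> W) x (a : R) u :
  differentiable f x -> 'D_(a *: u) f x = a *: 'D_u f x.
Proof. by move=> df; rewrite !deriveE// linearZ. Qed.

Lemma deriveNv (V W : normedModType R) (f : V -> W) x u :
  differentiable f x -> 'D_(- u) f x = - 'D_u f x.
Proof. by move=> df; rewrite !deriveE// linearN. Qed.

Lemma is_derive_continuous (W : normedModType R) (f : R -> W) t df :
  is_derive t (1 : R) f df -> {for t, continuous f}.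
Proof.
by move=> [fd _]; apply/differentiable_continuous/derivable1_diffP.
Qed.

(* The sup norm lets the mean value inequality be proved coordinatewise. *)
Lemma mean_value_bound (f df : R -> E) (a b : R) (M : R) : a <= b ->
  (forall t, a <= t <= b -> is_derive t (1 : R) f (df t)) ->
  (forall t, a <= t <= b -> `|df t| <= M) ->
  `|f b - f a| <= M * (b - a).
Proof.
move=> ab fd dM.
have M0 : 0 <= M by rewrite (le_trans _ (dM a _))// lexx.
apply: row_norm_le => [|i]; first by rewrite mulr_ge0// subr_ge0.
have H t : a <= t <= b -> is_derive t (1 : R) (fun s => f s 0 i) (df t 0 i).
  by move=> tab; apply: is_derive_coord; exact: fd.
have [c cab] := mean_value ab H.
rewrite !mxE => ->; rewrite normrM ler_pM//.
  by rewrite (le_trans (coord_norm_le _ _))// dM.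
by rewrite ger0_norm// subr_ge0.
Qed.

End rowvectors.

Lemma near_itv (R : realType) (a b t : R) : a < t < b ->
  \forall s \near t, a < s < b.
Proof.
move=> /andP[at_ tb].
have H : \forall s \near t, a < s /\ s < b.
  exact: filterI (lt_nbhsr at_) (lt_nbhsl tb).
by apply: filterS H => s [as_ sb]; apply/andP; split.
Qed.

Section real_induction.
Context {R : realType}.

(** The supremum of the [t] such that [P] holds on [a, t] satisfies [P] by the last hypothesis, and
    cannot lie below [b] by the one before. Bounds along a geodesic are continued in time in this
    way. *)
Lemma real_induction (P : R -> Prop) (a b : R) : a <= b -> P a ->
  (forall t, a <= t -> t < b -> (forall s, a <= s <= t -> P s) ->
    exists2 d, 0 < d & forall s, t <= s < t + d -> P s) ->
  (forall t, a < t -> t <= b -> (forall s, a <= s < t -> P s) -> P t) ->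
  forall t, a <= t <= b -> P t.
Proof.
move=> ab Pa Popen Pclosed.
pose S := [set t | a <= t <= b /\ forall s, a <= s <= t -> P s].
have Sa : S a.
  split; first by rewrite lexx.
  by move=> s sa; rewrite (_ : s = a)//; apply/eqP; rewrite eq_le andbC.
have Sb : ubound S b by move=> t [/andP[]].
have hS : has_sup S by split; [exists a|exists b].
pose c := sup S.
have ac : a <= c by apply: (sup_upper_bound hS).
have cb : c <= b by apply: ge_sup => //; exists a.
have Pltc s : a <= s < c -> P s.
  move=> /andP[as_ sc].
  have sc0 : 0 < c - s by rewrite subr_gt0.
  have [t [tab Pt] st] := sup_adherent sc0 hS.
  by apply: Pt; rewrite as_/= ltW//; move: st; rewrite opprB addrC subrK.
have Pc : P c.
  by move: ac; rewrite le_eqVlt => /predU1P[<-//|ac]; exact: Pclosed.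
have Plec s : a <= s <= c -> P s.
  move=> /andP[as_]; rewrite le_eqVlt => /predU1P[->//|sc].
  by apply: Pltc; rewrite as_.
move: cb; rewrite le_eqVlt => /predU1P[cb|cb]; first by rewrite -cb.
have [d d0 Pd] := Popen _ ac cb Plec.
pose e := Num.min (c + d / 2) b.
have ce : c < e by rewrite lt_min cb andbT ltrDl divr_gt0.
suff : e <= c by rewrite leNgt ce.
apply: (sup_upper_bound hS); split; first by rewrite ge_min lexx orbT (le_trans ac (ltW ce)).
move=> s /andP[as_ se]; have [sc|cs] := leP s c; first by apply: Plec; rewrite as_.
apply: Pd; rewrite ltW//= (le_lt_trans se)// gt_min ltrD2l; apply/orP; left.
by rewrite ltr_pdivrMr// ltr_pMr// ltr1n.
Qed.

(** [c] is the supremum of the points where [f] is nonpositive. It serves for [drho] in [comparison]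
    and for the last contact of a geodesic with the boundary. *)
Lemma last_nonpos (f : R -> R) (a b : R) : a <= b ->
  (forall t, a <= t <= b -> {for t, continuous f}) -> f a <= 0 -> 0 < f b ->
  exists c, [/\ a <= c, c < b, f c <= 0 & forall t, c < t <= b -> 0 < f t].
Proof.
move=> ab cf fa fb.
pose A := [set t | a <= t <= b /\ f t <= 0].
have Aa : A a by rewrite /A/= lexx.
have hA : has_sup A by split; [exists a|exists b => t [/andP[]]].
pose c := sup A.
have ac : a <= c by apply: (sup_upper_bound hA).
have cb : c <= b by apply: ge_sup; [exists a|move=> t [/andP[]]].
have fc : f c <= 0.
  rewrite leNgt; apply/negP => fc0.
  have : \forall t \near c, 0 < f t.
    have cfc : {for c, continuous f} by apply: cf; rewrite ac.
    exact: (cfc _ (lt_nbhsr fc0)).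
  move=> /nbhs_ballP[e e0 He].
  have [t [tab ft] et] := sup_adherent e0 hA.
  have : 0 < f t.
    apply: He; rewrite /ball/= ger0_norm ?ltrBlDr ?subr_ge0.
      by rewrite addrC -ltrBlDr.
    exact: sup_upper_bound.
  by rewrite ltNge ft.
exists c; split=> //.
  by rewrite lt_neqAle cb andbT; apply/eqP => cE; rewrite cE leNgt fb in fc.
move=> t /andP[ct tb]; rewrite ltNge; apply/negP => ft.
suff : t <= c by rewrite leNgt ct.
by apply: (sup_upper_bound hA); split=> //; rewrite tb (le_trans ac (ltW ct)).
Qed.

End real_induction.

(* Let m minimise rho on [0, t], and k maximise drho on [m, t].  Both drho and
   rho - rho m are at most drho k there, so the inequality does not let drho
   increase from its last zero before k up to drho k. *)
Lemma comparison (R : realType) (rho drho ddrho : R -> R) (C T : R) :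
  0 <= C -> T <= 1 -> C * T <= 8^-1 ->
  (forall t, 0 <= t <= T -> is_derive t (1 : R) rho (drho t)) ->
  (forall t, 0 <= t <= T -> is_derive t (1 : R) drho (ddrho t)) ->
  (forall t, 0 <= t <= T -> ddrho t <= C * (`|rho t| + `|drho t|)) ->
  rho 0 = 0 -> drho 0 = 0 ->
  forall t, 0 <= t <= T -> rho t <= 0.
Proof.
move=> C0 T1 CT drhoP ddrhoP ddrho_le rho0 drho0 t /andP[t0 tT].
rewrite leNgt; apply/negP => rhot.
have T0 : 0 <= T := le_trans t0 tT.
have cdrho s : 0 <= s <= T -> {for s, continuous drho}.
  by move=> /ddrhoP; exact: is_derive_continuous.
have wcrho : {within `[0, t], continuous rho}.
  apply: derivable_within_continuous => s; rewrite in_itv/= => /andP[s0 st].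
  by case: (@drhoP s) => //; rewrite s0 (le_trans st tT).
have [m] := EVT_min t0 wcrho.
rewrite in_itv/= => /andP[m0 mt] rhomin.
have rhom0 : rho m <= 0 by rewrite -rho0; apply: rhomin; rewrite in_itv/= lexx.
have mT : m <= T := le_trans mt tT.
have mltt : m < t.
  rewrite lt_neqAle mt andbT; apply/eqP => mE.
  by rewrite mE leNgt rhot in rhom0.
(* For m = 0 this is the initial condition; otherwise m is an interior minimum, since
   [rho m <= 0 < rho t] excludes m = t. *)
have drhom : drho m = 0.
  move: m0; rewrite le_eqVlt => /predU1P[<-//|m0].
  have mi : m \in `]0, t[%R by rewrite in_itv/= m0.
  have := @derive1_at_min _ rho 0 t m t0.
  have dm : is_derive m (1 : R) rho (drho m) by apply: drhoP; rewrite ltW.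
  move=> H; have : is_derive m (1 : R) rho 0.
    apply: H => //.
      move=> s; rewrite in_itv/= => /andP[s0 st].
      by case: (@drhoP s) => //; rewrite ltW//= (le_trans (ltW st) tT).
    move=> s; rewrite in_itv/= => /andP[s0 st].
    by apply: rhomin; rewrite in_itv/= !ltW.
  by case: dm => _ <- [_].
have wcdrho : {within `[m, t], continuous drho}.
  apply: derivable_within_continuous => s; rewrite in_itv/= => /andP[s0 st].
  by case: (@ddrhoP s) => //; rewrite (le_trans m0 s0) (le_trans st tT).
have [k] := EVT_max mt wcdrho.
rewrite in_itv/= => /andP[mk kt] drhomax.
have kT : k <= T := le_trans kt tT.
have drho_le s : m <= s <= k -> drho s <= drho k.
  move=> /andP[ms sk]; apply: drhomax.
  by rewrite in_itv/= ms (le_trans sk kt).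
(* The length of [m, s] is at most 1 because [T <= 1], so the factor [s - m] of the mean value
   theorem is dropped. *)
have inc s : m <= s <= t -> rho s - rho m <= drho k.
  move=> /andP[ms st].
  have [|c /andP[mc cs] ->] := @mean_value _ rho drho m s ms.
    by move=> r /andP[mr rs]; apply: drhoP; rewrite (le_trans m0 mr)//=
      (le_trans rs)// (le_trans st tT).
  have dk0 : 0 <= drho k by rewrite -drhom; apply: drho_le; rewrite lexx.
  apply: (@le_trans _ _ (drho k * (s - m))).
    apply: ler_wpM2r; first by rewrite subr_ge0.
    by apply: drhomax; rewrite in_itv/= mc (le_trans cs).
  apply: ler_piMr => //; rewrite lerBlDr (le_trans st)//.
  by rewrite (le_trans tT)// (le_trans T1)// lerDl.
have dk0 : 0 < drho k.
  rewrite lt_neqAle -{2}drhom drho_le ?lexx ?mk// andbT eq_sym.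
  apply/eqP => dk0.
  have : rho t - rho m <= 0 by rewrite -dk0; apply: inc; rewrite mt lexx.
  rewrite subr_le0 => /(lt_le_trans rhot).
  by rewrite ltNge rhom0.
have [|||c [mc ck dc0 dc_gt0]] := @last_nonpos _ drho m k mk.
- move=> s /andP[ms sk]; apply: cdrho.
  by rewrite (le_trans m0 ms) (le_trans sk kT).
- by rewrite drhom.
- by [].
have [|e /andP[ce ek] dE] := @mean_value_lt _ drho ddrho c k ck.
  move=> s /andP[cs sk]; apply: ddrhoP.
  by rewrite (le_trans m0 (le_trans mc cs)) (le_trans sk kT).
have me : m <= e by apply: (le_trans mc); exact: ltW.
have et : e <= t by apply: le_trans kt; exact: ltW.
have drhoe : `|drho e| <= drho k.
  by rewrite ger0_norm; [apply: drho_le; rewrite me ltW|apply/ltW/dc_gt0; rewrite ce ltW].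
have rhoe : `|rho e| <= drho k - rho m.
  rewrite ler_norml; apply/andP; split.
    rewrite opprB lerBlDr (@le_trans _ _ (rho e))//; last by rewrite lerDl ltW.
    by apply: rhomin; rewrite in_itv/= (le_trans m0 me).
  have := inc e; rewrite me et => /(_ isT); lra.
have He : ddrho e <= C * (`|rho e| + `|drho e|).
  by apply: ddrho_le; rewrite (le_trans m0 me) (le_trans et tT).
have A0 : 0 <= drho k + drho k - rho m by lra.
(* As [- rho m < rho t - rho m <= drho k], the right-hand side is less than 3/8 of [drho k], which
   contradicts [0 < drho k]. *)
have : drho k <= 8^-1 * (drho k + drho k - rho m).
  apply: (@le_trans _ _ (drho k - drho c)); first by lra.
  rewrite dE; apply: (@le_trans _ _ (C * (drho k + drho k - rho m) * (k - c))).
    rewrite ler_pM2r ?subr_gt0//; apply: (le_trans He).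
    by apply: ler_wpM2l => //; lra.
  rewrite mulrAC ler_wpM2r//; apply: (le_trans _ CT).
  apply: ler_wpM2l => //; rewrite lerBlDr (le_trans kT)// lerDl.
  exact: le_trans mc.
have : rho t - rho m <= drho k by apply: inc; rewrite mt lexx.
lra.
Qed.

(** * Locally Lipschitz maps *)

Section lipschitz_at.
Context {R : realType}.

(* The bound on [f] makes products of such functions Lipschitz again. *)
Definition lip_at (V W : normedModType R) (f : V -> W) (x : V) : Prop :=
  exists A : set V, exists K : R, [/\ nbhs x A, 0 <= K,
    forall p, A p -> `|f p| <= K &
    forall p q, A p -> A q -> `|f p - f q| <= K * `|p - q|].

Context {V : normedModType R}.

Lemma lip_atI (W : normedModType R) (f : V -> W) x (A : set V) K :
  nbhs x A -> (forall p q, A p -> A q -> `|f p - f q| <= K * `|p - q|) ->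
  lip_at f x.
Proof.
move=> nA fK; exists (A `&` ball x 1); exists (`|f x| + `|K|).
have fK' p q : A p -> A q -> `|f p - f q| <= `|K| * `|p - q|.
  move=> Ap Aq; rewrite (le_trans (fK _ _ Ap Aq))// ler_wpM2r//.
  exact: ler_norm.
split.
- by apply: filterI => //; exact: nbhsx_ballx.
- by rewrite addr_ge0.
- move=> p [Ap]; rewrite -ball_normE/= => /ltW xp.
  rewrite -[f p](subrK (f x)) addrC (le_trans (ler_normD _ _))// lerD2l.
  rewrite (le_trans (fK' _ _ Ap (nbhs_singleton nA)))//.
  by rewrite ler_piMr// distrC.
- move=> p q [Ap _] [Aq _]; rewrite (le_trans (fK' _ _ Ap Aq))//.
  by rewrite ler_wpM2r// lerDr.
Qed.

Lemma lip_at_continuous (W : normedModType R) (f : V -> W) x :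
  lip_at f x -> {for x, continuous f}.
Proof.
move=> [A [K [nA K0 _ fK]]].
apply/cvgrPdist_lt => e e0; have K1 : 0 < K + 1 by rewrite ltr_wpDl.
near=> y; apply: (@le_lt_trans _ _ (K * `|x - y|)).
  by apply: fK; [exact: nbhs_singleton|near: y].
rewrite (@le_lt_trans _ _ ((K + 1) * `|x - y|))//.
  by rewrite ler_wpM2r// lerDl.
rewrite -ltr_pdivlMl// mulrC; near: y.
have : nbhs x (ball x (e / (K + 1))) by apply: nbhsx_ballx; rewrite divr_gt0.
by rewrite -ball_normE.
Unshelve. all: by end_near. Qed.

Lemma lip_at_near (W : normedModType R) (f g : V -> W) x :
  {near x, f =1 g} -> lip_at f x -> lip_at g x.
Proof.
move=> fg [A [K [nA K0 fA fK]]].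
exists (A `&` [set y | f y = g y]); exists K; split=> //.
- exact: filterI.
- by move=> p [Ap <-]; exact: fA.
- by move=> p q [Ap <-] [Aq <-]; exact: fK.
Qed.

Lemma lip_at_cst (W : normedModType R) (c : W) x : lip_at (fun _ : V => c) x.
Proof.
apply: (@lip_atI _ _ _ setT 0); first exact: filterT.
by move=> p q _ _; rewrite subrr normr0 mul0r.
Qed.

Lemma lip_atD (W : normedModType R) (f g : V -> W) x :
  lip_at f x -> lip_at g x -> lip_at (fun p => f p + g p) x.
Proof.
move=> [A [K [nA _ _ fK]]] [B [L [nB _ _ gL]]].
apply: (@lip_atI _ _ _ (A `&` B) (K + L)); first exact: filterI.
move=> p q [Ap Bp] [Aq Bq].
rewrite opprD addrACA (le_trans (ler_normD _ _))// mulrDl lerD//.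
  exact: fK.
exact: gL.
Qed.

Lemma lip_atN (W : normedModType R) (f : V -> W) x :
  lip_at f x -> lip_at (fun p => - f p) x.
Proof.
move=> [A [K [nA _ _ fK]]]; apply: (@lip_atI _ _ _ A K) => // p q Ap Aq.
by rewrite -opprD normrN; exact: fK.
Qed.

Lemma lip_atB (W : normedModType R) (f g : V -> W) x :
  lip_at f x -> lip_at g x -> lip_at (fun p => f p - g p) x.
Proof. by move=> ff gg; apply: lip_atD => //; exact: lip_atN. Qed.

Lemma lip_atM (f g : V -> R) x :
  lip_at f x -> lip_at g x -> lip_at (fun p => f p * g p) x.
Proof.
move=> [A [K [nA K0 fA fK]]] [B [L [nB L0 gB gL]]].
apply: (@lip_atI _ _ _ (A `&` B) (K * L + K * L)); first exact: filterI.
move=> p q [Ap Bp] [Aq Bq].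
have -> : f p * g p - f q * g q = f p * (g p - g q) + (f p - f q) * g q by ring.
rewrite (le_trans (ler_normD _ _))// [leRHS]mulrDl !normrM lerD//.
  by rewrite -mulrA ler_pM//; [exact: fA|exact: gL].
by rewrite mulrAC ler_pM//; [exact: fK|exact: gB].
Qed.

Lemma lip_at_sum (W : normedModType R) (I : Type) (s : seq I) (P : pred I)
    (f : I -> V -> W) x :
  (forall i, P i -> lip_at (f i) x) ->
  lip_at (fun p => \sum_(i <- s | P i) f i p) x.
Proof.
move=> H; elim: s => [|i s IH].
  by under eq_fun do rewrite big_nil; exact: lip_at_cst.
under eq_fun do rewrite big_cons.
case Pi : (P i) => //; apply: lip_atD => //; exact: H.
Qed.

Lemma lip_at_prod (I : Type) (s : seq I) (P : pred I) (f : I -> V -> R) x :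
  (forall i, P i -> lip_at (f i) x) ->
  lip_at (fun p => \prod_(i <- s | P i) f i p) x.
Proof.
move=> H; elim: s => [|i s IH].
  by under eq_fun do rewrite big_nil; exact: lip_at_cst.
under eq_fun do rewrite big_cons.
case Pi : (P i) => //; apply: lip_atM => //; exact: H.
Qed.

Lemma lip_atV (f : V -> R) x : f x != 0 ->
  lip_at f x -> lip_at (fun p => (f p)^-1) x.
Proof.
move=> fx0 ff; have cf := lip_at_continuous ff.
move: ff => [A [K [nA K0 fA fK]]].
have [c c0 cx] : exists2 c, 0 < c & c < `|f x|.
  have fx : 0 < `|f x| by rewrite normr_gt0.
  by exists (`|f x| / 2); lra.
have nB : \forall p \near x, c < `|f p| by exact: (cvg_norm cf (lt_nbhsr cx)).
apply: (@lip_atI _ _ _ (A `&` [set p | c < `|f p|]) (K / (c * c))).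
  exact: filterI.
move=> p q [Ap /= cp] [Aq /= cq].
have p0 : f p != 0 by rewrite -normr_gt0 (lt_trans c0).
have q0 : f q != 0 by rewrite -normr_gt0 (lt_trans c0).
have -> : (f p)^-1 - (f q)^-1 = (f q - f p) * (f p * f q)^-1.
  by field; rewrite p0 q0.
rewrite normrM normfV mulrAC ler_pM ?invr_ge0//.
  by rewrite distrC; exact: fK.
rewrite lef_pV2 ?posrE ?mulr_gt0//; first by rewrite normrM ler_pM// ltW.
by rewrite normr_gt0 mulf_neq0.
Qed.

Lemma lip_at_comp (U W : normedModType R) (f : U -> W) (g : V -> U) x :
  lip_at g x -> lip_at f (g x) -> lip_at (f \o g) x.
Proof.
move=> gx; have cg := lip_at_continuous gx.
move: gx => [A [K [nA K0 gA gK]]] [B [L [nB L0 fB fL]]].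
apply: (@lip_atI _ _ _ (A `&` g @^-1` B) (L * K)).
  by apply: filterI => //; exact: cg.
move=> p q [Ap Bp] [Aq Bq] /=.
by rewrite (le_trans (fL _ _ Bp Bq))// -mulrA ler_wpM2l// gK.
Qed.

Lemma lip_at_coord n (f : V -> 'rV[R]_n) x i :
  lip_at f x -> lip_at (fun p => f p 0 i) x.
Proof.
move=> [A [K [nA _ _ fK]]]; apply: (@lip_atI _ _ _ A K) => // p q Ap Aq.
by rewrite (le_trans _ (fK _ _ Ap Aq))// (le_trans _ (coord_norm_le _ i))// !mxE.
Qed.

Lemma lip_at_row n (f : V -> 'rV[R]_n) x :
  (forall i, lip_at (fun p => f p 0 i) x) -> lip_at f x.
Proof.
move=> H; rewrite (_ : f = fun p => \sum_i f p 0 i *: basis_vec R i); last first.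
  by apply/funext => p; exact: row_basis.
apply: lip_at_sum => i _; have [A [K [nA K0 _ fK]]] := H i.
apply: (@lip_atI _ _ _ A (`|basis_vec R i| * K)) => // p q Ap Aq.
by rewrite -scalerBl normrZ mulrC -mulrA ler_wpM2l// fK.
Qed.

Lemma lip_at_det n (M : V -> 'M[R]_n) x :
  (forall i j, lip_at (fun p => M p i j) x) -> lip_at (fun p => \det (M p)) x.
Proof.
move=> H; rewrite /determinant; apply: lip_at_sum => s _.
by apply: lip_atM; [exact: lip_at_cst|exact: lip_at_prod].
Qed.

(** The cofactor formula for [invmx] holds only at invertible matrices. The determinant is
    continuous, so [M] stays invertible near [x], and there the entries of the inverse are
    polynomials in those of [M] divided by the determinant. *)
Lemma lip_at_invmx n (M : V -> 'M[R]_n) x : M x \in unitmx ->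
  (forall i j, lip_at (fun p => M p i j) x) ->
  forall i j, lip_at (fun p => invmx (M p) i j) x.
Proof.
move=> Mx H i j; have dM := lip_at_det H.
have dx0 : \det (M x) != 0 by rewrite -unitfE -unitmxE.
have near_unit : \forall p \near x, \det (M p) != 0.
  exact: (cvgr_neq0 _ (lip_at_continuous dM) dx0).
apply: (@lip_at_near _ (fun p => (\det (M p))^-1 * cofactor (M p) j i)).
  apply: filterS near_unit => p dp.
  by rewrite /invmx unitmxE unitfE dp !mxE.
apply: lip_atM; first exact: lip_atV.
rewrite /cofactor; apply: lip_atM; first exact: lip_at_cst.
apply: lip_at_det => k l.
by apply: (@lip_at_near _ (fun p => M p (lift j k) (lift i l))) => //;
  near=> p; rewrite !mxE.
Unshelve. all: by end_near. Qed.

End lipschitz_at.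

Section lines.
Context {R : realType} {V W : normedModType R}.

Lemma is_derive_affine (v x : V) (h : R) :
  is_derive h (1 : R) (fun h : R => h *: v + x) v.
Proof.
have H : is_derive h (1 : R) (fun h : R => h *: v) v.
  have [_ dE] := is_diff_scalel h v.
  split; first by apply: diff_derivable; case: (is_diff_scalel h v).
  by rewrite deriveE ?dE ?scale1r//; case: (is_diff_scalel h v).
have := is_deriveD H (is_derive_cst x h (1 : R)).
by rewrite addr0.
Qed.

Lemma is_derive_line (f : V -> W) (v x : V) (h : R) :
  differentiable f (h *: v + x) ->
  is_derive h (1 : R) (fun h : R => f (h *: v + x)) ('D_v f (h *: v + x)).
Proof.
move=> df; have H := is_derive_affine v x h.
by have := @is_derive_comp _ _ _ _ f (fun h : R => h *: v + x) h 1 v df H.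
Qed.

Lemma ball_segment (x p q : V) (r h : R) : 0 <= h <= 1 ->
  ball x r p -> ball x r q -> ball x r (h *: (p - q) + q).
Proof.
move=> /andP[h0 h1]; rewrite -ball_normE/= => xp xq.
have -> : x - (h *: (p - q) + q) = h *: (x - p) + (1 - h) *: (x - q).
  have -> : p - q = (x - q) - (x - p) by rewrite opprB [RHS]addrC addrA subrK.
  rewrite opprD addrCA scalerBr opprB scalerBl scale1r -addrA.
  by congr (_ + _); rewrite addrC.
rewrite (le_lt_trans (ler_normD _ _))// !normrZ (ger0_norm h0) ger0_norm ?subr_ge0//.
have [h1'|h1'] := ltP h 1; last first.
  have -> : h = 1 by apply/eqP; rewrite eq_le h1.
  by rewrite mul1r subrr mul0r addr0.
have : h * `|x - p| <= h * r by rewrite ler_wpM2l// ltW.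
have : (1 - h) * `|x - q| < (1 - h) * r by rewrite ltr_pM2l// subr_gt0.
lra.
Qed.

End lines.

Section C1_lipschitz.
Context {R : realType} {V : normedModType R}.

Lemma locally_lipschitz_lip_at (W : normedModType R) (U : set V) (f : V -> W) x :
  open U -> U x -> locally_lipschitz U f -> lip_at f x.
Proof.
move=> oU Ux /(_ x Ux)[A nA [K [_ HK]]].
apply: (@lip_atI _ _ _ _ _ (A `&` U) (K + 1)).
  by apply: filterI => //; exact: open_nbhs_nbhs.
move=> p q Ap Aq.
have := HK (K + 1); rewrite ltrDl ltr01 => /(_ isT (p, q)).
exact.
Qed.

(** The partial derivatives are locally bounded, and by the mean value theorem on segments the sum
    of their bounds is a Lipschitz constant. The family [b] with coordinates [co] stands for a
    basis, in order to cover both row vectors and pairs of row vectors. *)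
Lemma C1_lip_at (I : finType) (b : I -> V) (co : I -> V -> R) (f : V -> R) x :
  (forall v, v = \sum_i co i v *: b i) -> (forall i v, `|co i v| <= `|v|) ->
  (\forall y \near x, differentiable f y) ->
  (forall i, lip_at ('D_(b i) f) x) -> lip_at f x.
Proof.
move=> vE co_le df lf.
have [K HK] : exists K : I -> R, forall i, \forall y \near x, `|'D_(b i) f y| <= K i.
  have H i : exists K : R, \forall y \near x, `|'D_(b i) f y| <= K.
    by have [A [K [nA _ AK _]]] := lf i; exists K; apply: filterS nA.
  by exists (fun i => projT1 (cid (H i))) => i; exact: projT2 (cid (H i)).
have : \forall y \near x, differentiable f y /\
    (forall i, `|'D_(b i) f y| <= K i).
  by apply: filterI => //; exact: filter_forall.
move=> /nbhs_ballP[r r0 Hr].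
apply: (@lip_atI _ _ _ _ _ (ball x r) (\sum_i K i)).
  exact: nbhsx_ballx.
move=> p q xp xq.
have seg h : 0 <= h <= 1 -> ball x r (h *: (p - q) + q).
  by move=> h01; exact: ball_segment.
have [|c c01] := @mean_value _ (fun h => f (h *: (p - q) + q))
    (fun h => 'D_(p - q) f (h *: (p - q) + q)) 0 1 ler01.
  by move=> h h01; apply: is_derive_line; case: (Hr _ (seg _ h01)).
rewrite scale1r subrK scale0r add0r subr0 mulr1 => ->.
have [dfc Kc] := Hr _ (seg _ c01).
rewrite (deriveE _ dfc) [in X in 'd f _ X](vE (p - q)) linear_sum.
rewrite (le_trans (ler_norm_sum _ _ _))// mulr_suml ler_sum// => i _.
rewrite linearZ normrZ mulrC -(deriveE _ dfc) ler_pM//.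
Qed.

End C1_lipschitz.

Section compact_lipschitz.
Context {R : realType} {V1 V2 W : normedModType R}.

(** One growing parameter [k] plays at once the part of a constant and, through [k^-1], of a radius;
    uniformity over [S] is then the near-covering form of compactness at infinity. *)
Lemma compact_uniform (T : topologicalType) (S : set T) (P : R -> T -> Prop) :
  compact S ->
  (forall k l p, 0 < k -> k <= l -> P k p -> P l p) ->
  (forall p, S p -> exists2 k, 0 < k & \forall q \near p, P k q) ->
  exists2 k, 0 < k & forall p, S p -> P k p.
Proof.
move=> /compact_near_coveringP cS mono H.
have : \forall k \near +oo, S `<=` P k.
  apply: (cS R (pinfty_nbhs R) P) => p Sp.
  have [k k0 Hk] := H p Sp.
  exists ([set q | P k q], [set l | k < l]).
    by split=> //; exists k; split=> //; exact: num_real.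
  by move=> [q l] /= [Pq kl]; apply: mono Pq => //; exact: ltW.
move=> [M [_ HM]]; exists (`|M| + 1); first by rewrite ltr_wpDl.
by apply: HM; rewrite (le_lt_trans (ler_norm _))// ltrDl.
Qed.

Lemma pair_norm_le (p q : V1 * V2) : `|p - q| <= `|p.1 - q.1| + `|p.2 - q.2|.
Proof. by rewrite [leLHS]prod_normE/= ge_max lerDl lerDr !normr_ge0. Qed.

(** Every point of [S] has a box on which [f] is Lipschitz, and compactness makes its size and the
    constant uniform. Two vectors of [S] closer than [k2^-1] share a box; for the others the bound
    [k1] on [f] suffices, because [2 * k1] is at most [2 * k1 * k2] times their distance. *)
Lemma compact_lip (f : V1 * V2 -> W) (x0 : V1) (S : set V2) : compact S ->
  (forall w, S w -> lip_at f (x0, w)) ->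
  exists r, exists K, [/\ 0 < r, 0 < K,
   forall z w, ball x0 r z -> S w -> `|f (z, w)| <= K &
   forall z z' w w', ball x0 r z -> ball x0 r z' -> S w -> S w' ->
    `|f (z, w) - f (z', w')| <= K * (`|z - z'| + `|w - w'|)].
Proof.
move=> cS lf.
have box w : S w -> exists k, [/\ 0 < k,
    forall z w', ball x0 k^-1 z -> ball w k^-1 w' -> `|f (z, w')| <= k &
    forall z z' w1 w2, ball x0 k^-1 z -> ball x0 k^-1 z' ->
      ball w k^-1 w1 -> ball w k^-1 w2 ->
      `|f (z, w1) - f (z', w2)| <= k * (`|z - z'| + `|w1 - w2|)].
  move=> /lf[A [K [/nbhs_ballP[e e0 eA] K0 AK AL]]].
  exists (K + e^-1).
  have k0 : 0 < K + e^-1 by rewrite ltr_wpDl// invr_gt0.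
  have ke : (K + e^-1)^-1 <= e.
    by rewrite invf_ple ?posrE// lerDr.
  have inA z w' : ball x0 (K + e^-1)^-1 z -> ball w (K + e^-1)^-1 w' -> A (z, w').
    by move=> zb wb; apply: eA; split; exact: (le_ball ke).
  split=> // [z w' zb wb|z z' w1 w2 zb zb' w1b w2b].
    by rewrite (le_trans (AK _ (inA _ _ zb wb)))// lerDl invr_ge0 ltW.
  rewrite (le_trans (AL _ _ (inA _ _ zb w1b) (inA _ _ zb' w2b)))//.
  rewrite ler_pM//; first by rewrite lerDl invr_ge0 ltW.
  exact: pair_norm_le.
have ballV (T : pseudoMetricType R) (x : T) (k l : R) : 0 < k -> k <= l ->
    ball x l^-1 `<=` ball x k^-1.
  by move=> k0 kl; apply: le_ball; rewrite lef_pV2 ?posrE// (lt_le_trans k0).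
have [k1 k10 H1] : exists2 k, 0 < k & forall w, S w ->
    forall z, ball x0 k^-1 z -> `|f (z, w)| <= k.
  apply: (compact_uniform cS).
    move=> k l w k0 kl H z zb; rewrite (le_trans _ kl)// H//.
    exact: ballV zb.
  move=> w /box[k [k0 Hk _]]; exists k => //.
  apply/nbhs_ballP; exists k^-1; first by rewrite /= invr_gt0.
  by move=> w' wb z zb; exact: Hk.
have [k2 k20 H2] : exists2 k, 0 < k & forall w, S w ->
    forall z z' w', ball x0 k^-1 z -> ball x0 k^-1 z' -> ball w k^-1 w' ->
    `|f (z, w) - f (z', w')| <= k * (`|z - z'| + `|w - w'|).
  apply: (compact_uniform cS).
    move=> k l w k0 kl H z z' w' zb zb' wb.
    rewrite (le_trans (H _ _ _ (ballV _ _ _ _ k0 kl _ zb)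
      (ballV _ _ _ _ k0 kl _ zb') (ballV _ _ _ _ k0 kl _ wb)))//.
    exact: ler_wpM2r.
  move=> w /box[k [k0 _ Hk]].
  (* With half the radius any neighbour [w1] of [w] may serve as a centre: its ball of radius
     [(k * 2)^-1] lies in the ball of radius [k^-1] around [w]. *)
  have k20 : 0 < k * 2 by rewrite mulr_gt0.
  have kk2 : k <= k * 2 by rewrite ler_pMr// ler1n.
  exists (k * 2) => //; apply/nbhs_ballP; exists (k * 2)^-1; first by rewrite /= invr_gt0.
  move=> w1 wb1 z z' w2 zb zb' wb2.
  have kE : k^-1 = (k * 2)^-1 + (k * 2)^-1 by rewrite invfM [LHS]splitr.
  apply: le_trans (Hk z z' w1 w2 _ _ _ _) _.
  - exact: ballV zb.
  - exact: ballV zb'.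
  - exact: ballV wb1.
  - by rewrite kE; exact: ball_triangle wb1 wb2.
  - exact: ler_wpM2r.
pose K := k1 + k2 + 2 * k1 * k2.
have k120 : 0 < 2 * k1 * k2 by rewrite !mulr_gt0.
have k1k : k1 <= k1 + k2 by rewrite lerDl ltW.
have k2k : k2 <= k1 + k2 by rewrite lerDr ltW.
have kK : k1 + k2 <= K by rewrite lerDl ltW.
exists (k1 + k2)^-1, K.
split=> [||z w zb Sw|z z' w w' zb zb' Sw Sw'].
- by rewrite invr_gt0 addr_gt0.
- by rewrite !addr_gt0.
- rewrite (le_trans _ (le_trans k1k kK))//; apply: H1 => //; exact: ballV zb.
have n0 : 0 <= `|z - z'| + `|w - w'| by [].
have [ww'|ww'] := ltP `|w - w'| k2^-1.
  apply: le_trans (H2 w Sw z z' w' _ _ _) _; [exact: ballV zb|exact: ballV zb'| |].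
    by rewrite -ball_normE.
  by rewrite ler_wpM2r// (le_trans k2k).
rewrite (le_trans (ler_normB _ _))//.
apply: (@le_trans _ _ (2 * k1 * k2 * k2^-1)).
  rewrite mulfK ?gt_eqF// mulr_natl mulr2n.
  by rewrite lerD//; apply: H1 => //; [exact: ballV zb|exact: ballV zb'].
rewrite ler_pM ?invr_ge0 ?(ltW k20) ?(ltW k120)//.
  by rewrite lerDr addr_ge0// ltW.
by rewrite (le_trans ww')// lerDr.
Qed.

End compact_lipschitz.

(** * Directional derivatives *)

Section mixed_derivatives.
Context {R : realType} {V : normedModType R}.

Let second_diff (f : V -> R) (x u v : V) (h : R) :=
  f (h *: u + (h *: v + x)) - f (h *: u + x) - f (h *: v + x) + f x.

(** The mean value theorem is used twice: along [u] for the difference of the sections of [f]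
    through [h v + x] and through [x], then along [v] for ['D_u f]. *)
Let second_diff_mean (f : V -> R) (x u v : V) (r h : R) :
  0 < h -> h * (`|u| + `|v|) < r ->
  (forall y, ball x r y -> differentiable f y) ->
  (forall y, ball x r y -> differentiable ('D_u f) y) ->
  exists2 p, ball x r p & second_diff f x u v h = h * h * 'D_v ('D_u f) p.
Proof.
move=> h0 hr df ddf.
have inb s t : 0 <= s <= h -> 0 <= t <= h -> ball x r (s *: u + (t *: v + x)).
  move=> /andP[s0 sh] /andP[t0 th]; rewrite -ball_normE/=.
  rewrite addrA opprD addrCA subrr addr0 normrN (le_lt_trans (ler_normD _ _))//.
  rewrite !normrZ (ger0_norm s0) (ger0_norm t0) (le_lt_trans _ hr)//.
  by rewrite mulrDr lerD// ler_wpM2r.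
have inb0 s : 0 <= s <= h -> ball x r (s *: u + x).
  by move=> sh; have := inb s 0 sh; rewrite scale0r add0r; apply; rewrite lexx ltW.
have [|c /andP[c0 ch] E1] := @mean_value _
    (fun s => f (s *: u + (h *: v + x)) - f (s *: u + x))
    (fun s => 'D_u f (s *: u + (h *: v + x)) - 'D_u f (s *: u + x)) 0 h (ltW h0).
  move=> s sh; apply: is_deriveB; apply: is_derive_line; apply: df.
    by apply: inb => //; rewrite lexx ltW.
  exact: inb0.
have [|d /andP[d0 dh] E2] := @mean_value _
    (fun t => 'D_u f (t *: v + (c *: u + x)))
    (fun t => 'D_v ('D_u f) (t *: v + (c *: u + x))) 0 h (ltW h0).
  move=> s sh; apply: is_derive_line; apply: ddf.
  by rewrite addrCA; apply: inb => //; rewrite c0.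
exists (c *: u + (d *: v + x)); first by apply: inb; rewrite ?c0 ?d0.
rewrite /second_diff.
move: E1; rewrite subr0 scale0r !add0r => E1.
have -> : f (h *: u + (h *: v + x)) - f (h *: u + x) - f (h *: v + x) + f x =
   f (h *: u + (h *: v + x)) - f (h *: u + x) - (f (h *: v + x) - f x).
  by ring.
rewrite E1; move: E2; rewrite subr0 scale0r add0r addrCA => ->.
by rewrite (addrCA (d *: v)); ring.
Qed.

Let dist_half (a b c e : R) :
  `|a - c| < e / 2 -> `|b - c| < e / 2 -> `|a - b| <= e.
Proof.
move=> ac bc; rewrite (le_trans (ler_distD c _ _))// (splitr e) lerD// ltW//.
by rewrite distrC.
Qed.

(** The second difference is symmetric in [u] and [v], so divided by [h * h] it is a value of each
    mixed derivative at some point near [x]; continuity of both at [x] concludes. *)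
Lemma schwarz (f : V -> R) (x u v : V) :
  (\forall y \near x, differentiable f y) ->
  (\forall y \near x, differentiable ('D_u f) y) ->
  (\forall y \near x, differentiable ('D_v f) y) ->
  {for x, continuous ('D_v ('D_u f))} -> {for x, continuous ('D_u ('D_v f))} ->
  'D_v ('D_u f) x = 'D_u ('D_v f) x.
Proof.
move=> df duf dvf cvu cuv.
apply/eqP; rewrite -subr_eq0 -normr_le0; apply/ler_addgt0Pl => e e0.
rewrite addr0.
have e20 : 0 < e / 2 by rewrite divr_gt0.
have : \forall y \near x, [/\ differentiable f y, differentiable ('D_u f) y,
    differentiable ('D_v f) y,
    `|'D_v ('D_u f) x - 'D_v ('D_u f) y| < e / 2 &
    `|'D_u ('D_v f) x - 'D_u ('D_v f) y| < e / 2].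
  have n1 : \forall y \near x, `|'D_v ('D_u f) x - 'D_v ('D_u f) y| < e / 2.
    by move/cvgrPdist_lt : cvu; apply.
  have n2 : \forall y \near x, `|'D_u ('D_v f) x - 'D_u ('D_v f) y| < e / 2.
    by move/cvgrPdist_lt : cuv; apply.
  apply: filterS (filterI df (filterI duf (filterI dvf (filterI n1 n2)))) => y.
  by move=> [? [? [? []]]].
move=> /nbhs_ballP[r r0 Hr].
have s0 : 0 < `|u| + `|v| + 1 by rewrite ltr_wpDl// addr_ge0.
have [h h0 hr] : exists2 h, 0 < h & h * (`|u| + `|v|) < r.
  exists (r / (`|u| + `|v| + 1)); first by rewrite divr_gt0.
  by rewrite mulrAC ltr_pdivrMr// ltr_pM2l// ltrDl.
have [p pb E1] := second_diff_mean h0 hr (fun y yb => let: And5 a _ _ _ _ := Hr y yb in a)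
  (fun y yb => let: And5 _ a _ _ _ := Hr y yb in a).
have hr' : h * (`|v| + `|u|) < r by rewrite addrC.
have [q qb E2] := second_diff_mean h0 hr' (fun y yb => let: And5 a _ _ _ _ := Hr y yb in a)
  (fun y yb => let: And5 _ _ a _ _ := Hr y yb in a).
have E : 'D_v ('D_u f) p = 'D_u ('D_v f) q.
  apply: (@mulfI _ (h * h)); first by rewrite mulf_neq0 ?gt_eqF.
  apply: etrans (esym E1) _; apply: etrans _ E2.
  by rewrite /second_diff addrCA; congr (_ + _); rewrite addrAC.
have [_ _ _ Hp _] := Hr _ pb; have [_ _ _ _ Hq] := Hr _ qb.
move: Hp Hq; rewrite E.
move: ('D_v ('D_u f) x) ('D_u ('D_v f) x) ('D_u ('D_v f) q) => a b c ac bc.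
exact: dist_half ac bc.
Qed.

End mixed_derivatives.

Section near_equality.
Context {R : realType} {V W : normedModType R}.

Lemma near0_differentiable (k : V -> W) x :
  (\forall y \near x, k y = 0) -> differentiable k x.
Proof.
move=> k0; have kx : k x = 0 := nbhs_singleton k0.
have H : k \o shift x = cst (k x) + (\0 : V -> W) +o_ (0 : V) id.
  apply/eqaddoP => e e0; move: k0; rewrite (near_shift 0 x) => k0.
  apply: filterS k0 => y /=.
  rewrite subr0 => ky; rewrite kx.
  have -> : (k \o shift x - (cst 0 + \0)) y = k (y + x) by rewrite /= fctE/= addr0 subr0.
  by rewrite ky normr0 mulr_ge0// ltW.
have c0 : continuous (\0 : V -> W) by exact: cst_continuous.
have E := @diff_unique R V W k (\0 : {linear V -> W}) x c0 H.
by apply/diff_locallyP; rewrite E.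
Qed.

(** [differentiable] refers to a selected differential, so it is not visibly a local notion; [g] is
    written as [f] plus a function that vanishes near [x]. *)
Lemma near_differentiable (f g : V -> W) x :
  (\forall y \near x, f y = g y) -> differentiable f x -> differentiable g x.
Proof.
move=> fg df; have -> : g = f + (g - f) by apply/funext => y /=; rewrite fctE/= addrC subrK.
apply: (differentiableD df); apply: near0_differentiable.
by apply: filterS fg => y fgy; rewrite -[LHS]/(g y - f y) fgy subrr.
Qed.

End near_equality.

Lemma near_continuous (T U : topologicalType) (f g : T -> U) x :
  (\forall y \near x, f y = g y) -> {for x, continuous f} ->
  {for x, continuous g}.
Proof.
move=> fg; rewrite /prop_for /continuous_at (nbhs_singleton fg) => cf.
apply: cvg_trans cf; apply: near_eq_cvg.
by apply: filterS fg => y ->.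
Qed.

Section row_valued.
Context {R : realType} {V : normedModType R} {n : nat}.

Lemma differentiable_coord_comp (f : V -> 'rV[R]_n) x i :
  differentiable f x -> differentiable (fun y => f y 0 i) x.
Proof.
move=> df; apply: (@differentiable_comp _ _ _ _ f (fun v : 'rV[R]_n => v 0 i)) => //.
exact: differentiable_coord.
Qed.

Lemma derive_coord (f : V -> 'rV[R]_n) x v i :
  derivable f x v -> 'D_v (fun y => f y 0 i) x = ('D_v f x) 0 i.
Proof. by move=> fv; rewrite (derive_mx fv) mxE. Qed.

(** Taking a coordinate commutes with [derive] where the function is derivable, hence the passage
    through equalities near [x]. *)
Lemma schwarz_row (f : V -> 'rV[R]_n) (x u v : V) :
  (\forall y \near x, differentiable f y) ->
  (\forall y \near x, differentiable ('D_u f) y) ->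
  (\forall y \near x, differentiable ('D_v f) y) ->
  {for x, continuous ('D_v ('D_u f))} -> {for x, continuous ('D_u ('D_v f))} ->
  'D_v ('D_u f) x = 'D_u ('D_v f) x.
Proof.
move=> df duf dvf cvu cuv; apply/rowP => i.
have D1 w : \forall y \near x, ('D_w f) y 0 i = 'D_w (fun z => f z 0 i) y.
  apply: filterS df => y dfy; apply: esym.
  exact: (derive_coord i (diff_derivable dfy)).
have D2 w w' : (\forall y \near x, differentiable ('D_w f) y) ->
    \forall y \near x, ('D_w' ('D_w f)) y 0 i = 'D_w' ('D_w (fun z => f z 0 i)) y.
  move=> dw.
  apply: filterS (filterI dw (near_join (D1 w))) => y [dwy D1y].
  rewrite -(derive_coord i (diff_derivable dwy)).
  exact: near_eq_derive D1y.
apply: etrans (nbhs_singleton (D2 u v duf)) _.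
apply: etrans _ (esym (nbhs_singleton (D2 v u dvf))).
have cc (g : V -> 'rV[R]_n) (h : V -> R) : {for x, continuous g} ->
    (\forall y \near x, g y 0 i = h y) -> {for x, continuous h}.
  move=> cg gh; have c1 : {for x, continuous (fun y => g y 0 i)}.
    apply: (@continuous_comp _ _ _ g (fun v : 'rV[R]_n => v 0 i)) => //.
    exact: coord_continuous.
  exact: near_continuous gh c1.
have dD (w : V) : (\forall y \near x, differentiable ('D_w f) y) ->
    \forall y \near x, differentiable ('D_w (fun z => f z 0 i)) y.
  move=> dw.
  apply: filterS (filterI dw (near_join (D1 w))) => y [dwy D1y].
  by apply: near_differentiable D1y _; exact: differentiable_coord_comp.
apply: schwarz.
- by apply: filterS df => y; exact: differentiable_coord_comp.
- exact: dD.
- exact: dD.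
- exact: (cc _ _ cvu (D2 u v duf)).
- exact: (cc _ _ cuv (D2 v u dvf)).
Qed.

End row_valued.

Section product_derivatives.
Context {R : realType} {V1 V2 W : normedModType R}.
Implicit Type f : V1 * V2 -> W.

Lemma derive_fibre f z w b : 'D_(0, b) f (z, w) = 'D_b (fun w => f (z, w)) w.
Proof.
rewrite /derive; set g1 := fun h => h^-1 *: _; set g2 := fun h => h^-1 *: _.
suff -> : g1 = g2 by [].
apply/funext => h; rewrite /g1 /g2 /=; congr (_ *: (f _ - _)).
by rewrite [LHS]surjective_pairing/= scaler0 add0r.
Qed.

Lemma derive_base f z w a : 'D_(a, 0) f (z, w) = 'D_a (fun z => f (z, w)) z.
Proof.
rewrite /derive; set g1 := fun h => h^-1 *: _; set g2 := fun h => h^-1 *: _.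
suff -> : g1 = g2 by [].
apply/funext => h; rewrite /g1 /g2 /=; congr (_ *: (f _ - _)).
by rewrite [LHS]surjective_pairing/= scaler0 add0r.
Qed.

Lemma derive_pair f q a b : differentiable f q ->
  'D_(a, b) f q = 'D_(a, 0) f q + 'D_(0, b) f q.
Proof.
move=> df; rewrite -deriveDv//; congr ('D_ _ _ _).
by rewrite [RHS]surjective_pairing/= addr0 add0r.
Qed.

End product_derivatives.

Section homogeneous.
Context {R : realType} {V : normedModType R}.

(** Differentiate [f (a w)] at [a = 1], once by the chain rule and once by homogeneity. *)
Lemma euler_homogeneous (f : V -> R) k w :
  (forall a, 0 < a -> f (a *: w) = a ^+ k * f w) -> differentiable f w ->
  'D_w f w = k%:R * f w.
Proof.
move=> hf df.
have df1 : differentiable f ((1 : R) *: w + 0) by rewrite scale1r addr0.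
have [_ E1] := is_derive_line df1.
have := @near_eq_derive R R R (fun h => f (h *: w + 0)) (fun h => h ^+ k * f w) 1 1.
rewrite E1 scale1r addr0 => ->; last first.
  by near=> h; rewrite addr0 hf//; near: h; exact: lt_nbhsr.
rewrite deriveMr//; last exact: exprn_derivable.
by rewrite exp_derive expr1n /GRing.scale/= !mulr1 mulrC.
Unshelve. all: by end_near. Qed.

End homogeneous.

Section more_derivatives.
Context {R : realType}.

Lemma is_derive_scale (U W : normedModType R) (f : U -> R) (g : U -> W) x v df dg :
  is_derive x v f df -> is_derive x v g dg ->
  is_derive x v (fun s => f s *: g s) (f x *: dg + df *: g x).
Proof.
move=> [fx fE] [gx gE].
have cf : f (h *: v + x) @[h --> 0^'] --> f x.
  have f1 : differentiable (fun h : R => f (h *: v + x)) 0.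
    by apply/derivable1_diffP; move/derivable1P : fx.
  have := differentiable_continuous f1; rewrite /prop_for /continuous_at.
  rewrite scale0r add0r => H; exact: cvg_trans (cvg_app _ (@nbhs_dnbhs _ _)) H.
have H : h^-1 *: (f (h *: v + x) *: g (h *: v + x) - f x *: g x) @[h --> 0^'] -->
    f x *: dg + df *: g x.
  have -> : (fun h : R => h^-1 *: (f (h *: v + x) *: g (h *: v + x) - f x *: g x)) =
     (fun h : R => f (h *: v + x) *: (h^-1 *: (g (h *: v + x) - g x)) +
        (h^-1 *: (f (h *: v + x) - f x)) *: g x).
    apply/funext => h.
    rewrite -[X in _ = _ + X]/((h^-1 * (f (h *: v + x) - f x)) *: g x) -scalerA.
    rewrite [X in _ = X + _]scalerA (mulrC (f _)) -scalerA -scalerDr.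
    by congr (_ *: _); rewrite scalerBr [X in _ = _ + X]scalerBl addrA subrK.
  apply: cvgD.
    apply: cvgZ => //; rewrite -gE; exact: gx.
  have cf' : h^-1 *: (f (h *: v + x) - f x) @[h --> 0^'] --> df by rewrite -fE; exact: fx.
  by apply: cvgZ; [exact: cf'|exact: cvg_cst].
split; first by apply/cvg_ex; eexists; exact: H.
exact: cvg_lim H.
Qed.

(** This differentiates a function known only through an inequality, such as the displacement [tau]
    selected point by point in [boundary_curve]. *)
Lemma is_derive_squeeze (f g : R -> R) (k : R) : f 0 = 0 -> g 0 = 0 ->
  (\forall s \near (0 : R), `|f s| <= k * `|g s|) -> is_derive (0 : R) (1 : R) g 0 ->
  is_derive (0 : R) (1 : R) f 0.
Proof.
move=> f0 g0 fg [gd gE].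
have Hg : h^-1 *: (g (h *: (1 : R) + 0) - g 0) @[h --> 0^'] --> (0 : R).
  have : h^-1 *: (g (h *: (1 : R) + 0) - g 0) @[h --> 0^'] --> 'D_1 g 0 by exact: gd.
  by rewrite gE.
have H : h^-1 *: (f (h *: (1 : R) + 0) - f 0) @[h --> 0^'] --> (0 : R).
  apply/cvgrPdist_lt => e e0.
  have k0 : 0 < `|k| + 1 by rewrite ltr_wpDl.
  have ek : 0 < e / (`|k| + 1) by rewrite divr_gt0.
  have H1 : \forall h \near 0^', `|0 - h^-1 *: (g (h *: (1 : R) + 0) - g 0)| < e / (`|k| + 1).
    by move/cvgrPdist_lt : Hg; apply.
  have H2 : \forall h \near 0^', `|f h| <= k * `|g h| by exact: cvg_within fg.
  apply: filterS (filterI H1 H2) => h [].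
  rewrite !sub0r !normrN f0 g0 !subr0 !addr0 /GRing.scale/= !mulr1 !normrM => h1 h2.
  rewrite ltr_pdivlMr// in h1; apply: le_lt_trans h1.
  rewrite -mulrA ler_wpM2l// (le_trans h2)// mulrC ler_wpM2l//.
  by rewrite (le_trans (ler_norm _))// lerDl.
split; first by apply/cvg_ex; exists 0; exact: H.
exact: cvg_lim H.
Qed.

End more_derivatives.

Lemma is_derive_pair (R : realType) (U V W : normedModType R)
    (f : U -> V) (g : U -> W) x v df dg :
  is_derive x v f df -> is_derive x v g dg ->
  is_derive x v (fun y => (f y, g y)) (df, dg).
Proof.
move=> [fx fE] [gx gE].
have f1 : differentiable (fun h : R => f (h *: v + x)) 0.
  by apply/derivable1_diffP; move/derivable1P : fx.
have g1 : differentiable (fun h : R => g (h *: v + x)) 0.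
  by apply/derivable1_diffP; move/derivable1P : gx.
have fg1 := differentiable_pair f1 g1.
split; first by apply/derivable1P; move/derivable1_diffP : fg1.
apply: etrans (derive_line _ _ _) _; apply: etrans (deriveE _ fg1) _.
rewrite diff_pair// -fE -gE; congr (_, _).
  by apply: etrans (esym (deriveE _ f1)) _; exact: esym (derive_line _ _ _).
by apply: etrans (esym (deriveE _ g1)) _; exact: esym (derive_line _ _ _).
Qed.

(** * Charts and the fundamental tensor *)

Section charts.
Context {R : realType} {n : nat} {M : smoothManifold R n}.
Local Notation E := 'rV[R]_n.
Implicit Types c d : chart R n M.

Definition overlap c d : set E := ccod c `&` cinv c @^-1` cdom d.

Definition transition c d : E -> E := cto d \o cinv c.

Lemma overlap_open c d : open (overlap c d).
Proof.
rewrite openE => z [cz dz]; apply: filterI.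
  by apply: open_nbhs_nbhs; split => //; exact: ccod_open.
by apply: (cinv_continuous cz); apply: open_nbhs_nbhs; split => //; exact: cdom_open.
Qed.

Lemma overlap_transition c d z : overlap c d z -> overlap d c (transition c d z).
Proof.
move=> [cz dz]; split; first exact: cto_cod.
by rewrite /= /transition /= ctoK//; exact: cinv_dom.
Qed.

Lemma cinv_transition c d z : overlap c d z -> cinv d (transition c d z) = cinv c z.
Proof. by move=> [cz dz]; rewrite /transition/= ctoK. Qed.

Lemma transitionK c d z : overlap c d z -> transition d c (transition c d z) = z.
Proof.
by move=> [cz dz]; rewrite /transition/= ctoK// cinvK.
Qed.

Lemma near_overlap c d z : overlap c d z -> \forall y \near z, overlap c d y.
Proof. by move=> oz; apply: open_nbhs_nbhs; split=> //; exact: overlap_open. Qed.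

Lemma transition_C3 c d z : atlas c -> atlas d -> overlap c d z ->
  [/\ differentiable (transition c d) z,
      forall u, differentiable ('D_u (transition c d)) z &
      forall u v, {for z, continuous ('D_v ('D_u (transition c d)))}].
Proof.
move=> hc hd oz; have [H0 H1] := atlas_smooth hc hd 3.
split; first exact: H0.
  by move=> u; have [H _] := H1 u; exact: H.
move=> u v; have [_ H] := H1 u; have [H' _] := H v.
by apply: differentiable_continuous; exact: H'.
Qed.

Lemma transition_schwarz c d z u v : atlas c -> atlas d -> overlap c d z ->
  'D_v ('D_u (transition c d)) z = 'D_u ('D_v (transition c d)) z.
Proof.
move=> hc hd oz.
have H := near_overlap oz.
have [_ _ H3] := transition_C3 hc hd oz.
apply: schwarz_row; [| | |exact: H3|exact: H3].
- by apply: filterS H => y /(transition_C3 hc hd)[].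
- by apply: filterS H => y /(transition_C3 hc hd)[].
- by apply: filterS H => y /(transition_C3 hc hd)[].
Qed.

Lemma derive_transition_comp c d e z w : atlas c -> atlas d -> atlas e ->
  overlap c d z -> overlap c e z ->
  'D_('D_w (transition c d) z) (transition d e) (transition c d z) =
  'D_w (transition c e) z.
Proof.
move=> hc hd he od oe.
have [T1 _ _] := transition_C3 hc hd od.
have ode : overlap d e (transition c d z).
  have [? _] := overlap_transition od.
  by split=> //=; rewrite cinv_transition//; case: oe.
have [T2 _ _] := transition_C3 hd he ode.
have H : is_derive z w (transition c d) ('D_w (transition c d) z).
  by split=> //; exact: diff_derivable.
have [_ <-] := is_derive_comp T2 H.
apply: near_eq_derive; apply: filterS (near_overlap od) => y oy.
by rewrite /= {1}/transition/= cinv_transition.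
Qed.

Lemma transition_self c z : ccod c z -> overlap c c z.
Proof. by move=> cz; split=> //; exact: cinv_dom. Qed.

Lemma derive_transition_id c z w : ccod c z -> 'D_w (transition c c) z = w.
Proof.
move=> cz; rewrite -[RHS](derive_id z w).
apply: near_eq_derive; apply: filterS (near_overlap (transition_self cz)) => y [cy _].
by rewrite /transition/= cinvK.
Qed.

Lemma derive_transitionK c d z w : atlas c -> atlas d -> overlap c d z ->
  'D_('D_w (transition c d) z) (transition d c) (transition c d z) = w.
Proof.
move=> hc hd oz; have cz : ccod c z by case: oz.
rewrite derive_transition_comp//; last exact: transition_self.
exact: derive_transition_id.
Qed.

Lemma overlap_chart_at c z : ccod c z -> overlap c (chart_at (cinv c z)) z.
Proof. by move=> cz; split=> //; exact: chart_at_dom. Qed.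

Lemma tangent_ofE c z w :
  tangent_of c z w = 'D_w (transition c (chart_at (cinv c z))) z.
Proof. by []. Qed.

Lemma transition_chart_at c z : atlas c -> ccod c z ->
  differentiable (transition c (chart_at (cinv c z))) z.
Proof.
move=> hc cz; have [] := transition_C3 hc (chart_at_atlas (cinv c z)) (overlap_chart_at cz).
by [].
Qed.

Lemma tangent_ofZ c z a w : atlas c -> ccod c z ->
  tangent_of c z (a *: w) = a *: tangent_of c z w.
Proof. by move=> hc cz; apply: deriveZv; exact: transition_chart_at. Qed.

Lemma tangent_ofN c z w : atlas c -> ccod c z ->
  tangent_of c z (- w) = - tangent_of c z w.
Proof. by move=> hc cz; apply: deriveNv; exact: transition_chart_at. Qed.

Lemma tangent_of_eq0 c z w : atlas c -> ccod c z ->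
  tangent_of c z w = 0 -> w = 0.
Proof.
move=> hc cz w0.
have := derive_transitionK w hc (chart_at_atlas (cinv c z)) (overlap_chart_at cz).
by rewrite -tangent_ofE w0 derive0.
Qed.

Lemma tangent_of_transition c d z w : atlas c -> atlas d -> overlap c d z ->
  tangent_of d (transition c d z) ('D_w (transition c d) z) = tangent_of c z w.
Proof.
move=> hc hd oz; rewrite !tangent_ofE cinv_transition//.
apply: derive_transition_comp => //; first exact: chart_at_atlas.
by case: oz => cz _; exact: overlap_chart_at.
Qed.

Lemma near_ccod c z : ccod c z -> \forall y \near z, ccod c y.
Proof. by move=> cz; apply: open_nbhs_nbhs; split=> //; exact: ccod_open. Qed.

Lemma near_cdom c p : cdom c p -> \forall q \near p, cdom c q.
Proof. by move=> cp; apply: open_nbhs_nbhs; split=> //; exact: cdom_open. Qed.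

Lemma slit_domain_open c : open (slit_domain c).
Proof.
rewrite openE => -[z w] [/= cz w0].
have nz := near_ccod cz.
have nw : \forall v \near w, v != 0.
  exact: (cvgr_neq0 _ (@cvg_id _ (nbhs w)) w0).
by exists (ccod c, [set v | v != 0]).
Qed.

Lemma near_slit c q : slit_domain c q -> \forall p \near q, slit_domain c p.
Proof. by move=> sq; apply: open_nbhs_nbhs; split=> //; exact: slit_domain_open. Qed.

End charts.

(* Unification otherwise unfolds [derive] and diverges. *)
#[local] Opaque derive.

Section pair_space.
Context {R : realType} {n : nat}.
Local Notation E := 'rV[R]_n.

Definition pair_basis (i : 'I_n + 'I_n) : E * E :=
  match i with inl i => (basis_vec R i, 0) | inr i => (0, basis_vec R i) end.

Definition pair_coord (i : 'I_n + 'I_n) (q : E * E) : R :=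
  match i with inl i => q.1 0 i | inr i => q.2 0 i end.

Lemma fst_basis (b : E) : ((b, 0) : E * E) = \sum_l b 0 l *: ((basis_vec R l, 0) : E * E).
Proof.
apply: esym; rewrite [in RHS](row_basis b); elim/big_rec2 : _ => // i a _ _ ->.
by rewrite [LHS]surjective_pairing/= scaler0 addr0.
Qed.

Lemma snd_basis (b : E) : ((0, b) : E * E) = \sum_l b 0 l *: ((0, basis_vec R l) : E * E).
Proof.
apply: esym; rewrite [in RHS](row_basis b); elim/big_rec2 : _ => // i a _ _ ->.
by rewrite [LHS]surjective_pairing/= scaler0 addr0.
Qed.

Lemma pair_basisE (q : E * E) : q = \sum_i pair_coord i q *: pair_basis i.
Proof.
rewrite big_sumType/=.
by rewrite -fst_basis -snd_basis [RHS]surjective_pairing/= addr0 add0r -surjective_pairing.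
Qed.

Lemma derive_fibre_basis (f : E * E -> R) q (b : E) : differentiable f q ->
  'D_(0, b) f q = \sum_l b 0 l * 'D_(0, basis_vec R l) f q.
Proof.
move=> df; rewrite (snd_basis b) (deriveE _ df) linear_sum.
by apply: eq_bigr => l _; rewrite linearZ (deriveE _ df).
Qed.

Lemma derive_base_basis (f : E * E -> R) q (b : E) : differentiable f q ->
  'D_(b, 0) f q = \sum_l b 0 l * 'D_(basis_vec R l, 0) f q.
Proof.
move=> df; rewrite (fst_basis b) (deriveE _ df) linear_sum.
by apply: eq_bigr => l _; rewrite linearZ (deriveE _ df).
Qed.

Lemma derivable_base (f : E * E -> R) (z w a : E) : differentiable f (z, w) ->
  derivable (fun y => f (y, w)) z a.
Proof.
move=> df; have dz : is_derive z a (fun z : E => (z, w)) ((a, 0) : E * E).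
  exact: is_derive_pair.
by have [] := @is_derive_comp _ _ _ _ f (fun z => (z, w)) z a _ df dz.
Qed.

Lemma lip_at_fst (h : E -> R) (z w : E) :
  lip_at h z -> lip_at (fun q : E * E => h q.1) (z, w).
Proof.
move=> lh; apply: (@lip_at_comp _ _ _ _ h (fun q : E * E => q.1)) => //.
apply: (@lip_atI _ _ _ _ _ setT 1); first exact: filterT.
by move=> p q _ _; rewrite mul1r [leRHS]prod_normE/= le_max lexx.
Qed.

Lemma pair_coord_le i (q : E * E) : `|pair_coord i q| <= `|q|.
Proof.
rewrite [leRHS]prod_normE/= le_max.
by case: i => i /=; rewrite coord_norm_le ?orbT.
Qed.

Lemma pair_coord_lip i (q : E * E) : lip_at (pair_coord i) q.
Proof.
apply: (@lip_atI _ _ _ _ _ setT 1); first exact: filterT.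
move=> p p' _ _; rewrite mul1r (le_trans _ (pair_coord_le i _))//.
by case: i => i /=; rewrite !mxE.
Qed.

Lemma C1_lip_at_pair (f : E * E -> R) q :
  (\forall p \near q, differentiable f p) ->
  (forall v, lip_at ('D_v f) q) -> lip_at f q.
Proof.
by move=> df lf; apply: (C1_lip_at pair_basisE pair_coord_le df) => i; exact: lf.
Qed.

Lemma C1_lip_at_row (f : E -> R) z :
  (\forall y \near z, differentiable f y) ->
  (forall v, lip_at ('D_v f) z) -> lip_at f z.
Proof.
move=> df lf.
exact: (@C1_lip_at R E 'I_n (@basis_vec R n) (fun i (v : E) => v 0 i) f z
  (@row_basis _ _) (fun i v => coord_norm_le v i) df (fun i => lf _)).
Qed.

Lemma differentiable_snd_coord i (q : E * E) :
  differentiable (fun q : E * E => q.2 0 i) q.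
Proof.
apply: (@differentiable_coord_comp _ _ _ (fun q : E * E => q.2)).
by apply: (@linear_differentiable R _ E (@snd E E : {linear _ -> _})) => p; exact: cvg_snd.
Qed.

End pair_space.

(** The chain rule for the map that sends [v] to [a^-1 v]. Homogeneity is asked only near [w],
    because for the fibre derivatives of F^2 it is established at nonzero vectors. *)
Lemma derive_homogeneous (R : realType) (V : normedModType R)
    (f : V -> R) k (w b : V) (a : R) :
  (\forall v \near w, f (a *: v) = a ^+ k.+1 * f v) -> 0 < a ->
  differentiable f w -> 'D_b f (a *: w) = a ^+ k * 'D_b f w.
Proof.
move=> hf a0 df.
have aw : a^-1 *: (a *: w) = w by rewrite scalerA mulVf ?gt_eqF// scale1r.
have fE : \forall v \near a *: w, f v = a ^+ k.+1 * f (a^-1 *: v).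
  have ca : {for a *: w, continuous (fun v : V => a^-1 *: v)}.
    exact: scaler_continuous.
  have hf' : \forall v \near a^-1 *: (a *: w), f (a *: v) = a ^+ k.+1 * f v.
    by rewrite aw.
  have H : \forall v \near a *: w,
      f (a *: (a^-1 *: v)) = a ^+ k.+1 * f (a^-1 *: v) by exact: ca _ hf'.
  apply: filterS H => v <-.
  by rewrite scalerA divff ?gt_eqF// scale1r.
have dfa : differentiable f (a^-1 *: (a *: w)) by rewrite aw.
have H : is_derive (a *: w) b (fun v => f (a^-1 *: v)) ('D_(a^-1 *: b) f w).
  have := @is_derive_comp _ _ _ _ f (fun v => a^-1 *: v) (a *: w) b (a^-1 *: b) dfa.
  by rewrite aw; apply.
apply: etrans (near_eq_derive b fE) _.
apply: etrans (deriveMl (a ^+ k.+1) _) _; first by case: H.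
case: H => _ ->; rewrite deriveZv// -[_ *: _]/(_ * _) mulrA; congr (_ * _).
by rewrite exprSr mulfK// gt_eqF.
Qed.

(** * Euler's relations between F^2 and the fundamental tensor *)

Section fundamental_tensor_theory.
Context {R : realType} {n : nat} {M : smoothManifold R n}.
Variables (F : M -> 'rV[R]_n -> R) (F_finsler : finsler_metric F).
Variables (c : chart R n M) (hc : atlas c).
Local Notation E := 'rV[R]_n.
Local Notation L := (local_sq F c).
Local Notation g := (fundamental_tensor F c).
Local Notation e := (basis_vec R).
Let fibre (z : E) : E -> R := fun w => L (z, w).

Lemma local_sqZ z w a : ccod c z -> 0 < a -> L (z, a *: w) = a ^+ 2 * L (z, w).
Proof.
move=> cz a0; rewrite /local_sq/= tangent_ofZ// (finsler_homogeneous F_finsler)//.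
by rewrite exprMn.
Qed.

Lemma derive2_fibre z w a b :
  'D_(0, a) ('D_(0, b) L) (z, w) = 'D_a ('D_b (fibre z)) w.
Proof.
apply: etrans (derive_fibre ('D_(0, b) L) z w a) _.
apply: (congr1 (fun f : E -> R => 'D_a f w)).
by apply/funext => v; exact: (derive_fibre L z v b).
Qed.

Lemma fibre_C2 (z w : E) : ccod c z -> w != 0 ->
  [/\ differentiable (fibre z) w, forall b, differentiable ('D_b (fibre z)) w &
      forall a b, {for w, continuous ('D_a ('D_b (fibre z)))}].
Proof.
move=> cz w0; have [H0 H1] := finsler_fibre_C2 F_finsler hc cz.
split; first exact: H0.
  by move=> b; have [H _] := H1 b; exact: H.
by move=> a b; have [_ H] := H1 b; exact: H.
Qed.

Lemma near_neq0 (w : E) : w != 0 -> \forall v \near w, v != 0.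
Proof. by move=> w0; exact: (cvgr_neq0 _ (@cvg_id _ (nbhs w)) w0). Qed.

Lemma tensorE z w i j : g (z, w) i j = 2^-1 * 'D_(e i) ('D_(e j) (fibre z)) w.
Proof. by rewrite mxE derive2_fibre. Qed.

Lemma tensor_sym (z w : E) : ccod c z -> w != 0 -> (g (z, w))^T = g (z, w).
Proof.
move=> cz w0; apply/matrixP => i j; apply: etrans (mxE _ _ _ _) _.
apply: etrans (tensorE z w j i) _; apply: etrans _ (esym (tensorE z w i j)).
apply: (congr1 ( *%R 2^-1)).
have H := near_neq0 w0.
have [_ _ H3] := fibre_C2 cz w0.
apply: schwarz; [| | |exact: H3|exact: H3].
- by apply: filterS H => y /(fibre_C2 cz)[].
- by apply: filterS H => y /(fibre_C2 cz)[].
- by apply: filterS H => y /(fibre_C2 cz)[].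
Qed.

(** Euler's relation for a fibre derivative of F^2, which is homogeneous of degree 1. Together with
    [energyE] it reduces the base derivatives of F^2, on which the definition of a metric is silent,
    to those of the tensor. *)
Lemma momentumE (z w : E) j : ccod c z -> w != 0 ->
  'D_(0, e j) L (z, w) = 2 * \sum_i w 0 i * g (z, w) i j.
Proof.
move=> cz w0; have [d1 d2 _] := fibre_C2 cz w0.
apply: etrans (derive_fibre L z w (e j)) _.
have hom a : 0 < a -> 'D_(e j) (fibre z) (a *: w) = a ^+ 1 * 'D_(e j) (fibre z) w.
  move=> a0; apply: derive_homogeneous => //.
  by apply: filterE => v; exact: local_sqZ.
have := @euler_homogeneous R E ('D_(e j) (fibre z)) 1 w hom (d2 (e j)); rewrite mul1r => H; apply: etrans (esym H) _.
rewrite (derive_basis w (d2 (e j))) mulr_sumr; apply: eq_bigr => i _.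
rewrite tensorE mulrCA; congr (_ * _).
by rewrite mulrA divff ?mul1r// pnatr_eq0.
Qed.

Lemma energyE (z w : E) : ccod c z -> w != 0 ->
  L (z, w) = \sum_j w 0 j * (\sum_i w 0 i * g (z, w) i j).
Proof.
move=> cz w0; have [d1 _ _] := fibre_C2 cz w0.
have hom a : 0 < a -> fibre z (a *: w) = a ^+ 2 * fibre z w.
  by move=> a0; exact: local_sqZ.
have := @euler_homogeneous R E (fibre z) 2 w hom d1; rewrite (derive_basis w d1) => H.
apply: (@mulfI _ 2); first by rewrite pnatr_eq0.
rewrite -[LHS]H mulr_sumr; apply: eq_bigr => j _.
rewrite mulrCA; apply: (congr1 ( *%R (w 0 j))).
apply: etrans _ (momentumE j cz w0).
exact: (esym (derive_fibre L z w (e j))).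
Qed.

Lemma tensor_unit q : slit_domain c q -> g q \in unitmx.
Proof.
move=> sq; rewrite -row_free_unit -kermx_eq0; apply/negPn/negP => /rowV0Pn[v].
move=> /sub_kermxP vg v0.
have := finsler_posdef F_finsler hc sq v0.
by rewrite vg mul0mx mxE ltxx.
Qed.

Lemma tensor_C1 q i j : slit_domain c q ->
  [/\ differentiable (fun p => g p i j) q,
      forall v, lip_at ('D_v (fun p => g p i j)) q &
      lip_at (fun p => g p i j) q].
Proof.
move=> sq; have [H0 H1] := finsler_C11 F_finsler hc i j.
have H2 v : lip_at ('D_v (fun p => g p i j)) q.
  exact: (locally_lipschitz_lip_at (@slit_domain_open _ _ _ c) sq (H1 v)).
split=> //; first exact: H0.
apply: C1_lip_at_pair => //.
by apply: filterS (near_slit sq) => p; exact: H0.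
Qed.

End fundamental_tensor_theory.

Section geodesic_coefficients.
Context {R : realType} {n : nat} {M : smoothManifold R n}.
Variables (F : M -> 'rV[R]_n -> R) (F_finsler : finsler_metric F).
Variables (c : chart R n M) (hc : atlas c).
Local Notation E := 'rV[R]_n.
Local Notation L := (local_sq F c).
Local Notation g := (fundamental_tensor F c).
Local Notation e := (basis_vec R).

Lemma derive_lincomb (s : 'I_n -> R) (h : 'I_n -> E -> R) z v :
  (forall i, derivable (h i) z v) ->
  is_derive z v (fun z => \sum_i s i * h i z) (\sum_i s i * 'D_v (h i) z).
Proof.
move=> dh.
have -> : (fun z => \sum_i s i * h i z) = \sum_i (fun z => s i * h i z).
  by apply/funext => y; rewrite fct_sumE.
apply: is_derive_sum => i.
have H : is_derive z v (h i) ('D_v (h i) z) by split.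
exact: (@is_deriveZ R E R (h i) (s i) z v _ H).
Qed.

Lemma tensor_base_derivable i j z w v : slit_domain c (z, w) ->
  derivable (fun z => g (z, w) i j) z v.
Proof.
move=> sq; have [dg _ _] := tensor_C1 F_finsler hc i j sq.
exact: (@derivable_base _ _ (fun p => g p i j)).
Qed.

Lemma near_base (P : E * E -> Prop) (z w : E) : (\forall q \near (z, w), P q) ->
  \forall y \near z, P (y, w).
Proof.
move=> [[A B] [/= Az Bw] AB]; apply: filterS Az => y Ay; apply: AB; split=> //=.
exact: nbhs_singleton.
Qed.

Lemma momentum_base_derive (z w v : E) j : slit_domain c (z, w) ->
  'D_(v, 0) ('D_(0, e j) L) (z, w) =
  2 * \sum_i w 0 i * 'D_(v, 0) (fun p => g p i j) (z, w).
Proof.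
move=> sq; apply: etrans (derive_base ('D_(0, e j) L) z w v) _.
have H : \forall y \near z, 'D_(0, e j) L (y, w) = 2 * \sum_i w 0 i * g (y, w) i j.
  apply: filterS (near_base (near_slit sq)) => y [/= cy w0].
  exact: momentumE.
apply: etrans (near_eq_derive v H) _.
have dh i : derivable (fun y => g (y, w) i j) z v by exact: tensor_base_derivable.
have D := derive_lincomb (fun i => w 0 i) dh.
apply: etrans (deriveMl 2 _) _; first by case: D.
apply: (congr1 ( *%R 2)); apply: etrans (@derive_val _ _ _ _ _ _ _ D) _.
apply: eq_bigr => i _; apply: (congr1 ( *%R (w 0 i))).
exact: esym (derive_base (fun p => g p i j) z w v).
Qed.

Lemma energy_base_derive (z w v : E) : slit_domain c (z, w) ->
  'D_(v, 0) L (z, w) =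
  \sum_j w 0 j * (\sum_i w 0 i * 'D_(v, 0) (fun p => g p i j) (z, w)).
Proof.
move=> sq; apply: etrans (derive_base L z w v) _.
have H : \forall y \near z, L (y, w) = \sum_j w 0 j * (\sum_i w 0 i * g (y, w) i j).
  apply: filterS (near_base (near_slit sq)) => y [/= cy w0].
  exact: energyE.
apply: etrans (near_eq_derive v H) _.
have dh i j : derivable (fun y => g (y, w) i j) z v by exact: tensor_base_derivable.
have D j := derive_lincomb (fun i => w 0 i) (dh^~ j).
have dD j : derivable (fun y => \sum_i w 0 i * g (y, w) i j) z v by case: (D j).
apply: etrans (@derive_val _ _ _ _ _ _ _ (derive_lincomb (fun i => w 0 i) dD)) _.
apply: eq_bigr => j _; apply: (congr1 ( *%R (w 0 j))).
apply: etrans (@derive_val _ _ _ _ _ _ _ (D j)) _.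
apply: eq_bigr => i _; apply: (congr1 ( *%R (w 0 i))).
exact: esym (derive_base (fun p => g p i j) z w v).
Qed.

Lemma differentiable_lincomb (h : 'I_n -> E * E -> R) q :
  (forall i, differentiable (h i) q) ->
  differentiable (fun p : E * E => \sum_i p.2 0 i * h i p) q.
Proof.
move=> dh.
have -> : (fun p : E * E => \sum_i p.2 0 i * h i p) =
    \sum_i ((fun p : E * E => p.2 0 i) * h i).
  by apply/funext => y; rewrite fct_sumE.
apply: differentiable_sum => i; apply: differentiableM => //.
exact: differentiable_snd_coord.
Qed.

Lemma momentum_differentiable q j : slit_domain c q ->
  differentiable ('D_(0, e j) L) q.
Proof.
move=> sq.
apply: (@near_differentiable _ _ _ (fun p : E * E => 2 * \sum_i p.2 0 i * g p i j)).
  apply: filterS (near_slit sq) => -[z w] [/= cz w0].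
  exact: esym (momentumE F_finsler hc j cz w0).
apply: (@differentiableZ _ _ _ _ 2); apply: differentiable_lincomb => i.
by have [] := tensor_C1 F_finsler hc i j sq.
Qed.

Lemma local_sq_differentiable q : slit_domain c q -> differentiable L q.
Proof.
move=> sq.
apply: (@near_differentiable _ _ _
  (fun p : E * E => \sum_j p.2 0 j * \sum_i p.2 0 i * g p i j)).
  apply: filterS (near_slit sq) => -[z w] [/= cz w0].
  exact: esym (energyE F_finsler hc cz w0).
apply: differentiable_lincomb => j; apply: differentiable_lincomb => i.
by have [] := tensor_C1 F_finsler hc i j sq.
Qed.

(** The spray with its index lowered by the tensor. It is half of the part of the Euler-Lagrange
    expression of F^2 that does not involve the acceleration. *)
Definition force j (q : E * E) : R :=
  2^-1 * (\sum_k 'D_(e k, 0) ('D_(0, e j) L) q * q.2 0 k) - 2^-1 * 'D_(e j, 0) L q.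

Lemma geodesic_coefE q :
  geodesic_coef F c q = \row_i \sum_j invmx (g q) i j * force j q.
Proof. by []. Qed.

Lemma snd_coord_lip i (q : E * E) : lip_at (fun p : E * E => p.2 0 i) q.
Proof. exact: (pair_coord_lip (inr i)). Qed.

Lemma force_lip q j : slit_domain c q -> lip_at (force j) q.
Proof.
move=> sq.
have lg i k v : lip_at ('D_v (fun p => g p i k)) q.
  by have [] := tensor_C1 F_finsler hc i k sq.
apply: lip_atB; apply: lip_atM; try exact: lip_at_cst.
  apply: lip_at_sum => k _; apply: lip_atM; last exact: snd_coord_lip.
  apply: (@lip_at_near _ _ _
    (fun p : E * E => 2 * \sum_i p.2 0 i * 'D_(e k, 0) (fun p => g p i j) p)).
    apply: filterS (near_slit sq) => -[z w] sp.
    exact: esym (momentum_base_derive _ _ sp).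
  apply: lip_atM; first exact: lip_at_cst.
  by apply: lip_at_sum => i _; apply: lip_atM; [exact: snd_coord_lip|exact: lg].
apply: (@lip_at_near _ _ _ (fun p : E * E =>
  \sum_k p.2 0 k * (\sum_i p.2 0 i * 'D_(e j, 0) (fun p => g p i k) p))).
  apply: filterS (near_slit sq) => -[z w] sp.
  exact: esym (energy_base_derive _ sp).
apply: lip_at_sum => k _; apply: lip_atM; first exact: snd_coord_lip.
by apply: lip_at_sum => i _; apply: lip_atM; [exact: snd_coord_lip|exact: lg].
Qed.

Lemma geodesic_coef_lip q : slit_domain c q -> lip_at (geodesic_coef F c) q.
Proof.
move=> sq; apply: lip_at_row => i.
apply: (@lip_at_near _ _ _ (fun q => \sum_j invmx (g q) i j * force j q)).
  by near=> p; rewrite geodesic_coefE mxE.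
apply: lip_at_sum => j _; apply: lip_atM; last exact: force_lip.
apply: lip_at_invmx; first exact: tensor_unit.
by move=> k l; have [] := tensor_C1 F_finsler hc k l sq.
Unshelve. all: by end_near. Qed.

End geodesic_coefficients.

(** The force vanishes at zero velocity, whatever value [invmx] takes there. Only [F p 0 = 0] is
    assumed, so that the lemma applies to [reverse F] as it stands. *)
Lemma geodesic_coef_zero (R : realType) n (M : smoothManifold R n)
    (F : M -> 'rV[R]_n -> R) c z : (forall p, F p 0 = 0) ->
  geodesic_coef F c (z, 0) = 0.
Proof.
move=> F0; apply/rowP => i; rewrite geodesic_coefE !mxE big1// => j _.
rewrite /force.
have -> : 'D_(basis_vec R j, 0) (local_sq F c) (z, 0) = 0.
  apply: etrans (derive_base (local_sq F c) z 0 (basis_vec R j)) _.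
  have -> : (fun z => local_sq F c (z, 0)) = (cst 0 : 'rV[R]_n -> R).
    by apply/funext => y; rewrite /local_sq/= tangent_ofE derive0 F0 expr0n.
  exact: derive_cst.
rewrite mulr0 subr0 big1 ?mulr0// => k _.
by rewrite mxE mulr0.
Qed.

Lemma geodesic_coef0 (R : realType) n (M : smoothManifold R n)
    (F : M -> 'rV[R]_n -> R) c z :
  finsler_metric F -> geodesic_coef F c (z, 0) = 0.
Proof.
by move=> HF; apply: geodesic_coef_zero => p; exact/(finsler_eq0 HF).
Qed.

Section spray_homogeneity.
Context {R : realType} {n : nat} {M : smoothManifold R n}.
Variables (F : M -> 'rV[R]_n -> R) (F_finsler : finsler_metric F).
Variables (c : chart R n M) (hc : atlas c).
Local Notation E := 'rV[R]_n.
Local Notation L := (local_sq F c).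
Local Notation g := (fundamental_tensor F c).
Local Notation e := (basis_vec R).
Let fibre (z : E) : E -> R := fun w => L (z, w).

Lemma fibre_derive_homogeneous (z w b : E) (a : R) : ccod c z -> w != 0 -> 0 < a ->
  'D_b (fibre z) (a *: w) = a * 'D_b (fibre z) w.
Proof.
move=> cz w0 a0; have [d1 _ _] := fibre_C2 F_finsler hc cz w0.
rewrite -[X in X * _]expr1; apply: derive_homogeneous => //.
by apply: filterS (near_neq0 w0) => v _; exact: local_sqZ.
Qed.

Lemma momentum_homogeneous (z w : E) j (a : R) : ccod c z -> w != 0 -> 0 < a ->
  'D_(0, e j) L (z, a *: w) = a * 'D_(0, e j) L (z, w).
Proof.
move=> cz w0 a0; apply: etrans (derive_fibre L z (a *: w) (e j)) _.
apply: etrans (fibre_derive_homogeneous (e j) cz w0 a0) _.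
by apply: (congr1 ( *%R a)); exact: esym (derive_fibre L z w (e j)).
Qed.

Lemma tensor_homogeneous (z w : E) (a : R) : ccod c z -> w != 0 -> 0 < a ->
  g (z, a *: w) = g (z, w).
Proof.
move=> cz w0 a0; apply/matrixP => i j.
apply: etrans (tensorE F c z (a *: w) i j) _.
apply: etrans _ (esym (tensorE F c z w i j)); apply: (congr1 ( *%R 2^-1)).
have [_ d2 _] := fibre_C2 F_finsler hc cz w0.
rewrite -[RHS]mul1r -(expr0 a).
apply: (@derive_homogeneous R E ('D_(e j) (fibre z)) 0) => //.
  rewrite expr1.
  by apply: filterS (near_neq0 w0) => v v0; exact: fibre_derive_homogeneous.
Qed.

(** The momentum has degree 1 and is contracted with the velocity, while F^2 has degree 2. Base
    derivatives preserve the degree because homogeneity holds at all nearby base points. *)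
Lemma force_homogeneous (z w : E) j (a : R) : ccod c z -> w != 0 -> 0 < a ->
  force F c j (z, a *: w) = a ^+ 2 * force F c j (z, w).
Proof.
move=> cz w0 a0.
have sq : slit_domain c (z, w) by [].
have nz := near_ccod cz.
have H1 k : 'D_(e k, 0) ('D_(0, e j) L) (z, a *: w) =
    a * 'D_(e k, 0) ('D_(0, e j) L) (z, w).
  apply: etrans (derive_base ('D_(0, e j) L) z (a *: w) (e k)) _.
  have N : \forall y \near z,
      'D_(0, e j) L (y, a *: w) = a * 'D_(0, e j) L (y, w).
    by apply: filterS nz => y cy; exact: momentum_homogeneous.
  apply: etrans (near_eq_derive (e k) N) _.
  apply: etrans (deriveMl a _) _.
    apply: (@near_eq_derivable _ _ _ (fun y => 2 * \sum_i w 0 i * g (y, w) i j)).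
      apply: filterS nz => y cy; exact: esym (momentumE F_finsler hc j cy w0).
    apply: (@derivableZ _ _ _ (fun y => \sum_i w 0 i * g (y, w) i j) 2).
    have dh i : derivable (fun y => g (y, w) i j) z (e k).
      exact: tensor_base_derivable.
    by have [] := derive_lincomb (fun i => w 0 i) dh.
  by apply: (congr1 ( *%R a)); exact: esym (derive_base ('D_(0, e j) L) z w (e k)).
have H2 : 'D_(e j, 0) L (z, a *: w) = a ^+ 2 * 'D_(e j, 0) L (z, w).
  apply: etrans (derive_base L z (a *: w) (e j)) _.
  have N : \forall y \near z, L (y, a *: w) = a ^+ 2 * L (y, w).
    by apply: filterS nz => y cy; exact: local_sqZ.
  apply: etrans (near_eq_derive (e j) N) _.
  have dL : derivable (fun y => L (y, w)) z (e j).
    exact: derivable_base (local_sq_differentiable F_finsler hc sq).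
  apply: etrans (deriveMl (a ^+ 2) dL) _.
  by apply: (congr1 ( *%R (a ^+ 2))); exact: esym (derive_base L z w (e j)).
rewrite /force H2.
have -> : \sum_k 'D_(e k, 0) ('D_(0, e j) L) (z, a *: w) * (z, a *: w).2 0 k =
    a ^+ 2 * \sum_k 'D_(e k, 0) ('D_(0, e j) L) (z, w) * (z, w).2 0 k.
  rewrite mulr_sumr; apply: eq_bigr => k _; rewrite H1 mxE.
  by rewrite expr2 -!mulrA; congr (_ * _); rewrite mulrCA.
by rewrite mulrBr; congr (_ - _); rewrite mulrCA.
Qed.

Lemma geodesic_coefZ (z w : E) (a : R) : ccod c z -> 0 < a ->
  geodesic_coef F c (z, a *: w) = a ^+ 2 *: geodesic_coef F c (z, w).
Proof.
move=> cz a0; have [->|w0] := eqVneq w 0.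
  by rewrite scaler0 geodesic_coef0// scaler0.
apply/rowP => i; rewrite !geodesic_coefE !mxE mulr_sumr.
apply: eq_bigr => j _; rewrite tensor_homogeneous//.
by rewrite force_homogeneous// mulrCA.
Qed.

End spray_homogeneity.

(** * Covariance of the geodesic equation *)

Section euler_lagrange.
Context {R : realType} {n : nat} {M : smoothManifold R n}.
Variables (F : M -> 'rV[R]_n -> R) (F_finsler : finsler_metric F).
Local Notation E := 'rV[R]_n.
Local Notation e := (basis_vec R).

Section one_chart.
Variables (c : chart R n M) (hc : atlas c).
Local Notation L := (local_sq F c).
Local Notation g := (fundamental_tensor F c).

(** Multiplication by the invertible tensor lowers the index. Symmetry of the tensor turns the
    product of [geodesic_coef] into one of a row by a matrix. *)
Lemma geodesic_force q (a : E) : slit_domain c q ->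
  a + geodesic_coef F c q = 0 <->
  forall j, \sum_i a 0 i * g q i j + force F c j q = 0.
Proof.
move=> sq; have gu := tensor_unit F_finsler hc sq.
pose A : E := \row_j force F c j q.
have gT : (g q)^T = g q.
  by case: q sq {gu A} => z w [cz w0]; exact: tensor_sym.
have GE : geodesic_coef F c q = A *m invmx (g q).
  rewrite -[in RHS]gT -trmx_inv; apply/rowP => i.
  rewrite geodesic_coefE !mxE; apply: eq_bigr => j _.
  by rewrite !mxE mulrC.
split=> [aG j|H].
  have : (a + geodesic_coef F c q) *m g q = 0 by rewrite aG mul0mx.
  rewrite mulmxDl GE mulmxKV// => /rowP/(_ j).
  by rewrite !mxE.
have -> : a + geodesic_coef F c q = (a *m g q + A) *m invmx (g q).
  by rewrite mulmxDl mulmxK// GE.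
rewrite (_ : a *m g q + A = 0) ?mul0mx//.
by apply/rowP => j; rewrite !mxE; exact: H.
Qed.

Lemma momentum_curve_derive (z v : R -> E) (t : R) (a : E) j :
  is_derive t (1 : R) z (v t) -> is_derive t (1 : R) v a ->
  slit_domain c (z t, v t) ->
  is_derive t (1 : R) (fun s => 'D_(0, e j) L (z s, v s))
    (\sum_k 'D_(e k, 0) ('D_(0, e j) L) (z t, v t) * v t 0 k +
     2 * \sum_i a 0 i * g (z t, v t) i j).
Proof.
move=> dz dv sq.
have dm := momentum_differentiable F_finsler hc j sq.
have D := @is_derive_comp _ _ _ _ ('D_(0, e j) L) (fun s => (z s, v s)) t 1 _ dm
  (is_derive_pair dz dv).
apply: is_derive_eq D _.
apply: etrans (derive_pair _ _ dm) _; congr (_ + _).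
  apply: etrans (derive_base_basis _ dm) _.
  by apply: eq_bigr => k _; rewrite mulrC.
apply: etrans (derive_fibre_basis _ dm) _.
rewrite mulr_sumr; apply: eq_bigr => i _.
rewrite mulrCA; apply: (congr1 ( *%R (a 0 i))).
rewrite mxE mulrA divff ?mul1r// pnatr_eq0.
Qed.

(* In this form the equation is covariant, hence can be transported from one
   chart to another. *)
Lemma euler_lagrange (z v : R -> E) (t : R) (a : E) (dp : 'I_n -> R) :
  is_derive t (1 : R) z (v t) -> is_derive t (1 : R) v a ->
  slit_domain c (z t, v t) ->
  (forall j, is_derive t (1 : R) (fun s => 'D_(0, e j) L (z s, v s)) (dp j)) ->
  a + geodesic_coef F c (z t, v t) = 0 <->
  forall j, dp j = 'D_(e j, 0) L (z t, v t).
Proof.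
move=> dz dv sq Hp.
have dpE j : dp j - 'D_(e j, 0) L (z t, v t) =
    2 * (\sum_i a 0 i * g (z t, v t) i j + force F c j (z t, v t)).
  have [_ <-] := Hp j; have [_ ->] := momentum_curve_derive j dz dv sq.
  rewrite /force/=.
  move: (\sum_k _) (\sum_i _) ('D_(e j, 0) L _) => x y w.
  by field.
rewrite geodesic_force//; split=> H j.
  by apply/eqP; rewrite -subr_eq0 dpE H mulr0.
apply: (@mulfI _ 2); first by rewrite pnatr_eq0.
by rewrite mulr0 -dpE H subrr.
Qed.

End one_chart.

End euler_lagrange.

(** The direction varies with [s], so ['D_(v s) f] is expanded on the basis and each term is a
    scalar times a derivative in a fixed direction. The formula yields the acceleration in another
    chart, and the second derivative of a function along a curve. *)
Lemma curve_derive_direction (R : realType) n (W : normedModType R)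
    (f : 'rV[R]_n -> W) (z v : R -> 'rV[R]_n) (t : R) (a : 'rV[R]_n) :
  (\forall y \near z t, differentiable f y) ->
  (forall u, differentiable ('D_u f) (z t)) ->
  is_derive t (1 : R) z (v t) -> is_derive t (1 : R) v a ->
  is_derive t (1 : R) (fun s => 'D_(v s) f (z s))
    ('D_(v t) ('D_(v t) f) (z t) + 'D_a f (z t)).
Proof.
move=> df ddf dz dv.
have nz : \forall s \near t, differentiable f (z s).
  exact: (is_derive_continuous dz df).
have D i : is_derive t (1 : R) (fun s => v s 0 i *: 'D_(basis_vec R i) f (z s))
    (v t 0 i *: 'D_(v t) ('D_(basis_vec R i) f) (z t) + a 0 i *: 'D_(basis_vec R i) f (z t)).
  have D1 := is_derive_coord i dv.
  have D2 : is_derive t (1 : R) ('D_(basis_vec R i) f \o z) ('D_(v t) ('D_(basis_vec R i) f) (z t)).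
    exact: is_derive_comp.
  exact: is_derive_scale.
have DS := @is_derive_sum _ _ _ _ _ _ _ _ D.
have N : \forall s \near t,
    (\sum_i (fun s => v s 0 i *: 'D_(basis_vec R i) f (z s))) s = 'D_(v s) f (z s).
  apply: filterS nz => s ds; rewrite fct_sumE; apply: esym.
  exact: derive_basis.
apply: near_eq_is_derive N _.
apply: is_derive_eq DS _.
rewrite big_split/=; congr (_ + _); last first.
  exact: esym (derive_basis a (nbhs_singleton df)).
have N' : \forall y \near z t, 'D_(v t) f y = \sum_i v t 0 i *: 'D_(basis_vec R i) f y.
  by apply: filterS df => y dy; exact: derive_basis.
apply: etrans _ (esym (near_eq_derive (v t) N')).
have D' i : is_derive (z t) (v t) (fun y => v t 0 i *: 'D_(basis_vec R i) f y)
    (v t 0 i *: 'D_(v t) ('D_(basis_vec R i) f) (z t)).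
  have D1 : is_derive (z t) (v t) ('D_(basis_vec R i) f) ('D_(v t) ('D_(basis_vec R i) f) (z t)).
    by split=> //; exact: diff_derivable.
  exact: (@is_deriveZ _ _ _ ('D_(basis_vec R i) f) (v t 0 i) _ _ _ D1).
have [_ H] := @is_derive_sum _ _ _ _ _ _ _ _ D'.
apply: etrans (esym H) _.
apply: (congr1 (fun f : 'rV[R]_n -> W => 'D_(v t) f (z t))).
by apply/funext => y; rewrite fct_sumE.
Qed.

Lemma is_derive_linear (R : realType) (V W : normedModType R)
    (f : {linear V -> W}) (x v : V) :
  continuous f -> is_derive x v f (f v).
Proof.
move=> cf; have df : differentiable f x by exact: linear_differentiable.
by split; [exact: diff_derivable|rewrite deriveE// diff_lin].
Qed.

Section change_of_chart.
Context {R : realType} {n : nat} {M : smoothManifold R n}.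
Variables (F : M -> 'rV[R]_n -> R) (F_finsler : finsler_metric F).
Variables (c d : chart R n M) (hc : atlas c) (hd : atlas d).
Local Notation E := 'rV[R]_n.
Local Notation e := (basis_vec R).
Local Notation T := (transition c d).
Local Notation Lc := (local_sq F c).
Local Notation Ld := (local_sq F d).

Lemma local_sq_transition (z w : E) : overlap c d z ->
  Lc (z, w) = Ld (T z, 'D_w T z).
Proof.
move=> oz; have H1 := cinv_transition oz.
have H2 := tangent_of_transition w hc hd oz.
by rewrite /local_sq /= H1 H2.
Qed.

Lemma is_derive_in_direction (z w b : E) : overlap c d z ->
  is_derive w b (derive T z) ('D_b T z).
Proof.
move=> oz; have [dT _ _] := transition_C3 hc hd oz.
have -> : derive T z = 'd T z.
  by apply/funext => v; exact: deriveE.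
have cT : continuous ('d T z) by exact: diff_continuous.
by apply: is_derive_eq (is_derive_linear w b cT) _.
Qed.

Lemma slit_transition (z w : E) : overlap c d z -> w != 0 ->
  slit_domain d (T z, 'D_w T z).
Proof.
move=> oz w0; split=> /=; first by have [] := overlap_transition oz.
apply: contra_neq w0 => Tw0.
by rewrite -(derive_transitionK w hc hd oz) Tw0 derive0.
Qed.

Lemma momentum_transition (z w : E) j : overlap c d z -> w != 0 ->
  'D_(0, e j) Lc (z, w) =
  \sum_l ('D_(e j) T z) 0 l * 'D_(0, e l) Ld (T z, 'D_w T z).
Proof.
move=> oz w0; apply: etrans (derive_fibre Lc z w (e j)) _.
have -> : (fun w : E => Lc (z, w)) = fun w : E => Ld (T z, 'D_w T z).
  by apply/funext => v; exact: local_sq_transition.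
have dL := local_sq_differentiable F_finsler hd (slit_transition oz w0).
have D1 : is_derive w (e j) (fun v : E => (T z, 'D_v T z)) (0, 'D_(e j) T z).
  apply: is_derive_pair; last exact: is_derive_in_direction.
have [_ H] := @is_derive_comp _ _ _ _ Ld (fun v : E => (T z, 'D_v T z)) w (e j) _ dL D1.
apply: etrans H _; exact: derive_fibre_basis.
Qed.

(** The second sum comes from the dependence of the pushed vector ['D_w T z] on [z]. It is
    compensated in [geodesic_transition] by the derivative of the Jacobian along the curve. *)
Lemma position_transition (z w : E) j : overlap c d z -> w != 0 ->
  'D_(e j, 0) Lc (z, w) =
  \sum_l ('D_(e j) T z) 0 l * 'D_(e l, 0) Ld (T z, 'D_w T z) +
  \sum_l ('D_(e j) ('D_w T) z) 0 l * 'D_(0, e l) Ld (T z, 'D_w T z).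
Proof.
move=> oz w0; apply: etrans (derive_base Lc z w (e j)) _.
have N : \forall y \near z, Lc (y, w) = Ld (T y, 'D_w T y).
  by apply: filterS (near_overlap oz) => y oy; exact: local_sq_transition.
apply: etrans (near_eq_derive (e j) N) _.
have dL := local_sq_differentiable F_finsler hd (slit_transition oz w0).
have [dT ddT _] := transition_C3 hc hd oz.
have D1 : is_derive z (e j) (fun y : E => (T y, 'D_w T y))
    ('D_(e j) T z, 'D_(e j) ('D_w T) z).
  by apply: is_derive_pair; split=> //; exact: diff_derivable.
have [_ H] := @is_derive_comp _ _ _ _ Ld (fun y : E => (T y, 'D_w T y)) z (e j) _ dL D1.
apply: etrans H _; apply: etrans (derive_pair _ _ dL) _.
congr (_ + _); first exact: derive_base_basis.
exact: derive_fibre_basis.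
Qed.

Lemma transition_velocity (z : R -> E) (t : R) (v : E) : overlap c d (z t) ->
  is_derive t (1 : R) z v -> is_derive t (1 : R) (T \o z) ('D_v T (z t)).
Proof.
move=> oz dz; have [dT _ _] := transition_C3 hc hd oz.
exact: is_derive_comp.
Qed.

Lemma transition_acceleration (z v : R -> E) (t : R) (a : E) : overlap c d (z t) ->
  is_derive t (1 : R) z (v t) -> is_derive t (1 : R) v a ->
  is_derive t (1 : R) (fun s => 'D_(v s) T (z s))
    ('D_(v t) ('D_(v t) T) (z t) + 'D_a T (z t)).
Proof.
move=> oz dz dv; have [_ ddT _] := transition_C3 hc hd oz.
apply: curve_derive_direction => //.
by apply: filterS (near_overlap oz) => y /(transition_C3 hc hd)[].
Qed.

(** Differentiating [momentum_transition] along the curve and subtracting [position_transition]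
    shows that the Euler-Lagrange expression is a covector; it vanishes in one chart, hence in the
    other. *)
Lemma geodesic_transition (z v : R -> E) (t : R) (a : E) :
  overlap c d (z t) ->
  (\forall s \near t, is_derive s (1 : R) z (v s)) -> is_derive t (1 : R) v a ->
  a + geodesic_coef F c (z t, v t) = 0 ->
  'D_(v t) ('D_(v t) T) (z t) + 'D_a T (z t) +
  geodesic_coef F d (T (z t), 'D_(v t) T (z t)) = 0.
Proof.
move=> oz ndz dv eqc; have dz := nbhs_singleton ndz.
have cz : ccod c (z t) by case: oz.
have [dT ddT _] := transition_C3 hc hd oz.
have [v0|v0] := eqVneq (v t) 0.
  move: eqc; rewrite v0 geodesic_coef0// addr0 => ->.
  by rewrite !derive0 geodesic_coef0// !addr0.
have no : \forall s \near t, overlap c d (z s).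
  exact: (is_derive_continuous dz (near_overlap oz)).
have sqc : slit_domain c (z t, v t) by [].
have sqd := slit_transition oz v0.
have Tz := transition_velocity oz dz.
have Ta := transition_acceleration oz dz dv.
have [dp Dd] : exists dp, forall j, is_derive t (1 : R)
    (fun s => 'D_(0, e j) Ld ((T \o z) s, 'D_(v s) T (z s))) (dp j).
  exists (fun j => 'D_1 (fun s => 'D_(0, e j) Ld ((T \o z) s, 'D_(v s) T (z s))) t).
  by move=> j; have [] := momentum_curve_derive F_finsler hd j Tz Ta sqd.
have nv : \forall s \near t, v s != 0.
  exact: (cvgr_neq0 _ (is_derive_continuous dv) v0).
have Dc j : is_derive t (1 : R) (fun s => 'D_(0, e j) Lc (z s, v s))
    (\sum_l (('D_(e j) T (z t)) 0 l * dp l +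
       'D_(0, e l) Ld (T (z t), 'D_(v t) T (z t)) * ('D_(v t) ('D_(e j) T) (z t)) 0 l)).
  have N : \forall s \near t, (\sum_l (fun s => ('D_(e j) T (z s)) 0 l) *
      (fun s => 'D_(0, e l) Ld ((T \o z) s, 'D_(v s) T (z s)))) s =
      'D_(0, e j) Lc (z s, v s).
    apply: filterS (filterI no nv) => s [os vs]; rewrite fct_sumE.
    exact: esym (momentum_transition j os vs).
  apply: near_eq_is_derive N _.
  apply: is_derive_sum => l.
  have D2 : is_derive t (1 : R) ('D_(e j) T \o z) ('D_(v t) ('D_(e j) T) (z t)).
    exact: is_derive_comp.
  exact: is_deriveM (is_derive_coord l D2) (Dd l).
have HEL := (euler_lagrange F_finsler hc dz dv sqc Dc).1 eqc.
(* The Euler-Lagrange covector in the chart [d]; the transposed Jacobian of [T] sends it to the one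
   in [c], which is zero. *)
pose Y l := dp l - 'D_(e l, 0) Ld (T (z t), 'D_(v t) T (z t)).
have HY j : \sum_l ('D_(e j) T (z t)) 0 l * Y l = 0.
  have := HEL j; move/eqP; rewrite -subr_eq0 => /eqP.
  move=> H0; apply: etrans _ H0.
  apply: etrans _ (esym (congr1 (fun x => _ - x) (position_transition j oz v0))).
  rewrite big_split/= opprD addrACA -!sumrB.
  rewrite [X in _ + X]big1 ?addr0; last first.
    (* By symmetry of the second derivatives of [T], the variation of the Jacobian along the curve
       cancels the second sum of [position_transition]. *)
    move=> l _; rewrite (transition_schwarz (v t) (e j) hc hd oz).
    by rewrite mulrC subrr.
  by apply: eq_bigr => l _; rewrite mulrBr.
have HYb (b : E) : \sum_l ('D_b T (z t)) 0 l * Y l = 0.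
  rewrite (derive_basis b dT).
  under eq_bigr => l _ do rewrite summxE mulr_suml.
  rewrite exchange_big/= big1// => j _.
  under eq_bigr => l _ do rewrite mxE -mulrA.
  by rewrite -mulr_sumr HY mulr0.
apply/(euler_lagrange F_finsler hd Tz Ta sqd Dd) => m.
have od := overlap_transition oz.
(* The Jacobian is invertible: applying [HYb] to the preimage of [e m] isolates [Y m]. *)
have := derive_transitionK (e m) hd hc od; rewrite transitionK// => Hm.
have := HYb ('D_(e m) (transition d c) (T (z t))); rewrite Hm.
rewrite (bigD1 m)//= big1 => [|l lm]; last by rewrite mxE (negbTE lm) andbF mul0r.
rewrite addr0 mxE !eqxx mul1r => /eqP; rewrite subr_eq0 => /eqP ->.
by [].
Qed.

End change_of_chart.

(** * Sprays *)

Section sprays.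
Context {R : realType} {n : nat}.
Local Notation E := 'rV[R]_n.

(* The ordinary differential equation is z'' = - S (z, z').  Homogeneity extends
   the Lipschitz condition to zero vectors, where [S] need not be C^1. *)
Record spray_on (W : set E) (S : E * E -> E) : Prop := SprayOn {
  spray_open : open W ;
  spray0 : forall z, W z -> S (z, 0) = 0 ;
  sprayZ : forall z w (a : R), W z -> 0 < a -> S (z, a *: w) = a ^+ 2 *: S (z, w) ;
  spray_lip_slit : forall z w, W z -> w != 0 -> lip_at S (z, w) }.

Lemma sphere_compact : compact [set w : E | `|w| = 1].
Proof.
apply: bounded_closed_compact.
  by exists 1; split=> // x x1 w /= ->; exact: ltW.
have -> : [set w : E | `|w| = 1] = (fun w : E => `|w|) @^-1` [set 1] by [].
apply: preimage_closed; last exact: closed_eq.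
by move=> w _; exact: norm_continuous.
Qed.

Lemma closed_ball_compact (r : R) : compact [set w : E | `|w| <= r].
Proof.
apply: bounded_closed_compact.
  by exists r; split=> // [|x rx w /= wr]; [exact: num_real|exact: ltW (le_lt_trans wr rx)].
have -> : [set w : E | `|w| <= r] = (fun w : E => `|w|) @^-1` [set x | x <= r] by [].
apply: preimage_closed; last exact: closed_le.
by move=> w _; exact: norm_continuous.
Qed.

Variables (W : set E) (S : E * E -> E) (HS : spray_on W S).

(** Compactness of the unit sphere gives bounds for unit vectors. Homogeneity of degree 2 carries
    them to |w| <= 1, at the cost of a factor 4, and then by scaling to |w| <= a. The explicit
    powers of [a] make the field a weak perturbation at small velocities, as Picard iteration on a
    fixed time interval demands. *)
Lemma spray_bounds (z0 : E) : W z0 -> exists r : R, exists K : R, [/\ 0 < r, 0 < K,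
  ball z0 r `<=` W,
  forall z w : E, ball z0 r z -> `|S (z, w)| <= K * `|w| ^+ 2 &
  forall (a : R) (z z' w w' : E), 0 < a -> ball z0 r z -> ball z0 r z' ->
    `|w| <= a -> `|w'| <= a ->
    `|S (z, w) - S (z', w')| <= K * (a ^+ 2 * `|z - z'| + a * `|w - w'|)].
Proof.
move=> Wz0.
have [|r1 [K [r10 K0 HK HL]]] := compact_lip (f := S) (x0 := z0) sphere_compact.
  move=> w /= w1; apply: (spray_lip_slit HS) => //.
  by rewrite -normr_eq0 w1 oner_neq0.
have [r2 r20 Hr2] : exists2 r2, 0 < r2 & ball z0 r2 `<=` W.
  have : nbhs z0 W by apply: open_nbhs_nbhs; split=> //; exact: (spray_open HS).
  by move=> /nbhs_ballP[r2 r20 H]; exists r2.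
pose r := Num.min r1 r2.
have rr1 : ball z0 r `<=` ball z0 r1 by apply: le_ball; rewrite ge_min lexx.
have rW : ball z0 r `<=` W.
  by apply: subset_trans Hr2; apply: le_ball; rewrite ge_min lexx orbT.
have SE (z w : E) : ball z0 r z -> w != 0 ->
    S (z, w) = `|w| ^+ 2 *: S (z, `|w|^-1 *: w) /\ `|(`|w|^-1 *: w)| = 1.
  move=> zr w0; have w0' : 0 < `|w| by rewrite normr_gt0.
  rewrite -(sprayZ HS)//; last exact: rW.
  rewrite scalerA divff ?gt_eqF// scale1r; split=> //.
  by rewrite normrZ normfV normr_id mulVf// gt_eqF.
have bound (z w : E) : ball z0 r z -> `|S (z, w)| <= K * `|w| ^+ 2.
  move=> zr; have [->|w0] := eqVneq w 0.
    by rewrite (spray0 HS)// ?normr0 ?expr0n ?mulr0//; exact: rW.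
  have [-> u1] := SE _ _ zr w0.
  rewrite normrZ ger0_norm ?sqr_ge0// mulrC ler_wpM2r ?sqr_ge0//.
  by apply: HK => //; exact: rr1.
have lip1 (z z' w w' : E) : ball z0 r z -> ball z0 r z' -> `|w| <= 1 -> `|w'| <= 1 ->
    `|S (z, w) - S (z', w')| <= (4 * K) * (`|z - z'| + `|w - w'|).
  move=> zr zr' w1 w1'.
  have K0' : 0 <= K := ltW K0; have K4 : K <= 4 * K by lra.
  have [->|w0] := eqVneq w 0.
    rewrite (spray0 HS); last exact: rW.
    rewrite !sub0r !normrN (le_trans (bound _ _ zr'))// ler_pM// ?sqr_ge0//.
    by rewrite (@le_trans _ _ `|w'|) ?lerDr// expr2 ler_piMl.
  have [->|w0'] := eqVneq w' 0.
    rewrite (spray0 HS (rW _ zr')) !subr0 (le_trans (bound _ _ zr))// ler_pM// ?sqr_ge0//.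
    by rewrite (@le_trans _ _ `|w|) ?lerDr// expr2 ler_piMl.
  have [-> u1] := SE _ _ zr w0; have [-> u1'] := SE _ _ zr' w0'.
  move: u1 u1'; set u := _ *: w; set u' := _ *: w' => u1 u1'.
  have wE : w = `|w| *: u by rewrite scalerA divff ?scale1r// normr_eq0.
  have wE' : w' = `|w'| *: u' by rewrite scalerA divff ?scale1r// normr_eq0.
  have Su : `|S (z, u)| <= K by apply: HK => //; exact: rr1.
  have Suu : `|S (z, u) - S (z', u')| <= K * (`|z - z'| + `|u - u'|).
    by apply: HL => //; exact: rr1.
  have dn : `| `|w| - `|w'| | <= `|w - w'| by exact: ler_dist_dist.
  (* The direction of a vector is not Lipschitz near zero, but times the length it is: of the two
     factors |w'| supplied by homogeneity, one pays for the direction and the other is bounded by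
     1. *)
  have uu : `|w'| * `|u - u'| <= 2 * `|w - w'|.
    rewrite -[X in X * _]normr_id -normrZ scalerBr -wE'.
    have -> : `|w'| *: u - w' = (w - w') - (`|w| - `|w'|) *: u.
      by rewrite scalerBl -wE opprB [RHS]addrC addrA subrK.
    rewrite (le_trans (ler_normB _ _))// normrZ u1 mulr1.
    by rewrite mulr_natl mulr2n lerD.
  have -> : `|w| ^+ 2 *: S (z, u) - `|w'| ^+ 2 *: S (z', u') =
     (`|w| ^+ 2 - `|w'| ^+ 2) *: S (z, u) + `|w'| ^+ 2 *: (S (z, u) - S (z', u')).
    by rewrite scalerBl scalerBr addrA subrK.
  rewrite (le_trans (ler_normD _ _))// [X in X + _]normrZ [X in _ + X]normrZ.
  have n0 : 0 <= `|w| by []. have n0' : 0 <= `|w'| by [].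
  have A1 : `| `|w| ^+ 2 - `|w'| ^+ 2 | <= 2 * `|w - w'|.
    rewrite subr_sqr normrM mulrC ler_pM// ger0_norm ?addr_ge0//.
    by rewrite -[2]/(1 + 1) lerD.
  have A2 : `| `|w| ^+ 2 - `|w'| ^+ 2 | * `|S (z, u)| <= 2 * `|w - w'| * K.
    by rewrite ler_pM.
  have A3 : `| `|w'| ^+ 2 | * `|S (z, u) - S (z', u')| <=
      K * `|z - z'| + K * (2 * `|w - w'|).
    rewrite ger0_norm ?sqr_ge0//.
    apply: (@le_trans _ _ (`|w'| ^+ 2 * (K * (`|z - z'| + `|u - u'|)))).
      by rewrite ler_wpM2l// sqr_ge0.
    rewrite mulrCA -mulrDr; apply: ler_wpM2l; first exact: ltW.
    rewrite mulrDr lerD//.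
      by rewrite ler_piMl// expr_le1.
    by rewrite expr2 -mulrA (le_trans _ uu)// ler_piMl// mulr_ge0.
  have z0' : 0 <= `|z - z'| by [].
  have KZ : 0 <= K * `|z - z'| by rewrite mulr_ge0// ltW.
  rewrite (le_trans (lerD A2 A3))//.
  move: (`|z - z'|) (`|w - w'|) KZ => x y KZ.
  have -> : 2 * y * K + (K * x + K * (2 * y)) = K * x + 4 * K * y by ring.
  have -> : 4 * K * (x + y) = K * x + 4 * K * y + 3 * (K * x) by ring.
  by rewrite lerDl mulr_ge0.
exists r, (4 * K).
have r0 : 0 < r by rewrite lt_min r10.
have K40 : 0 < 4 * K by rewrite mulr_gt0.
split=> // [z w zr|a z z' w w' a0 zr zr' wa wa'].
  rewrite (le_trans (bound _ _ zr))// ler_wpM2r// ?sqr_ge0//.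
  by rewrite ler_peMl ?(ltW K0)// ler1n.
have sc (v : E) : `|v| <= a -> `|a^-1 *: v| <= 1.
  by move=> va; rewrite normrZ ger0_norm ?invr_ge0 ?(ltW a0)// mulrC ler_pdivrMr// mul1r.
have Sa (y v : E) : ball z0 r y -> S (y, v) = a ^+ 2 *: S (y, a^-1 *: v).
  move=> yr; rewrite -(sprayZ HS)//; last exact: rW.
  by rewrite scalerA divff ?gt_eqF// scale1r.
rewrite (Sa z w zr) (Sa z' w' zr') -scalerBr normrZ ger0_norm ?sqr_ge0//.
apply: (@le_trans _ _ (a ^+ 2 * (4 * K * (`|z - z'| + `|a^-1 *: w - a^-1 *: w'|)))).
  by rewrite ler_wpM2l ?sqr_ge0// lip1// sc.
rewrite -scalerBr normrZ ger0_norm ?invr_ge0 ?(ltW a0)//.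
rewrite mulrCA; apply: ler_wpM2l; first exact: ltW.
by rewrite mulrDr mulrA expr2 mulfK// gt_eqF.
Qed.

Lemma spray_lip (z w : E) : W z -> lip_at S (z, w).
Proof.
move=> Wz; have [->|w0] := eqVneq w 0; last exact: (spray_lip_slit HS).
have [r [K [r0 K0 _ _ HL]]] := spray_bounds Wz.
apply: (@lip_atI _ _ _ _ _ (ball z r `*` ball (0 : E) 1) (2 * K)).
  by exists (ball z r, ball (0 : E) 1) => //; split; exact: nbhsx_ballx.
have b1 v : ball (0 : E) 1 v -> `|v| <= 1.
  by rewrite -ball_normE/= sub0r normrN => /ltW.
move=> [z1 w1] [z2 w2] [/= zb1 /b1 wb1] [/= zb2 /b1 wb2].
rewrite (le_trans (HL 1 _ _ _ _ ltr01 zb1 zb2 wb1 wb2))//.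
rewrite expr1n !mul1r [leRHS]mulrAC [leRHS]mulrC ler_wpM2l ?(ltW K0)//.
rewrite mulr_natl mulr2n [X in _ <= X + X]prod_normE/=.
by rewrite lerD// le_max lexx ?orbT.
Qed.

End sprays.

Section integration.
Import constructive_ereal measure lebesgue_measure lebesgue_integral ftc.

(** The integral starts at [- b], so that its derivative is available at negative times too;
    subtracting its value at 0 normalises it. *)
Lemma antiderivative (R : realType) (f : R -> R) (b : R) : 0 < b -> continuous f ->
  exists2 F : R -> R, F 0 = 0 & forall x, - b < x < b -> is_derive x (1 : R) F (f x).
Proof.
move=> b0 cf.
pose G x := parameterized_integral lebesgue_measure (- b) x f.
have intf : integrable lebesgue_measure `[- b, b] (constructive_ereal.EFin \o f).
  apply: continuous_compact_integrable.
    exact: segment_compact.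
  exact: continuous_subspaceT.
have GP x : - b < x < b -> is_derive x (1 : R) G (f x).
  move=> /andP[bx xb].
  have [d dE] := continuous_FTC1_closed xb intf bx (cf x).
  split; [exact: d|exact: etrans (esym (derive1E G x)) dE].
exists (fun x => G x - G 0); first by rewrite subrr.
move=> x /GP Gx; have := is_deriveB Gx (is_derive_cst (G 0) x (1 : R)).
by rewrite subr0.
Qed.

End integration.

(** * Picard iteration *)

Section picard.
Context {R : realType}.

Definition clamp (a x : R) : R := Num.max (- a) (Num.min a x).

Lemma clamp_bound a x : 0 <= a -> - a <= clamp a x <= a.
Proof.
move=> a0; rewrite /clamp le_max lexx/= ge_max ge_min lexx/= andbT.
by rewrite (le_trans _ a0)// oppr_le0.
Qed.

Lemma clamp_id a x : - a <= x <= a -> clamp a x = x.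
Proof. by move=> /andP[ax xa]; rewrite /clamp min_r// max_r. Qed.

Lemma clamp_lip a x y : `|clamp a x - clamp a y| <= `|x - y|.
Proof.
have H (b x' y' : R) : `|Num.max b x' - Num.max b y'| <= `|x' - y'| /\
    `|Num.min b x' - Num.min b y'| <= `|x' - y'|.
  have h1 : x' - y' <= `|x' - y'| by exact: ler_norm.
  have h2 : y' - x' <= `|x' - y'| by rewrite distrC ler_norm.
  move: (`|x' - y'|) h1 h2 (normr_ge0 (x' - y')) => d h1 h2 d0.
  rewrite !ler_norml; split;
    by case: (leP b x') => ?; case: (leP b y') => ?; apply/andP; split; lra.
have [H1 _] := H (- a) (Num.min a x) (Num.min a y).
by have [_ H2] := H a x y; exact: le_trans H1 H2.
Qed.

Lemma clamp_continuous a : continuous (clamp a).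
Proof.
move=> x; apply: lip_at_continuous.
apply: (@lip_atI _ _ _ _ _ setT 1); first exact: filterT.
by move=> p q _ _; rewrite mul1r clamp_lip.
Qed.

Lemma half_pow_small (D e : R) : 0 < e -> exists k : nat, D / 2 ^+ k < e.
Proof.
move=> e0; pose m := Num.bound (D / e); exists m.
have p0 : (0 : R) < 2 ^+ m by rewrite exprn_gt0.
rewrite ltr_pdivrMr// mulrC -ltr_pdivrMr//.
have [De|De] := ltP (D / e) 0; first exact: lt_trans De p0.
rewrite (lt_le_trans (archi_boundP De))// -natrX ler_nat ltnW//.
exact: ltn_expl.
Qed.

(** The intervals of centre [u k] and radius [c k = 2 * D / 2 ^+ k] are nested, since [c k - c k.+1]
    is exactly the allowed increment [D / 2 ^+ k]. The supremum of their left ends lies in all of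
    them. *)
Lemma geometric_limit (u : nat -> R) (D : R) :
  (forall k, `|u k.+1 - u k| <= D / 2 ^+ k) ->
  exists l, forall k, `|l - u k| <= 2 * D / 2 ^+ k.
Proof.
move=> Hu; pose c k := 2 * D / 2 ^+ k.
have D0 : 0 <= D.
  by have := Hu 0%N; rewrite expr0 divr1; apply: le_trans.
have c0 k : 0 <= c k by rewrite /c divr_ge0 ?exprn_ge0 ?mulr_ge0.
have cS k : c k - c k.+1 = D / 2 ^+ k.
  have p0 : (2 ^+ k : R) != 0 by rewrite expf_neq0// pnatr_eq0.
  by rewrite /c exprS; field; rewrite p0.
have lo k : u k - c k <= u k.+1 - c k.+1.
  have := Hu k; rewrite -cS ler_norml => /andP[+ _].
  move: (u k) (u k.+1) (c k) (c k.+1) => ? ? ? ?; lra.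
have hi k : u k.+1 + c k.+1 <= u k + c k.
  have := Hu k; rewrite -cS ler_norml => /andP[_].
  move: (u k) (u k.+1) (c k) (c k.+1) => ? ? ? ?; lra.
have los j k : u j - c j <= u (j + k)%N - c (j + k)%N.
  by elim: k => [|k IH]; rewrite ?addn0// addnS (le_trans IH).
have his j k : u (j + k)%N + c (j + k)%N <= u j + c j.
  by elim: k => [|k IH]; rewrite ?addn0// addnS (le_trans _ IH).
have lohi j k : u j - c j <= u k + c k.
  have := los j k; have := his k j; rewrite addnC.
  have := c0 (j + k)%N.
  move: (u _) (u _) (u _) (c _) (c _) (c _) => ? ? ? ? ? ?; lra.
pose A := [set u k - c k | k in [set: nat]].
have hA : has_sup A.
  by split; [exists (u 0%N - c 0%N), 0%N|exists (u 0%N + c 0%N) => _ [k _ <-]].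
exists (sup A) => k; rewrite ler_norml; apply/andP; split.
  by rewrite lerBrDr addrC; apply: (sup_upper_bound hA); exists k.
rewrite lerBlDr addrC; apply: ge_sup; first by case: hA.
by move=> _ [j _ <-].
Qed.

Context {n : nat}.
Local Notation E := 'rV[R]_n.

(** For the sup norm this is a 1-Lipschitz retraction onto the closed ball of radius [a];
    [spray_existence] uses it to extend a local field to the whole space. *)
Definition clamp_row (a : R) (v : E) : E := \row_i clamp a (v 0 i).

Lemma clamp_row_norm a v : 0 <= a -> `|clamp_row a v| <= a.
Proof.
by move=> a0; apply: row_norm_le => // i; rewrite mxE ler_norml clamp_bound.
Qed.

Lemma clamp_row_lip a (v w : E) : `|clamp_row a v - clamp_row a w| <= `|v - w|.
Proof.
apply: row_norm_le => // i; rewrite !mxE (le_trans (clamp_lip _ _ _))//.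
by rewrite (le_trans _ (coord_norm_le _ i))// !mxE.
Qed.

Lemma clamp_row_id a (v : E) : `|v| <= a -> clamp_row a v = v.
Proof.
move=> va; apply/rowP => i; rewrite mxE clamp_id// -ler_norml.
exact: le_trans (coord_norm_le _ _) va.
Qed.

Lemma row_antiderivative (f : R -> E) : continuous f ->
  exists F : R -> E, F 0 = 0 /\
    forall x : R, - 3 < x < 3 -> is_derive x (1 : R) F (f x).
Proof.
move=> cf.
have H i : exists F : R -> R, F 0 = 0 /\
    forall x : R, - 3 < x < 3 -> is_derive x (1 : R) F (f x 0 i).
  have ci : continuous (fun x => f x 0 i).
    move=> x; apply: (@continuous_comp _ _ _ f (fun v : E => v 0 i)).
      exact: cf.
    exact: coord_continuous.
  have b0 : (0 : R) < 3 by [].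
  by have [F F0 FP] := antiderivative b0 ci; exists F.
pose F i := projT1 (cid (H i)).
have FP i : F i 0 = 0 /\
    forall x : R, - 3 < x < 3 -> is_derive x (1 : R) (F i) (f x 0 i).
  exact: projT2 (cid (H i)).
exists (fun x => \row_i F i x); split.
  by apply/rowP => i; rewrite !mxE; case: (FP i).
move=> x x3; apply: is_derive_row => i.
under eq_fun do rewrite mxE.
by case: (FP i) => _; apply.
Qed.

(** A selected antiderivative that vanishes at 0, meaningful for continuous [f]. The interval (-3,
    3) leaves a margin around the time window [-2, 2] of the iteration, so that derivatives exist at
    its ends. *)
Definition primitive (f : R -> E) : R -> E :=
  xget (cst 0) [set F : R -> E | F 0 = 0 /\
    forall x : R, - 3 < x < 3 -> is_derive x (1 : R) F (f x)].

Lemma primitiveP (f : R -> E) : continuous f -> primitive f 0 = 0 /\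
  forall x : R, - 3 < x < 3 -> is_derive x (1 : R) (primitive f) (f x).
Proof.
by move=> /row_antiderivative[F HF]; rewrite /primitive; case: xgetP => // /(_ F).
Qed.

Lemma derive_bound_from0 (F f : R -> E) (T D t : R) : F 0 = 0 ->
  (forall s : R, - T <= s <= T -> is_derive s (1 : R) F (f s)) ->
  (forall s, - T <= s <= T -> `|f s| <= D) -> - T <= t <= T -> `|F t| <= T * D.
Proof.
move=> F0 FP fD /andP[t1 t2].
have T0 : 0 <= T by rewrite -(pmulrn_lge0 _ (isT : (0 < 2)%N)) mulr2n -lerBlDr sub0r (le_trans t1).
have D0 : 0 <= D by apply: le_trans (fD 0 _) => //; rewrite oppr_le0 T0.
have [t0|t0] := leP 0 t.
  have H := @mean_value_bound _ _ F f 0 t D t0.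
  rewrite -[F t]subr0 -F0; apply: le_trans (H _ _) _.
  - move=> s /andP[s0 st]; apply: FP.
    by rewrite (le_trans st t2) andbT (le_trans _ s0)// oppr_le0.
  - move=> s /andP[s0 st]; apply: fD.
    by rewrite (le_trans st t2) andbT (le_trans _ s0)// oppr_le0.
  - by rewrite mulrC ler_wpM2r// subr0.
have H := @mean_value_bound _ _ F f t 0 D (ltW t0).
rewrite -normrN -[- F t]add0r -F0; apply: le_trans (H _ _) _.
- by move=> s /andP[ts s0]; apply: FP; rewrite (le_trans t1 ts)/= (le_trans s0).
- by move=> s /andP[ts s0]; apply: fD; rewrite (le_trans t1 ts)/= (le_trans s0).
- by rewrite mulrC ler_wpM2r// sub0r lerNl.
Qed.

Lemma primitive_bound (f : R -> E) (D t : R) : continuous f ->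
  (forall s, `|f s| <= D) -> - 2 <= t <= 2 -> `|primitive f t| <= 2 * D.
Proof.
move=> /primitiveP[f0 fP] fD t2.
apply: (@derive_bound_from0 _ f) => // s s2.
by apply: fP; move: s2 => /andP[s1 s2]; apply/andP; split; lra.
Qed.

Lemma primitive_dist (f g : R -> E) (D t : R) : continuous f -> continuous g ->
  (forall s, `|f s - g s| <= D) -> - 2 <= t <= 2 ->
  `|primitive f t - primitive g t| <= 2 * D.
Proof.
move=> /primitiveP[f0 fP] /primitiveP[g0 gP] fg t2.
apply: (@derive_bound_from0 (fun s => primitive f s - primitive g s)
  (fun s => f s - g s)) => //; first by rewrite f0 g0 subrr.
move=> s /andP[s1 s2]; have s3 : - 3 < s < 3 by apply/andP; split; lra.
exact: is_deriveB (fP _ s3) (gP _ s3).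
Qed.

End picard.

(* The unknown is the velocity, the position being z0 plus its primitive.  The
   field is globally Lipschitz here; truncating time to [-2, 2] keeps the
   functions total. *)
Section picard_iteration.
Context {R : realType} {n : nat}.
Local Notation E := 'rV[R]_n.
Variables (f : E * E -> E) (z0 y : E) (B : R).
Hypothesis f_bound : forall p, `|f p| <= B.
Hypothesis f_lip : forall p p' : E * E,
  `|f p - f p'| <= 12^-1 * (`|p.1 - p'.1| + `|p.2 - p'.2|).

Let f_continuous : continuous f.
Proof.
move=> p; apply: lip_at_continuous.
apply: (@lip_atI _ _ _ _ _ setT (12^-1 * 2)); first exact: filterT.
move=> p1 p2 _ _; rewrite (le_trans (f_lip _ _))// -[leRHS]mulrA ler_wpM2l//.
rewrite mulr_natl mulr2n [X in _ <= X + X]prod_normE/=.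
by rewrite lerD// le_max lexx ?orbT.
Qed.

Let tau : R -> R := clamp 2.

Let tau_bound t : - 2 <= tau t <= 2. Proof. exact: clamp_bound. Qed.

Let position (w : R -> E) t := z0 + primitive w (tau t).

Let step (w : R -> E) t := y - primitive (fun s => f (position w s, w s)) (tau t).

Let primitive_tau_continuous (w : R -> E) : continuous w ->
  continuous (fun t => primitive w (tau t)).
Proof.
move=> cw t; apply: (@continuous_comp _ _ _ tau (primitive w)).
  exact: clamp_continuous.
have [_ H] := primitiveP cw.
have t3 : - 3 < tau t < 3.
  by have /andP[] := tau_bound t; move: (tau t) => s ? ?; apply/andP; split; lra.
exact: is_derive_continuous (H _ t3).
Qed.

Let position_continuous (w : R -> E) : continuous w -> continuous (position w).
Proof.
move=> cw t; apply: cvgD; first exact: cvg_cst.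
exact: primitive_tau_continuous.
Qed.

Let field_continuous (w : R -> E) : continuous w -> continuous (fun s => f (position w s, w s)).
Proof.
move=> cw t.
have c1 : {for t, continuous (position w)} by exact: position_continuous.
have c2 : {for t, continuous w} by exact: cw.
have c3 : {for (position w t, w t), continuous f} by exact: f_continuous.
apply: (@continuous_comp _ _ _ (fun s => (position w s, w s)) f _ _ c3).
exact: (@cvg_pair _ _ _ (nbhs t) (nbhs (position w t)) (nbhs (w t)) _ _ _
  (position w) w c1 c2).
Qed.

Let step_continuous (w : R -> E) : continuous w -> continuous (step w).
Proof.
move=> cw t; apply: cvgB; first exact: cvg_cst.
by apply: primitive_tau_continuous; exact: field_continuous.
Qed.

Let step_contraction (w w' : R -> E) (D : R) : continuous w -> continuous w' ->
  (forall t, `|w t - w' t| <= D) -> forall t, `|step w t - step w' t| <= D / 2 ^+ 1.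
Proof.
move=> cw cw' ww' t.
have D0 : 0 <= D by exact: le_trans (ww' 0).
have pos s : `|position w s - position w' s| <= 2 * D.
  by rewrite /position opprD addrACA subrr add0r; apply: primitive_dist.
(* This accounts for the Lipschitz constant 1/12: the field changes by at most (2 D + D) / 12, and
   integration over a time at most 2 gives D / 2. *)
have H := @primitive_dist _ _ _ _ (12^-1 * (2 * D + D)) _ (field_continuous cw)
  (field_continuous cw') _ (tau_bound t).
rewrite /step opprD addrACA subrr add0r -opprD normrN.
apply: le_trans (H _) _.
  move=> s; rewrite (le_trans (f_lip _ _))// ler_wpM2l//.
  exact: lerD (pos s) (ww' s).
by rewrite expr1; lra.
Qed.

Lemma picard_fixpoint : exists z v : R -> E, [/\ z 0 = z0, v 0 = y,
  forall t : R, - 2 < t < 2 -> is_derive t (1 : R) z (v t),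
  forall t : R, - 2 < t < 2 -> is_derive t (1 : R) v (- f (z t, v t)) &
  forall t, `|v t - y| <= 2 * B].
Proof.
pose w k := iter k step (fun=> y).
have cw k : continuous (w k).
  elim: k => [|k IH]; first by move=> t; exact: cvg_cst.
  exact: step_continuous.
have stepy (h : R -> E) : continuous h -> forall t, `|step h t - y| <= 2 * B.
  move=> ch t; rewrite /step addrAC subrr sub0r normrN.
  by apply: primitive_bound; [exact: field_continuous|move=> s; exact: f_bound|].
(* An opaque name for the bound on the distance between the first two iterates. *)
have [D DE] : exists D, D = 2 * B by exists (2 * B).
have wS k : forall t, `|w k.+1 t - w k t| <= D / 2 ^+ k.
  elim: k => [|k IH] t; first by rewrite expr0 divr1 DE; exact: (stepy _ (cw 0%N)).
  have := step_contraction (cw k.+1) (cw k) IH t.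
  by rewrite expr1 -mulrA -invfM -exprSr.
have lim t i : exists l, forall k, `|l - w k t 0 i| <= 2 * D / 2 ^+ k.
  apply: geometric_limit => k.
  by rewrite (le_trans _ (wS k t))// (le_trans _ (coord_norm_le _ i))// !mxE.
pose v t : E := \row_i projT1 (cid (lim t i)).
have D0 : 0 <= D by have := wS 0%N 0; rewrite expr0 divr1; apply: le_trans.
have vw k t : `|v t - w k t| <= 2 * D / 2 ^+ k.
  apply: row_norm_le => [|i].
    by rewrite divr_ge0 ?mulr_ge0 ?exprn_ge0.
  by rewrite !mxE; exact: projT2 (cid (lim t i)) k.
have cv : continuous v.
  move=> t; apply/cvgrPdist_le => e e0.
  have e40 : 0 < e / 4 by rewrite divr_gt0.
  have [k Hk] := half_pow_small (2 * D) e40.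
  have wc : \forall s \near t, `|w k t - w k s| <= e / 4.
    by have /cvgrPdist_le := cw k t; apply.
  apply: filterS wc => s ws.
  have -> : v t - v s = (v t - w k t) + (w k t - w k s) - (v s - w k s).
    by rewrite opprB [RHS]addrA (addrA (v t - w k t)) subrK subrK.
  rewrite (le_trans (ler_normB _ _))//.
  have := ler_normD (v t - w k t) (w k t - w k s).
  have := vw k t; have := vw k s; move: ws Hk.
  move: (2 * D / 2 ^+ k) (`|v t - w k t + (w k t - w k s)|) (`|v t - w k t|)
    (`|w k t - w k s|) (`|v s - w k s|) => x1 x2 x3 x4 x5; lra.
(* Both [v] and [step v] are within a multiple of [2^-k] of the iterate [w k.+1 = step (w k)], the
   latter by contraction. *)
have vstep t : v t = step v t.
  apply/eqP; rewrite -subr_eq0 -normr_le0; apply/ler_addgt0Pl => e e0; rewrite addr0.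
  have e20 : 0 < e / 2 by rewrite divr_gt0.
  have [k Hk] := half_pow_small (2 * D) e20.
  have H1 := vw k.+1 t.
  have H2 := step_contraction cv (cw k) (vw k) t.
  have sub3 (a b c : E) : a - b = (a - c) - (b - c) by rewrite opprB addrA subrK.
  have -> : v t - step v t = (v t - w k.+1 t) - (step v t - step (w k) t).
    exact: sub3.
  rewrite (le_trans (ler_normB _ _))//.
  have p1 : 2 * D / 2 ^+ k.+1 <= 2 * D / 2 ^+ k.
    rewrite exprS invfM mulrCA ler_piMl// ?invf_le1 ?ler1n//.
    by rewrite divr_ge0 ?mulr_ge0 ?exprn_ge0.
  have p2 : 2 * D / 2 ^+ k / 2 ^+ 1 <= 2 * D / 2 ^+ k.
    rewrite expr1 ler_piMr// ?invf_le1 ?ler1n//.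
    by rewrite divr_ge0 ?mulr_ge0 ?exprn_ge0.
  have := le_trans H1 p1; have := le_trans H2 p2; move: Hk.
  move: (2 * D / 2 ^+ k) (`|v t - w k.+1 t|) (`|step v t - step (w k) t|) => x1 x2 x3; lra.
have nt (t : R) : - 2 < t < 2 -> \forall s \near t, tau s = s.
  move=> /near_itv H; apply: filterS H => s /andP[s1 s2].
  by apply: clamp_id; rewrite !ltW.
have tau0 : tau 0 = 0 by apply: clamp_id; rewrite oppr_le0 ler0n.
have t3 (t : R) : - 2 < t < 2 -> - 3 < t < 3.
  by move=> /andP[t1 t2]; apply/andP; split; lra.
exists (position v), v; split.
- by rewrite /position tau0; have [-> _] := primitiveP cv; rewrite addr0.
- by rewrite vstep /step tau0; have [-> _] := primitiveP (field_continuous cv); rewrite subr0.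
- move=> t t2; have [_ H] := primitiveP cv.
  have N : \forall s \near t, z0 + primitive v s = position v s.
    by apply: filterS (nt t t2) => s ts; rewrite /position ts.
  apply: near_eq_is_derive N _.
  have := is_deriveD (is_derive_cst z0 t (1 : R)) (H _ (t3 _ t2)).
  by rewrite add0r.
- move=> t t2; have [_ H] := primitiveP (field_continuous cv).
  have N : \forall s \near t, y - primitive (fun s => f (position v s, v s)) s = v s.
    by apply: filterS (nt t t2) => s ts; rewrite vstep /step ts.
  apply: near_eq_is_derive N _.
  have := is_deriveB (is_derive_cst y t (1 : R)) (H _ (t3 _ t2)).
  by rewrite sub0r.
- by move=> t; rewrite vstep; exact: stepy.
Qed.

End picard_iteration.

(** The time interval is fixed and the smallness is put on the velocity, because the exponential map
    needs solutions up to time 1. [S] is precomposed with retractions onto a ball of positions and a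
    ball of velocities, and the solution is shown to stay where these are the identity. *)
Lemma spray_existence (R : realType) n (W : set 'rV[R]_n)
    (S : 'rV[R]_n * 'rV[R]_n -> 'rV[R]_n) (z0 : 'rV[R]_n) :
  spray_on W S -> W z0 -> exists2 eps : R, 0 < eps & forall y, `|y| <= eps ->
  exists z v : R -> 'rV[R]_n, [/\ z 0 = z0, v 0 = y & forall t : R, - 2 < t < 2 ->
    [/\ is_derive t (1 : R) z (v t), is_derive t (1 : R) v (- S (z t, v t)) &
      W (z t)]].
Proof.
move=> HS Wz0.
have [r [K [r0 K0 rW Sb Sl]]] := spray_bounds HS Wz0.
(* With speeds at most [d], the bounds [d <= 1] and [K * d <= 12^-1] make the field 1/12-Lipschitz,
   and [d <= r / 4] keeps positions within [2 * d <= r / 2]. Starting from |y| <= d / 2, the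
   velocity varies by at most [2 * (K * d ^+ 2) <= d / 6], so it stays below [d]. *)
have [d [d0 d1 dr dK]] : exists d : R, [/\ 0 < d, d <= 1, d <= r / 4 & K * d <= 12^-1].
  have k0 : 0 < 12^-1 / K by rewrite divr_gt0// invr_gt0.
  exists (Num.min 1 (Num.min (r / 4) (12^-1 / K))); split.
  - by rewrite !lt_min ltr01 k0 divr_gt0.
  - by rewrite ge_min lexx.
  - by rewrite !ge_min lexx orbT.
  - by rewrite mulrC -ler_pdivlMr// !ge_min lexx !orbT.
have d0' := ltW d0; have K0' := ltW K0.
have r20 : 0 <= r / 2 by rewrite divr_ge0// ltW.
pose cz (z : 'rV[R]_n) := z0 + clamp_row (r / 2) (z - z0).
have czr z : ball z0 r (cz z).
  rewrite -ball_normE/= /cz opprD addrA subrr sub0r normrN.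
  by rewrite (le_lt_trans (clamp_row_norm _ r20))// ltr_pdivrMr// ltr_pMr// ltr1n.
pose f (p : 'rV[R]_n * 'rV[R]_n) := S (cz p.1, clamp_row d p.2).
have fb p : `|f p| <= K * d ^+ 2.
  rewrite (le_trans (Sb _ _ (czr _)))// ler_wpM2l// lerXn2r ?nnegrE//.
  exact: clamp_row_norm.
have fl p p' : `|f p - f p'| <= 12^-1 * (`|p.1 - p'.1| + `|p.2 - p'.2|).
  rewrite (le_trans (Sl d _ _ _ _ d0 (czr _) (czr _) (clamp_row_norm _ d0') (clamp_row_norm _ d0')))//.
  have h1 : `|cz p.1 - cz p'.1| <= `|p.1 - p'.1|.
    rewrite /cz opprD addrACA subrr add0r (le_trans (clamp_row_lip _ _ _))//.
    by rewrite opprB addrA subrK.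
  have h2 : `|clamp_row d p.2 - clamp_row d p'.2| <= `|p.2 - p'.2| by exact: clamp_row_lip.
  apply: (@le_trans _ _ (K * (d * `|p.1 - p'.1| + d * `|p.2 - p'.2|))).
    apply: ler_wpM2l => //; apply: lerD; last exact: ler_wpM2l.
    rewrite (@le_trans _ _ (d * `|cz p.1 - cz p'.1|))//; last by rewrite ler_wpM2l.
    by rewrite ler_wpM2r// expr2 ler_piMl.
  by rewrite -mulrDr mulrA ler_wpM2r ?addr_ge0.
exists (d / 2); first by rewrite divr_gt0.
move=> y yd.
have [z [v [z00 v0 dz dv vy]]] := picard_fixpoint z0 y fb fl.
have vd t : `|v t| <= d.
  rewrite -[v t](subrK y) (le_trans (ler_normD _ _))//.
  have := vy t; have : K * d ^+ 2 <= d / 12.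
    by rewrite expr2 mulrA mulrC ler_wpM2l.
  move: yd; move: (K * d ^+ 2) (`|v t - y|) (`|y|) => a b c; lra.
have zd (t : R) : - 2 < t < 2 -> `|z t - z0| <= r / 2.
  move=> t2.
  have tt : - `|t| <= t <= `|t| by rewrite lerNl -normrN ler_norm normrN ler_norm.
  have ab : `|t| < 2 by rewrite ltr_norml.
  apply: (@le_trans _ _ (`|t| * d)); last first.
    apply: (@le_trans _ _ (2 * d)); first by rewrite ler_wpM2r// ltW.
    by move: dr; lra.
  apply: (@derive_bound_from0 _ _ (fun s => z s - z0) v) => //.
    by rewrite z00 subrr.
  move=> s /andP[s1 s2].
  have s2' : - 2 < s < 2.
    by rewrite (le_lt_trans s2 ab) andbT (lt_le_trans _ s1)// ltrN2.
  have := is_deriveB (dz s s2') (is_derive_cst z0 s (1 : R)).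
  by rewrite subr0.
exists z, v; split=> // t t2.
have fE : f (z t, v t) = S (z t, v t).
  rewrite /f /cz/= clamp_row_id; last exact: zd.
  by rewrite addrC subrK clamp_row_id.
split; first exact: dz.
  by rewrite -fE; exact: dv.
apply: rW; rewrite -ball_normE/= distrC (le_lt_trans (zd t t2))//.
by rewrite ltr_pdivrMr// ltr_pMr// ltr1n.
Qed.

(** * Geodesics *)

Section geodesics.
Context {R : realType} {n : nat} {M : smoothManifold R n}.
Local Notation E := 'rV[R]_n.

Lemma geodesic_spray (F : M -> E -> R) c : finsler_metric F -> atlas c ->
  spray_on (ccod c) (geodesic_coef F c).
Proof.
move=> HF hc; split.
- exact: ccod_open.
- by move=> z _; exact: geodesic_coef0.
- by move=> z w a cz a0; exact: geodesic_coefZ.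
- by move=> z w cz w0; apply: geodesic_coef_lip.
Qed.

(** Solve for the small velocity [a *: y] and slow time down by [a]: homogeneity of degree 2 makes
    the reparametrised curve a solution with velocity [y]. *)
Lemma spray_existence_any (W : set E) (S : E * E -> E) (z0 y : E) :
  spray_on W S -> W z0 -> exists2 d : R, 0 < d & exists z v : R -> E,
  [/\ z 0 = z0, v 0 = y & forall t : R, - d < t < d ->
    [/\ is_derive t (1 : R) z (v t), is_derive t (1 : R) v (- S (z t, v t)) &
      W (z t)]].
Proof.
move=> HS Wz0; have [eps eps0 H] := spray_existence HS Wz0.
pose a := eps / (`|y| + 1).
have a0 : 0 < a by rewrite divr_gt0// ltr_wpDl.
have [|z [v [z00 v0 zv]]] := H (a *: y).
  rewrite normrZ gtr0_norm// /a mulrAC ler_pdivrMr ?ltr_wpDl//.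
  by rewrite ler_pM2l// lerDl.
exists a => //; exists (fun s => z (a^-1 *: s)), (fun s => a^-1 *: v (a^-1 *: s)).
split; first by rewrite scaler0.
  by rewrite scaler0 v0 scalerA mulVf ?gt_eqF// scale1r.
move=> t /andP[t1 t2].
have s2 : - 2 < a^-1 *: t < 2.
  rewrite -[_ *: _]/(_ * _) mulrC; apply/andP; split.
    by rewrite ltr_pdivlMr//; lra.
  by rewrite ltr_pdivrMr//; lra.
have [dz dv Wz] := zv _ s2.
have ds : is_derive t (1 : R) (fun s : R => a^-1 *: s) (a^-1).
  have := is_derive_affine (a^-1 : R) 0 t.
  rewrite (_ : (fun h => _) = fun s => a^-1 *: s)//.
  by apply/funext => s; rewrite addr0 -![_ *: _]/(_ * _) mulrC.
have comp (f : R -> E) df : is_derive (a^-1 *: t) (1 : R) f df ->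
    is_derive t (1 : R) (fun s => f (a^-1 *: s)) (a^-1 *: df).
  move=> [f1 f2].
  have df1 : differentiable f (a^-1 *: t) by apply/derivable1_diffP.
  have := @is_derive_comp _ _ _ _ f (fun s : R => a^-1 *: s) t 1 a^-1 df1 ds.
  have -> : 'D_(a^-1) f (a^-1 *: t) = a^-1 *: df.
    by rewrite -[X in 'D_X f _]mulr1 -[X in 'D_X f _]/(a^-1 *: 1) deriveZv// f2.
  by [].
split=> //; first exact: comp.
rewrite (sprayZ HS)// ?invr_gt0//.
have H2 := @is_deriveZ _ _ _ (fun s => v (a^-1 *: s)) a^-1 t 1 _ (comp _ _ dv).
by apply: is_derive_eq H2 _; rewrite scalerA scalerN expr2.
Qed.

Lemma derive1_is_derive (V : normedModType R) (f : R -> V) t df :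
  is_derive t (1 : R) f df -> derive1 f t = df.
Proof. by move=> [_ <-]; rewrite derive1E. Qed.

(** [geodesic_eq_at] requires the equation in every chart around the point; [geodesic_transition]
    transports it from [c] to the others. *)
Lemma chart_geodesic (F : M -> E -> R) c (I : set R) (z v : R -> E) :
  finsler_metric F -> atlas c -> open I ->
  (forall t, I t -> [/\ is_derive t (1 : R) z (v t),
    is_derive t (1 : R) v (- geodesic_coef F c (z t, v t)) & ccod c (z t)]) ->
  forall t, I t -> geodesic_eq_at F (cinv c \o z) t.
Proof.
move=> HF hc oI H t It; have [dz dv cz] := H t It.
have nI : \forall s \near t, I s by exact: open_nbhs_nbhs.
have zc : {for t, continuous z} := is_derive_continuous dz.
split.
  by apply: continuous_comp => //; exact: cinv_continuous.
move=> d hd dt; have od : overlap c d (z t) by [].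
have no : \forall s \near t, overlap c d (z s) by exact: zc (near_overlap od).
have vel s : I s -> overlap c d (z s) ->
    is_derive s (1 : R) (cto d \o (cinv c \o z)) ('D_(v s) (transition c d) (z s)).
  by move=> Is os; have [dzs _ _] := H s Is; exact: transition_velocity.
have acc := transition_acceleration hc hd od dz dv.
have N : \forall s \near t,
    'D_(v s) (transition c d) (z s) = derive1 (cto d \o (cinv c \o z)) s.
  apply: filterS (filterI nI no) => s [Is os].
  exact: esym (derive1_is_derive (vel s Is os)).
have acc' := near_eq_is_derive N acc.
split.
- by apply: filterS (filterI nI no) => s [Is os]; have [] := vel s Is os.
- by case: acc'.
- have -> : derive1n 2 (cto d \o (cinv c \o z)) t = _ := derive1_is_derive acc'.
  rewrite (derive1_is_derive (vel t It od)).
  apply: (geodesic_transition HF hc hd od _ dv).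
    by apply: filterS nI => s /H[].
  by rewrite addNr.
Qed.

Lemma geodesic_eq_chart (F : M -> E -> R) c (gamma : R -> M) t :
  atlas c -> cdom c (gamma t) -> geodesic_eq_at F gamma t ->
  is_derive t (1 : R) (cto c \o gamma) (derive1 (cto c \o gamma) t) /\
  is_derive t (1 : R) (derive1 (cto c \o gamma))
    (- geodesic_coef F c (cto c (gamma t), derive1 (cto c \o gamma) t)).
Proof.
move=> hc ct [_ /(_ c hc ct)[d1 d2 eq]]; split.
  by split; [exact: nbhs_singleton d1|rewrite derive1E].
split=> //; rewrite -derive1E; apply/eqP; rewrite -addr_eq0; apply/eqP.
exact: eq.
Qed.

Lemma chart_geodesic_velocity c p (z v : R -> E) : c = chart_at p ->
  z 0 = cto c p -> is_derive (0 : R) (1 : R) z (v 0) -> ccod c (z 0) ->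
  (cinv c \o z) 0 = p /\ velocity (M := M) (cinv c \o z) 0 = v 0.
Proof.
move=> cE z0 dz cz.
have gp : (cinv c \o z) 0 = p.
  by rewrite /= z0 ctoK// cE; exact: chart_at_dom.
split=> //; rewrite /velocity gp -cE; apply: derive1_is_derive.
have N : \forall s \near (0 : R), z s = (cto c \o (cinv c \o z)) s.
  have nz : \forall s \near (0 : R), ccod c (z s).
    exact: (is_derive_continuous dz (near_ccod cz)).
  by apply: filterS nz => s cs; rewrite /= cinvK.
exact: near_eq_is_derive N dz.
Qed.

Lemma chart_geodesic_from (F : M -> E -> R) p (z v : R -> E) (d : R) :
  finsler_metric F -> 0 < d -> z 0 = cto (chart_at p) p ->
  (forall t : R, - d < t < d -> [/\ is_derive t (1 : R) z (v t),
    is_derive t (1 : R) v (- geodesic_coef F (chart_at p) (z t, v t)) &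
    ccod (chart_at p) (z t)]) ->
  exists gamma : R -> M, [/\ gamma 0 = p, velocity gamma 0 = v 0 &
    forall t, - d < t < d -> geodesic_eq_at F gamma t].
Proof.
move=> HF d0 z0 H; have hc := chart_at_atlas p.
have d00 : - d < 0 < d by rewrite d0 oppr_lt0 d0.
have [dz dv cz] := H 0 d00.
have [g0 gv] := chart_geodesic_velocity erefl z0 dz cz.
exists (cinv (chart_at p) \o z); split=> //.
apply: (@chart_geodesic F (chart_at p) [set t | - d < t < d] z v) => //.
have -> : [set t | - d < t < d] = `]- d, d[%classic.
  by apply/seteqP; split=> t /=; rewrite in_itv.
exact: itv_open.
Qed.

Lemma geodesic_existence (F : M -> E -> R) p y : finsler_metric F ->
  exists2 d : R, 0 < d & exists gamma : R -> M, [/\ gamma 0 = p,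
    velocity gamma 0 = y & forall t, - d < t < d -> geodesic_eq_at F gamma t].
Proof.
move=> HF; have hc := chart_at_atlas p; have cp := chart_at_dom p.
have [d d0 [z [v [z0 <- H]]]] :=
  spray_existence_any y (geodesic_spray HF hc) (cto_cod cp).
by exists d => //; exact: chart_geodesic_from H.
Qed.

Lemma geodesic_existence_small (F : M -> E -> R) p : finsler_metric F ->
  exists2 eps : R, 0 < eps & forall y, `|y| <= eps ->
  exists gamma : R -> M, [/\ gamma 0 = p, velocity gamma 0 = y &
    forall t, - 2 < t < 2 -> geodesic_eq_at F gamma t].
Proof.
move=> HF; have hc := chart_at_atlas p; have cp := chart_at_dom p.
have [eps eps0 H] := spray_existence (geodesic_spray HF hc) (cto_cod cp).
exists eps => // y /H[z [v [z0 <- {}H]]].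
exact: chart_geodesic_from H.
Qed.

End geodesics.

Lemma is_derive_comp_opp (R : realType) (V W : normedModType R) (f : V -> W)
    (x v : V) : differentiable f (- x) ->
  is_derive x v (fun y => f (- y)) (- 'D_v f (- x)).
Proof.
move=> df; have D : is_derive x v (-%R : V -> V) (- v) by exact: is_deriveNid.
have H := @is_derive_comp _ _ _ _ f (-%R) x v (- v) df D.
by apply: is_derive_eq H _; rewrite deriveNv.
Qed.

(** * Geodesics of the reversed metric *)

Section reversal.
Context {R : realType} {n : nat} {M : smoothManifold R n}.
Local Notation E := 'rV[R]_n.
Local Notation e := (basis_vec R).

Variables (F : M -> E -> R) (HF : finsler_metric F).
Variables (c : chart R n M) (hc : atlas c).
Local Notation L := (local_sq F c).
Local Notation L' := (local_sq (reverse F) c).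

Lemma local_sq_reverse (z w : E) : ccod c z -> L' (z, w) = L (z, - w).
Proof. by move=> cz; rewrite /local_sq/= tangent_ofN. Qed.

Lemma momentum_reverse (z w b : E) : ccod c z -> w != 0 ->
  'D_(0, b) L' (z, w) = - 'D_(0, b) L (z, - w).
Proof.
move=> cz w0; apply: etrans (derive_fibre L' z w b) _.
have -> : (fun w : E => L' (z, w)) = fun w => L (z, - w).
  by apply/funext => v; exact: local_sq_reverse.
have w0' : - w != 0 by rewrite oppr_eq0.
have [d1 _ _] := fibre_C2 HF hc cz w0'.
have [_ H] := is_derive_comp_opp b d1.
apply: etrans H _; apply: (congr1 -%R).
exact: esym (derive_fibre L z (- w) b).
Qed.

Lemma tensor_reverse (z w : E) : ccod c z -> w != 0 ->
  fundamental_tensor (reverse F) c (z, w) = fundamental_tensor F c (z, - w).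
Proof.
move=> cz w0; apply/matrixP => i j.
apply: etrans (tensorE (reverse F) c z w i j) _.
apply: etrans _ (esym (tensorE F c z (- w) i j)).
apply: (congr1 ( *%R 2^-1)).
have fE : (fun w : E => L' (z, w)) = fun w => L (z, - w).
  by apply/funext => v; exact: local_sq_reverse.
have N : \forall v \near w, 'D_(e j) (fun w => L' (z, w)) v =
    - 'D_(e j) (fun w => L (z, w)) (- v).
  apply: filterS (near_neq0 w0) => v v0; rewrite fE.
  have v0' : - v != 0 by rewrite oppr_eq0.
  have [d1 _ _] := fibre_C2 HF hc cz v0'.
  by have [_ H] := is_derive_comp_opp (e j) d1.
apply: etrans (near_eq_derive (e i) N) _.
have w0' : - w != 0 by rewrite oppr_eq0.
have [_ d2 _] := fibre_C2 HF hc cz w0'.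
have [_ H] := is_deriveN (is_derive_comp_opp (e i) (d2 (e j))).
by apply: etrans H _; rewrite opprK.
Qed.

Lemma force_reverse (z w : E) j : ccod c z -> w != 0 ->
  force (reverse F) c j (z, w) = force F c j (z, - w).
Proof.
move=> cz w0; have w0' : - w != 0 by rewrite oppr_eq0.
have nz := near_ccod cz.
have H1 k : 'D_(e k, 0) ('D_(0, e j) L') (z, w) =
    - 'D_(e k, 0) ('D_(0, e j) L) (z, - w).
  apply: etrans (derive_base ('D_(0, e j) L') z w (e k)) _.
  have N : \forall y \near z, 'D_(0, e j) L' (y, w) = - 'D_(0, e j) L (y, - w).
    by apply: filterS nz => y cy; exact: momentum_reverse.
  apply: etrans (near_eq_derive (e k) N) _.
  have dm : derivable (fun y => 'D_(0, e j) L (y, - w)) z (e k).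
    have sq : slit_domain c (z, - w) by [].
    have dm := momentum_differentiable HF hc j sq.
    exact: derivable_base dm.
  apply: etrans (deriveN dm) _; apply: (congr1 -%R).
  exact: esym (derive_base ('D_(0, e j) L) z (- w) (e k)).
have H2 : 'D_(e j, 0) L' (z, w) = 'D_(e j, 0) L (z, - w).
  apply: etrans (derive_base L' z w (e j)) _.
  have N : \forall y \near z, L' (y, w) = L (y, - w).
    by apply: filterS nz => y cy; exact: local_sq_reverse.
  apply: etrans (near_eq_derive (e j) N) _.
  exact: esym (derive_base L z (- w) (e j)).
rewrite /force H2; congr (_ * _ - _).
by apply: eq_bigr => k _; rewrite H1 /= mxE mulrN mulNr.
Qed.

(** The tensor takes two fibre derivatives, whose signs cancel; in the force, the sign of the single
    fibre derivative meets that of the velocity it is contracted with. *)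
Lemma geodesic_coef_reverse (z w : E) : ccod c z ->
  geodesic_coef (reverse F) c (z, w) = geodesic_coef F c (z, - w).
Proof.
move=> cz; have [->|w0] := eqVneq w 0.
  have F0 p : F p 0 = 0 by exact/(finsler_eq0 HF).
  rewrite oppr0 !geodesic_coef_zero//.
  by move=> p; rewrite /reverse oppr0.
apply/rowP => i; rewrite !geodesic_coefE !mxE; apply: eq_bigr => j _.
by rewrite tensor_reverse// force_reverse.
Qed.

Lemma spray_reverse (W : set E) (S : E * E -> E) : spray_on W S ->
  spray_on W (fun q => S (q.1, - q.2)).
Proof.
move=> HS; split.
- exact: spray_open HS.
- by move=> z Wz; rewrite /= oppr0 (spray0 HS).
- by move=> z w a Wz a0; rewrite /= -scalerN (sprayZ HS).
- move=> z w Wz w0; apply: (@lip_at_comp _ _ _ _ S (fun q : E * E => (q.1, - q.2))).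
    apply: (@lip_atI _ _ _ _ _ setT 1); first exact: filterT.
    move=> p q _ _; rewrite mul1r !prod_normE/=.
    by rewrite -opprD normrN.
  by apply: (spray_lip_slit HS) => //=; rewrite oppr_eq0.
Qed.

End reversal.

(** Time reversal negates the velocity and keeps the acceleration, which matches
    [geodesic_coef_reverse]. *)
Lemma geodesic_reverse (R : realType) n (M : smoothManifold R n)
    (F : M -> 'rV[R]_n -> R) (gamma : R -> M) (t : R) :
  finsler_metric F -> geodesic_eq_at F gamma (- t) ->
  geodesic_eq_at (reverse F) (gamma \o -%R) t.
Proof.
move=> HF [cg H]; split.
  by apply: continuous_comp => //; exact: oppr_continuous.
move=> c hc /= ct; have [d1 d2 eq] := H c hc ct.
pose z := cto c \o gamma.
have opp_near (P : R -> Prop) : (\forall s \near - t, P s) -> \forall s \near t, P (- s).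
  by move=> HP; exact: (@oppr_continuous _ R t _ HP).
have D' (s : R) : derivable z (- s) 1 ->
    is_derive s (1 : R) (fun s => z (- s)) (- derive1 z (- s)).
  move=> /derivable1_diffP dz; apply: is_derive_eq (is_derive_comp_opp (1 : R) dz) _.
  by rewrite derive1E.
have nD := opp_near _ d1.
have N : \forall s \near t, - derive1 z (- s) = derive1 (fun s => z (- s)) s.
  by apply: filterS nD => s /D' Ds; exact: esym (derive1_is_derive Ds).
have D2 : is_derive t (1 : R) (derive1 (fun s => z (- s))) (derive1 (derive1 z) (- t)).
  apply: near_eq_is_derive N _.
  have dz' : differentiable (derive1 z) (- t) by apply/derivable1_diffP.
  apply: is_derive_eq (is_deriveN (is_derive_comp_opp (1 : R) dz')) _.
  by rewrite opprK [RHS]derive1E.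
split.
- by apply: filterS nD => s /D'[].
- by case: D2.
- have -> : derive1 (derive1 (cto c \o (gamma \o -%R))) t = _ := derive1_is_derive D2.
  have -> : derive1 (cto c \o (gamma \o -%R)) t = - derive1 z (- t).
    exact: esym (nbhs_singleton N).
  have -> := geodesic_coef_reverse HF hc (- derive1 z (- t)) (cto_cod ct).
  by rewrite opprK; exact: eq.
Qed.

Lemma left_point (R : realType) (a t : R) (U : set R) : a < t -> nbhs t U ->
  exists2 s, a <= s < t & U s.
Proof.
move=> at_ /nbhs_ballP[r r0 rU].
pose s := Num.max a (t - r / 2).
have st : s < t by rewrite gt_max at_/= ltrBlDr ltrDl divr_gt0.
exists s; first by rewrite le_max lexx.
apply: rU; rewrite -ball_normE/= ger0_norm ?subr_ge0 ?(ltW st)//.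
rewrite ltrBlDr -ltrBlDl lt_max; apply/orP; right.
have r2 : r / 2 < r by rewrite ltr_pdivrMr// ltr_pMr// ltr1n.
by rewrite ltrD2l ltrN2.
Qed.

Lemma dist_continuous (R : realType) (T : topologicalType) (V : normedModType R)
    (f : T -> V) (a : V) (t : T) : {for t, continuous f} ->
  {for t, continuous (fun s => `|a - f s|)}.
Proof.
move=> cf; have H : a - f s @[s --> t] --> a - f t.
  by apply: cvgB; [exact: cvg_cst|exact: cf].
exact: cvg_norm H.
Qed.

(** * Confinement of slow geodesics to a chart *)

Section short_geodesics.
Context {R : realType} {n : nat} {M : smoothManifold R n}.
Local Notation E := 'rV[R]_n.
Variables (c : chart R n M) (S : E * E -> E).
Hypothesis HS : spray_on (ccod c) S.

(** The set is closed in [M] and not merely in the domain of the chart, being the image of a compact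
    ball in a Hausdorff space. Hence a continuous curve cannot leave the chart at the end of an
    interval on which it stays in this set. *)
Lemma chart_closed_ball (z0 : E) (b : R) : (forall z, `|z0 - z| <= b -> ccod c z) ->
  closed [set p | cdom c p /\ `|z0 - cto c p| <= b].
Proof.
move=> bc; pose B := [set z : E | `|z0 - z| <= b].
have cB : compact B.
  apply: bounded_closed_compact.
    exists (b + `|z0|); split=> // [|r rb z /= zb]; first exact: num_real.
    rewrite (le_trans _ (ltW rb))// -[z](subKr z0) (le_trans (ler_normB _ _))//.
    by rewrite addrC lerD2r.
  have -> : B = (fun z : E => `|z0 - z|) @^-1` [set x | x <= b] by [].
  apply: preimage_closed; last exact: closed_le.
  by move=> w _; apply: dist_continuous; exact: cvg_id.
have -> : [set p | cdom c p /\ `|z0 - cto c p| <= b] = cinv c @` B.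
  apply/seteqP; split=> [p [cp pb]|_ [z zb <-]] /=.
    by exists (cto c p) => //; exact: ctoK.
  split; first exact/cinv_dom/bc.
  by rewrite cinvK//; exact: bc.
apply: compact_closed; first exact: mhausdorff.
apply: continuous_compact => //.
apply: continuous_in_subspaceT => z; rewrite inE => zb.
by apply: cinv_continuous; exact: bc.
Qed.

(** Nothing says beforehand that [gamma] stays in the chart, so the equation is assumed only at
    times when it does. Real induction is run on [P]: on [0, t] it improves its own bounds from
    [2 * b] to [3 / 2 * b], hence persists beyond t, and [chart_closed_ball] lets it pass to limits.
    The last bound, quadratic in [b], says that the velocity is nearly constant relative to its
    size. *)
Lemma short_geodesics (x : M) (U : set E) : cdom c x -> nbhs (cto c x) U ->
  exists eps : R, exists K : R, [/\ 0 < eps, 0 < K &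
  forall (b : R) (gamma : R -> M), 0 < b <= eps -> gamma 0 = x ->
  let z := cto c \o gamma in let v := derive1 z in
  (forall t, 0 <= t <= 1 -> {for t, continuous gamma}) ->
  (forall t, 0 <= t <= 1 -> cdom c (gamma t) ->
    is_derive t (1 : R) z (v t) /\ is_derive t (1 : R) v (- S (z t, v t))) ->
  `|v 0| <= b -> forall t, 0 <= t <= 1 ->
  [/\ cdom c (gamma t), U (z t), `|v t| <= 2 * b & `|v t - v 0| <= K * b ^+ 2]].
Proof.
move=> cx nU; pose z0 := cto c x.
have [r1 [K [r10 K0 rW Sb _]]] := spray_bounds HS (cto_cod cx).
move: nU => /nbhs_ballP[r2 r20 rU].
have [r [r0 rr1 rr2]] : exists r : R, [/\ 0 < r, r <= r1 & r <= r2].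
  by exists (Num.min r1 r2); rewrite lt_min r10 r20 !ge_min !lexx ?orbT.
(* [2 * eps < r] keeps positions in the ball where the spray is bounded. The velocity changes by at
   most [K * (2 * b) ^+ 2 = 4 * K * b ^+ 2], which [epsK] makes at most [b / 2]. *)
have [eps [eps0 epsr epsK]] : exists eps : R, [/\ 0 < eps, 2 * eps < r & 4 * K * eps <= 2^-1].
  exists (Num.min (r / 4) (2^-1 / (4 * K))); split.
  - by rewrite lt_min !divr_gt0 ?mulr_gt0 ?invr_gt0.
  - apply: (@le_lt_trans _ _ (2 * (r / 4))); last by lra.
    by rewrite ler_wpM2l// ge_min lexx.
  - rewrite mulrC -ler_pdivlMr ?mulr_gt0//.
    by rewrite ge_min lexx orbT.
exists eps, (4 * K); split=> //; first by rewrite mulr_gt0.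
move=> b gamma /andP[b0 beps] g0 z v cg Hd v0b.
have zE t : z t = cto c (gamma t) by [].
clearbody v; clearbody z.
have c32 : (3 / 2 : R) < 2 by rewrite ltr_pdivrMr// -natrM ltr_nat.
have b2r : 2 * b < r by rewrite (le_lt_trans _ epsr)// ler_wpM2l.
have b2 : 4 * K * b ^+ 2 <= b / 2.
  rewrite expr2 mulrA mulrC ler_wpM2l ?(ltW b0)//.
  by rewrite (le_trans _ epsK)// ler_wpM2l// mulr_ge0// ltW.
have inW y : `|z0 - y| <= 2 * b -> ccod c y.
  move=> yb; apply: rW; rewrite -ball_normE/=.
  by rewrite (le_lt_trans yb)// (lt_le_trans b2r).
pose P t := [/\ cdom c (gamma t), `|z0 - z t| <= 2 * b & `|v t| <= 2 * b].
have zz0 : z 0 = z0 by rewrite zE g0.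
have b20 : 0 <= 2 * b by rewrite mulr_ge0// ltW.
have P0 : P 0.
  split; [by rewrite g0|by rewrite zz0 subrr normr0|].
  by rewrite (le_trans v0b)// ler_peMl ?(ltW b0)// ler1n.
have vel t : 0 <= t -> t <= 1 -> (forall s, 0 <= s <= t -> P s) ->
    `|v t - v 0| <= 4 * K * b ^+ 2.
  move=> t0 t1 HP.
  apply: (@le_trans _ _ (4 * K * b ^+ 2 * (t - 0))).
    apply: (@mean_value_bound _ _ v (fun s => - S (z s, v s))) => // s /andP[s0 st].
      have [cs _ _] := HP s (introT andP (conj s0 st)).
      by have [] := Hd s (introT andP (conj s0 (le_trans st t1))) cs.
    have [_ zs vs] := HP s (introT andP (conj s0 st)).
    rewrite normrN (le_trans (Sb _ _ _))//.
      rewrite -ball_normE/= (le_lt_trans zs)// (lt_le_trans b2r)//.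
    have -> : 4 * K * b ^+ 2 = K * (2 * b) ^+ 2 by ring.
    by rewrite ler_wpM2l ?(ltW K0)// lerXn2r ?nnegrE.
  by rewrite subr0 ler_piMr// mulr_ge0 ?sqr_ge0// mulr_ge0// ltW.
have half t : 0 <= t -> t <= 1 -> (forall s, 0 <= s <= t -> P s) ->
    `|v t| <= 3 / 2 * b.
  move=> t0 t1 HP; rewrite -[v t](subrK (v 0)) (le_trans (ler_normD _ _))//.
  have := vel t t0 t1 HP; move: v0b b2.
  by move: (`|v 0|) (`|v t - v 0|) (4 * K * b ^+ 2) => x1 x2 x3; lra.
have all t : 0 <= t <= 1 -> P t.
  apply: (real_induction ler01 P0).
    move=> {}t t0 t1 HP.
    have t01 : 0 <= t <= 1 by rewrite t0 ltW.
    have [ct zt vt] := HP t (introT andP (conj t0 (lexx t))).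
    have [dz dv] := Hd t t01 ct.
    have b32 : 3 / 2 * b < 2 * b by rewrite ltr_pM2r.
    have vlt : `|v t| < 2 * b by rewrite (le_lt_trans (half t t0 (ltW t1) HP)).
    have zlt : `|z0 - z t| < 2 * b.
      apply: le_lt_trans b32; rewrite distrC -zz0.
      apply: (@le_trans _ _ (3 / 2 * b * (t - 0))).
        apply: (@mean_value_bound _ _ z v) => // s /andP[s0 st].
          have [cs _ _] := HP s (introT andP (conj s0 st)).
          by have [] := Hd s (introT andP (conj s0 (le_trans st (ltW t1)))) cs.
        apply: (half s s0 (le_trans st (ltW t1))).
        by move=> s' /andP[s'0 s's]; apply: HP; rewrite s'0 (le_trans s's).
      by rewrite subr0 ler_piMr ?(ltW t1)// mulr_ge0 ?(ltW b0)// divr_ge0.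
    have n1 : \forall s \near t, cdom c (gamma s).
      exact: (cg t t01 _ (near_cdom ct)).
    have n2 : \forall s \near t, `|z0 - z s| < 2 * b.
      have cz : {for t, continuous (fun s => `|z0 - z s|)}.
        by apply: dist_continuous; exact: (is_derive_continuous dz).
      exact: (cz _ (lt_nbhsl zlt)).
    have n3 : \forall s \near t, `|v s| < 2 * b.
      have cv : {for t, continuous (fun s => `|v s|)}.
        by apply: cvg_norm; exact: (is_derive_continuous dv).
      exact: (cv _ (lt_nbhsl vlt)).
    have : \forall s \near t,
        cdom c (gamma s) /\ (`|z0 - z s| < 2 * b /\ `|v s| < 2 * b).
      by apply: filterI => //; exact: filterI.
    move=> /nbhs_ballP[d d0 Hb].
    exists d => // s /andP[ts std].
    have [c1 [c2 c3]] : cdom c (gamma s) /\ (`|z0 - z s| < 2 * b /\ `|v s| < 2 * b).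
      apply: Hb; rewrite -ball_normE/= distrC ger0_norm ?subr_ge0//.
      by rewrite ltrBlDl.
    by split=> //; exact: ltW.
  move=> {}t t0 t1 HP; have t01 : 0 <= t <= 1 by rewrite ltW.
  have [ct zt] : [set p | cdom c p /\ `|z0 - cto c p| <= 2 * b] (gamma t).
    apply: (chart_closed_ball inW) => V nV.
    have [s st Vs] := left_point t0 (cg t t01 _ nV).
    exists (gamma s); split; last exact: Vs.
    by have [cs zs _] := HP s st; rewrite zE in zs.
  have [_ dv] := Hd t t01 ct; split; [exact: ct|by rewrite zE|].
  rewrite leNgt; apply/negP => vb.
  have cv : {for t, continuous (fun s => `|v s|)}.
    by apply: cvg_norm; exact: (is_derive_continuous dv).
  have [s st] := left_point t0 (cv _ (lt_nbhsr vb)).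
  by have [_ _] := HP s st; rewrite leNgt => /negP.
move=> t t01; have [ct zt vt] := all t t01; split=> //.
  by apply: rU; rewrite -ball_normE/= (le_lt_trans zt)// (lt_le_trans b2r).
move/andP : t01 => [t0 t1]; apply: vel => // s /andP[s0 st].
by apply: all; rewrite s0 (le_trans st t1).
Qed.

End short_geodesics.

(** * Functions with locally Lipschitz second derivatives *)

Section C2_functions.
Context {R : realType} {n : nat}.
Local Notation E := 'rV[R]_n.
Local Notation e := (basis_vec R).
Variables (W : set E) (f : E -> R).
Hypotheses (oW : open W) (fC : Ck1 2 W f).

Let nearW z : W z -> \forall y \near z, W y.
Proof. by move=> Wz; apply: open_nbhs_nbhs. Qed.

Lemma C21_differentiable z : W z -> differentiable f z.
Proof. by move=> Wz; have [H _] := fC; exact: H. Qed.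

Lemma C21_derive_differentiable z u : W z -> differentiable ('D_u f) z.
Proof. by move=> Wz; have [_ H] := fC; have [H' _] := H u; exact: H'. Qed.

Lemma near_derive_gt z u (a : R) : W z -> a < 'D_u f z ->
  \forall y \near z, a < 'D_u f y.
Proof.
move=> Wz au.
have cD := differentiable_continuous (C21_derive_differentiable u Wz).
exact: (cD _ (lt_nbhsr au)).
Qed.

Lemma C21_derive2_lip z u v : W z -> lip_at ('D_v ('D_u f)) z.
Proof.
move=> Wz; have [_ H] := fC; have [_ H'] := H u.
exact: locally_lipschitz_lip_at (H' v).
Qed.

Lemma C21_derive_lip z u : W z -> lip_at ('D_u f) z.
Proof.
move=> Wz; apply: C1_lip_at_row; last by move=> v; exact: C21_derive2_lip.
by apply: filterS (nearW Wz) => y; exact: C21_derive_differentiable.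
Qed.

Lemma curve_derive (z : R -> E) t v : W (z t) -> is_derive t (1 : R) z v ->
  is_derive t (1 : R) (f \o z) ('D_v f (z t)).
Proof. by move=> Wz dz; apply: is_derive_comp => //; exact: C21_differentiable. Qed.

Lemma curve_derive2 (z v : R -> E) (t : R) (a : E) : W (z t) ->
  is_derive t (1 : R) z (v t) -> is_derive t (1 : R) v a ->
  is_derive t (1 : R) (fun s => 'D_(v s) f (z s))
    ('D_(v t) ('D_(v t) f) (z t) + 'D_a f (z t)).
Proof.
move=> Wz; apply: curve_derive_direction.
  by apply: filterS (nearW Wz) => y; exact: C21_differentiable.
by move=> u; exact: C21_derive_differentiable.
Qed.

Lemma derive2_basis z w : W z ->
  'D_w ('D_w f) z = \sum_j w 0 j * \sum_i w 0 i * 'D_(e i) ('D_(e j) f) z.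
Proof.
move=> Wz.
have N : \forall y \near z, 'D_w f y = \sum_j w 0 j * 'D_(e j) f y.
  apply: filterS (nearW Wz) => y Wy.
  by apply: derive_basis; exact: C21_differentiable.
apply: etrans (near_eq_derive w N) _.
have dh j : derivable ('D_(e j) f) z w.
  by apply: diff_derivable; exact: C21_derive_differentiable.
have [_ H] := derive_lincomb (fun j => w 0 j) dh.
apply: etrans H _; apply: eq_bigr => j _; apply: (congr1 ( *%R (w 0 j))).
by apply: derive_basis; exact: C21_derive_differentiable.
Qed.

(** The right-hand side of [curve_derive2] for the acceleration [- S q]. For the spray of a metric
    it is the Finslerian Hessian in coordinates, see [finsler_hessian_chart]. *)
Definition spray_hessian (S : E * E -> E) (q : E * E) : R :=
  'D_(q.2) ('D_(q.2) f) q.1 - 'D_(S q) f q.1.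

Lemma spray_hessian_lip S z w : W z -> lip_at S (z, w) ->
  lip_at (spray_hessian S) (z, w).
Proof.
move=> Wz lS.
have nq : \forall q \near (z, w), W q.1.
  by exists (W, setT) => [|[y v] [/= Wy _]//]; split; [exact: nearW|exact: filterT].
have N (q : E * E) : W q.1 ->
    \sum_j q.2 0 j * (\sum_i q.2 0 i * 'D_(e i) ('D_(e j) f) q.1) -
      \sum_i (S q : E) 0 i * 'D_(e i) f q.1 = spray_hessian S q.
  move=> Wq; apply: esym; rewrite /spray_hessian.
  rewrite (derive2_basis _ Wq) (derive_basis _ (C21_differentiable Wq)).
  by [].
apply: lip_at_near (filterS N nq) _; apply: lip_atB; apply: lip_at_sum => j _.
  apply: lip_atM; first exact: snd_coord_lip.
  apply: lip_at_sum => i _; apply: lip_atM; first exact: snd_coord_lip.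
  by apply: (lip_at_fst (h := 'D_(e i) ('D_(e j) f))); exact: C21_derive2_lip.
apply: lip_atM; first exact: lip_at_coord.
by apply: (lip_at_fst (h := 'D_(e j) f)); exact: C21_derive_lip.
Qed.

Lemma spray_hessian0 S z : W z -> S (z, 0) = 0 -> spray_hessian S (z, 0) = 0.
Proof. by move=> Wz S0; rewrite /spray_hessian/= S0 !derive0 subr0. Qed.

Lemma spray_hessianZ S z w (a : R) : W z -> S (z, a *: w) = a ^+ 2 *: S (z, w) ->
  spray_hessian S (z, a *: w) = a ^+ 2 * spray_hessian S (z, w).
Proof.
move=> Wz Sa; rewrite /spray_hessian/= Sa !(derive2_basis _ Wz).
rewrite (deriveZv _ _ (C21_differentiable Wz)) mulrBr; congr (_ - _).
rewrite mulr_sumr; apply: eq_bigr => j _; rewrite mxE.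
have -> : \sum_i (a *: w) 0 i * 'D_(e i) ('D_(e j) f) z =
    a * \sum_i w 0 i * 'D_(e i) ('D_(e j) f) z.
  by rewrite mulr_sumr; apply: eq_bigr => i _; rewrite mxE mulrA.
by rewrite expr2 -!mulrA; congr (_ * _); rewrite mulrCA.
Qed.

End C2_functions.

(** * The zero set of a function with nonvanishing differential *)

Section boundary_function.
Context {R : realType} {n : nat}.
Local Notation E := 'rV[R]_n.
Local Notation e := (basis_vec R).
Variables (W : set E) (f : E -> R).
Hypotheses (oW : open W) (fC : Ck1 2 W f).

Lemma derive_pair_lip (z w : E) : W z ->
  lip_at (fun q : E * E => 'D_(q.2) f q.1) (z, w).
Proof.
move=> Wz.
have nq : \forall q \near (z, w), W q.1.
  exists (W, setT) => [|[y v] [/= Wy _]//].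
  by split; [exact: open_nbhs_nbhs|exact: filterT].
have N (q : E * E) : W q.1 ->
    \sum_i q.2 0 i * 'D_(e i) f q.1 = 'D_(q.2) f q.1.
  by move=> Wq; apply: esym; exact: derive_basis (C21_differentiable fC Wq).
apply: lip_at_near (filterS N nq) _; apply: lip_at_sum => i _.
apply: lip_atM; first exact: snd_coord_lip.
apply: (lip_at_fst (h := 'D_(e i) f)).
exact: (C21_derive_lip oW fC (e i) Wz).
Qed.

(** By continuity ['D_v f] exceeds some [m > 0] on a ball, and [T] is so small that segments of
    direction [v] starting in the half ball stay in it. This takes the place of the implicit
    function theorem. *)
Lemma ascending_direction (z0 v : E) (U : set E) : W z0 -> 0 < 'D_v f z0 ->
  nbhs z0 U -> exists r : R, exists T : R, exists m : R,
  [/\ 0 < r, 0 < T, 0 < m & forall z, ball z0 r z ->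
    (forall s : R, `|s| <= T -> W (s *: v + z) /\ U (s *: v + z)) /\
    forall s : R, 0 <= s <= T ->
      f z + m * s <= f (s *: v + z) /\ f ((- s) *: v + z) <= f z - m * s].
Proof.
move=> Wz0 fv Uz0.
have [m m0 mv] : exists2 m : R, 0 < m & m < 'D_v f z0.
  by move: ('D_v f z0) fv => x x0; exists (x / 2); lra.
have N1 := near_derive_gt fC Wz0 mv.
have N2 : \forall z \near z0, W z by exact: open_nbhs_nbhs.
have : nbhs z0 [set z | [/\ W z, m < 'D_v f z & U z]].
  by apply: filterS (filterI (filterI N2 N1) Uz0) => z [[]].
move=> /nbhs_ballP[r /= r0 Hr].
set N := `|v| + 1.
have N0 : 0 < N by rewrite ltr_wpDl.
have T0 : 0 < r / 2 / N by rewrite !divr_gt0.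
exists (r / 2), (r / 2 / N), m; split=> //; first by rewrite divr_gt0.
move=> z zr.
have inb (s : R) : `|s| <= r / 2 / N -> ball z0 r (s *: v + z).
  move=> sT; have sv : `|s *: v| <= r / 2.
    rewrite normrZ (@le_trans _ _ (`|s| * N))//.
      by rewrite ler_wpM2l// lerDl.
    by rewrite -ler_pdivlMr.
  move: zr; rewrite -!ball_normE/= => zr.
  have -> : z0 - (s *: v + z) = (z0 - z) - s *: v by rewrite opprD addrCA addrC.
  rewrite (le_lt_trans (ler_normB _ _))//.
  by rewrite [ltRHS](splitr r) ltr_leD.
split=> [s /inb/Hr[] //|s /andP[s0 sT]].
have mono (a b : R) : a <= b -> - s <= a -> b <= s ->
    f (a *: v + z) + m * (b - a) <= f (b *: v + z).
  move=> ab sa bs.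
  have ts (t : R) : a <= t -> t <= b -> `|t| <= r / 2 / N.
    move=> at_ tb.
    by rewrite (le_trans _ sT)// ler_norml (le_trans sa at_) (le_trans tb bs).
  have [t /andP[at_ tb]|t /andP[at_ tb] H] :=
    @mean_value _ (fun h : R => f (h *: v + z)) (fun h => 'D_v f (h *: v + z)) a b ab.
    apply: is_derive_line; apply: (C21_differentiable fC).
    by have [] := Hr _ (inb t (ts t at_ tb)).
  have [_ /ltW Hm _] := Hr _ (inb t (ts t at_ tb)).
  by rewrite -lerBrDl H ler_wpM2r// subr_ge0.
have f0E : f (0 *: v + z) = f z by rewrite scale0r add0r.
have sN : - s <= 0 by rewrite oppr_le0.
split; first by have := mono 0 s s0 sN (lexx _); rewrite f0E subr0.
by have := mono (- s) 0 sN (lexx _) s0; rewrite f0E sub0r opprK lerBrDr.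
Qed.

(** Moving by |f z| / m either way along [v] changes [f] by at least |f z|, so the intermediate
    value theorem yields a zero, with [k = m^-1]. Linearity of the displacement in |f z| is what
    [hessian_estimate] and [boundary_curve] rely on. *)
Lemma zero_along (z0 v : E) (U : set E) : W z0 -> f z0 = 0 ->
  0 < 'D_v f z0 -> nbhs z0 U ->
  exists r : R, exists k : R, [/\ 0 < r, 0 < k & forall z, ball z0 r z ->
    exists tau : R, [/\ `|tau| <= k * `|f z|, U (tau *: v + z),
      f (tau *: v + z) = 0 & forall s, `|s| <= k * `|f z| -> U (s *: v + z)]].
Proof.
move=> Wz0 fz0 fv Uz0.
have [r0 [T [m [r00 T0 m0 Hr]]]] := ascending_direction Wz0 fv Uz0.
have mT0 : 0 < m * T by rewrite mulr_gt0.
have cf : {for z0, continuous f}.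
  exact: differentiable_continuous (C21_differentiable fC Wz0).
have N3 : \forall z \near z0, `|f z| < m * T.
  have H : \forall z \near z0, ball (f z0) (m * T) (f z).
    exact: (cf _ (nbhsx_ballx (f z0) _ mT0)).
  by apply: filterS H => z; rewrite fz0 -ball_normE/= sub0r normrN.
move: N3 => /nbhs_ballP[r1 r10 Hr1].
exists (Num.min r0 r1), m^-1.
split; [by rewrite lt_min r00|by rewrite invr_gt0|move=> z zb].
have fT : `|f z| < m * T by apply: Hr1; apply: le_ball zb; rewrite ge_min lexx orbT.
have zb0 : ball z0 r0 z by apply: le_ball zb; rewrite ge_min lexx.
have [HU Hf] := Hr _ zb0.
have sgT : m^-1 * `|f z| <= T by rewrite mulrC ler_pdivrMr// mulrC ltW.
have sg0 : 0 <= m^-1 * `|f z| by rewrite mulr_ge0// invr_ge0 ltW.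
have [up dn] := Hf _ (introT andP (conj sg0 sgT)).
have msg : m * (m^-1 * `|f z|) = `|f z| by rewrite mulrA divff ?mul1r// gt_eqF.
move: up dn; rewrite msg; set sg := m^-1 * `|f z| => up dn.
have {}up : 0 <= f (sg *: v + z).
  by rewrite (le_trans _ up)// -lerBlDl sub0r -normrN ler_norm.
have {}dn : f ((- sg) *: v + z) <= 0 by rewrite (le_trans dn)// subr_le0 ler_norm.
have sgn : - sg <= sg by rewrite (@le_trans _ _ 0)// oppr_le0.
have [|| tau] := @IVT _ (fun h : R => f (h *: v + z)) (- sg) sg 0 sgn.
- apply: continuous_in_subspaceT => t; rewrite inE/= in_itv/= -ler_norml => ts.
  have [Wt _] := HU t (le_trans ts sgT).
  exact: is_derive_continuous (is_derive_line (C21_differentiable fC Wt)).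
- by rewrite ge_min dn le_max up orbT.
rewrite in_itv/= -ler_norml => ts ft.
exists tau; split=> //; first by have [] := HU _ (le_trans ts sgT).
by move=> s ss; have [] := HU _ (le_trans ss sgT).
Qed.

(* Move z along v to a zero z' of f, and w along v to a vector w' killed by the
   differential of f at z'.  Both displacements are O(|f z| + |'D_w f z|) when
   |w| = 1, and the Hessian at (z', w') is nonpositive. *)
Lemma hessian_estimate (S : E * E -> E) (z0 v : E) : spray_on W S ->
  W z0 -> f z0 = 0 -> 0 < 'D_v f z0 ->
  (\forall z \near z0, forall w, f z = 0 -> 'D_w f z = 0 ->
     spray_hessian f S (z, w) <= 0) ->
  exists r : R, exists C : R, [/\ 0 < r, 0 <= C & forall z w : E, ball z0 r z ->
    spray_hessian f S (z, w) <= C * (`|f z| * `|w| ^+ 2 + `|'D_w f z| * `|w|)].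
Proof.
move=> HS Wz0 fz0 fv hess.
pose p (q : E * E) : R := 'D_(q.2) f q.1.
pose H := spray_hessian f S.
have [m m0 mv] : exists2 m : R, 0 < m & m < 'D_v f z0.
  by move: ('D_v f z0) fv => x x0; exists (x / 2); lra.
have [|r1 [A [r10 A0 HA _]]] := compact_lip (f := p) (x0 := z0) (@closed_ball_compact R n 1).
  by move=> w _; exact: derive_pair_lip.
(* A radius that contains the corrected vectors: [w'] differs from the unit vector [w] by a multiple
   of [v] with coefficient at most [A / m]. *)
set B := 1 + A / m * `|v|.
have B1 : 1 <= B by rewrite lerDl mulr_ge0// divr_ge0// ltW.
have [|r2 [L' [r20 L'0 _ HL']]] := compact_lip (f := p) (x0 := z0) (@closed_ball_compact R n B).
  by move=> w _; exact: derive_pair_lip.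
have [|r3 [L [r30 L0 _ HL]]] := compact_lip (f := H) (x0 := z0) (@closed_ball_compact R n B).
  by move=> w _; exact: (spray_hessian_lip oW fC Wz0 (spray_lip HS w Wz0)).
pose U : set E := [set z | [/\ ball z0 r1 z, ball z0 r2 z, ball z0 r3 z,
   W z & (m < 'D_v f z /\ forall w, f z = 0 -> 'D_w f z = 0 -> H (z, w) <= 0)]].
have Uz0 : nbhs z0 U.
  have N1 := near_derive_gt fC Wz0 mv.
  have N2 : \forall z \near z0, W z by exact: open_nbhs_nbhs.
  have B' (r : R) : 0 < r -> nbhs z0 (ball z0 r) by move=> r0; exact: nbhsx_ballx.
  apply: filterS (filterI (filterI (filterI N1 N2) hess)
    (filterI (filterI (B' _ r10) (B' _ r20)) (B' _ r30))).
  by move=> z [[[? ?] ?] [[? ?] ?]].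
have [r [k [r0 k0 Hz]]] := zero_along Wz0 fz0 fv Uz0.
set V := `|v|; have V0 : 0 <= V by exact: normr_ge0.
(* [L] times the coefficients of the two displacements: [k * V] for the point; for the vector,
   [V / m] times |'D_w f| at the moved point, which exceeds its value at [z] by at most
   [L' * (k * V * |f z|)]. *)
set C := L * (k * V + V / m * (L' * (k * V)) + V / m).
have Vm0 : 0 <= V / m by rewrite divr_ge0// ltW.
have kV0 : 0 <= k * V by rewrite mulr_ge0// ltW.
have C1 : 0 <= k * V + V / m * (L' * (k * V)).
  by rewrite addr_ge0// mulr_ge0// mulr_ge0// ltW.
have C0 : 0 <= C by rewrite mulr_ge0 ?(ltW L0)// addr_ge0.
(* Both sides of the estimate are homogeneous of degree 2 in [w], so unit vectors suffice. *)
have unit_case (z w : E) : ball z0 r z -> `|w| = 1 ->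
    H (z, w) <= C * (`|f z| + `|'D_w f z|).
  move=> zr w1; have [tau [tauk Uz' fz' Us]] := Hz _ zr.
  have zE : U z.
    have := Us 0; rewrite normr0 scale0r add0r; apply.
    by rewrite mulr_ge0// ltW.
  move: Uz' fz'; set z' := tau *: v + z => Uz' fz'.
  have zz' : `|z - z'| <= k * V * `|f z|.
    rewrite /z' opprD addrCA subrr addr0 normrN normrZ mulrAC.
    by rewrite ler_wpM2r.
  have [z'1 z'2 z'3 Wz' [mz' Hz']] := Uz'.
  have [z1 z2 z3 Wz [mz _]] := zE.
  have dv0 : 0 < 'D_v f z' by rewrite (lt_trans m0).
  set b := 'D_w f z' / 'D_v f z'.
  have bm : `|b| <= `|'D_w f z'| / m.
    rewrite normrM normfV (gtr0_norm dv0) ler_wpM2l// lef_pV2 ?posrE//.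
    exact: ltW.
  set w' := w - b *: v.
  have pw' : 'D_w' f z' = 0.
    have df := C21_differentiable fC Wz'.
    have E1 := deriveDv w (- (b *: v)) df.
    have E2 := deriveNv (b *: v) df; have E3 := deriveZv b v df.
    apply: etrans E1 _; rewrite E2 E3.
    have -> : b *: 'D_v f z' = 'D_w f z'.
      by rewrite -[LHS]/(b * 'D_v f z') /b -mulrA mulVf ?mulr1// gt_eqF.
    by rewrite subrr.
  have ww' : `|w - w'| <= V / m * `|'D_w f z'|.
    rewrite /w' opprB addrCA subrr addr0 normrZ mulrC.
    by rewrite -mulrA ler_wpM2l// mulrC.
  have pA : `|'D_w f z'| <= A by apply: (HA z' w) => //=; rewrite w1.
  have w'B : `|w'| <= B.
    have -> : w' = w - (w - w') by rewrite opprB addrCA subrr addr0.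
    rewrite (le_trans (ler_normB _ _))// w1 lerD2l (le_trans ww')//.
    by rewrite mulrC mulrA mulrAC ler_wpM2r// ler_wpM2r// invr_ge0 ltW.
  have wB : `|w| <= B by rewrite w1.
  have HH := HL z z' w w' z3 z'3 wB w'B.
  have pp : `|p (z', w) - p (z, w)| <= L' * (k * V * `|f z|).
    rewrite (le_trans (HL' z' z w w z'2 z2 wB wB))// subrr normr0 addr0.
    by rewrite distrC ler_wpM2l// ltW.
  have p' : `|'D_w f z'| <= `|'D_w f z| + L' * (k * V * `|f z|).
    have -> : 'D_w f z' = p (z, w) + (p (z', w) - p (z, w)).
      by rewrite addrCA subrr addr0.
    by rewrite (le_trans (ler_normD _ _))// lerD2l.
  have ww'2 : `|w - w'| <= V / m * (`|'D_w f z| + L' * (k * V * `|f z|)).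
    by rewrite (le_trans ww')// ler_wpM2l.
  have H0 : H (z', w') <= 0 by exact: Hz'.
  have HH' : H (z, w) <= L * (`|z - z'| + `|w - w'|).
    have : H (z, w) - H (z', w') <= L * (`|z - z'| + `|w - w'|).
      by rewrite (le_trans _ HH)// ler_norm.
    rewrite lerBlDr => X; rewrite (le_trans X)//.
    by rewrite gerDl.
  rewrite (le_trans HH')// /C -mulrA ler_wpM2l ?(ltW L0)//.
  rewrite (le_trans (lerD zz' ww'2))//.
  have f0 : 0 <= `|f z| by []. have d0 : 0 <= `|'D_w f z| by [].
  move: (`|f z|) (`|'D_w f z|) f0 d0 => x y x0 y0.
  have -> : k * V * x + V / m * (y + L' * (k * V * x)) =
     (k * V + V / m * (L' * (k * V))) * x + V / m * y by ring.
  have -> : (k * V + V / m * (L' * (k * V)) + V / m) * (x + y) =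
    (k * V + V / m * (L' * (k * V))) * x + V / m * y +
    ((k * V + V / m * (L' * (k * V))) * y + V / m * x) by ring.
  by rewrite lerDl addr_ge0// mulr_ge0.
exists r, C; split=> // z w zr.
have Wz : W z.
  have [_ [_ _ _ Us]] := Hz _ zr.
  have := Us 0; rewrite normr0 scale0r add0r => X.
  by have [|] := X; first by rewrite mulr_ge0// ltW.
have [w0|w0] := eqVneq w 0.
  have -> : spray_hessian f S (z, w) = 0.
    by rewrite w0; apply: (@spray_hessian0 _ _ W) => //; exact: (spray0 HS).
  by rewrite mulr_ge0// addr_ge0// mulr_ge0// sqr_ge0.
have n0 : 0 < `|w| by rewrite normr_gt0.
have u1 : `|(`|w|^-1 *: w)| = 1.
  by rewrite normrZ normfV normr_id mulVf// gt_eqF.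
have wE : w = `|w| *: (`|w|^-1 *: w) by rewrite scalerA divff ?scale1r// gt_eqF.
have df := C21_differentiable fC Wz.
have HE : spray_hessian f S (z, w) = `|w| ^+ 2 * H (z, `|w|^-1 *: w).
  have X := @spray_hessianZ _ _ _ _ oW fC S z (`|w|^-1 *: w) `|w| Wz.
  rewrite [in LHS]wE X// (sprayZ HS)//.
have DE : `|'D_w f z| = `|w| * `|'D_(`|w|^-1 *: w) f z|.
  have X := deriveZv `|w| (`|w|^-1 *: w) df.
  have Y : 'D_w f z = `|w| *: 'D_(`|w|^-1 *: w) f z.
    by apply: etrans _ X; apply: (congr1 (fun w => 'D_w f z)).
  by rewrite Y normrZ normr_id.
rewrite HE DE; clearbody C.
have -> : C * (`|f z| * `|w| ^+ 2 + `|w| * `|'D_(`|w|^-1 *: w) f z| * `|w|) =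
   `|w| ^+ 2 * (C * (`|f z| + `|'D_(`|w|^-1 *: w) f z|)).
  by move: (`|'D_(`|w|^-1 *: w) f z|) => x; ring.
by rewrite ler_wpM2l ?sqr_ge0// unit_case.
Qed.

(** The line through [z] of direction [w] is pushed along [v] onto {f = 0}. The displacement is at
    most k |f| on the line, which is o(t) as ['D_w f z = 0], so the pushed curve still has velocity
    [w] at 0, although [tau] is selected without any continuity. *)
Lemma boundary_curve (z w v : E) : W z -> f z = 0 -> 0 < 'D_v f z ->
  'D_w f z = 0 -> exists zeta : R -> E, [/\ zeta 0 = z,
    is_derive (0 : R) (1 : R) zeta w &
    \forall t \near (0 : R), W (zeta t) /\ f (zeta t) = 0].
Proof.
move=> Wz fz fv fw.
have [r [k [r0 k0 H]]] := zero_along Wz fz fv (open_nbhs_nbhs (conj oW Wz)).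
pose line (t : R) : E := t *: w + z.
pose P (t tau : R) := [/\ `|tau| <= k * `|f (line t)|, W (tau *: v + line t) &
  f (tau *: v + line t) = 0].
pose tau (t : R) : R := xget 0 (P t).
have line0 : line 0 = z by rewrite /line scale0r add0r.
have nl : \forall t \near (0 : R), ball z r (line t).
  have dl : is_derive (0 : R) (1 : R) line w by exact: is_derive_affine.
  apply: (is_derive_continuous dl); rewrite line0; exact: nbhsx_ballx.
have tauP (t : R) : ball z r (line t) -> P t (tau t).
  move=> /H[s [s1 s2 s3 _]]; apply: (@xgetPex _ 0 (P t)).
  by exists s.
have tau0 : tau 0 = 0.
  have /tauP[H1 _ _] : ball z r (line 0) by rewrite line0; exact: ballxx.
  move: H1; rewrite line0 fz normr0 mulr0 normr_le0 => /eqP.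
  exact.
have dtau : is_derive (0 : R) (1 : R) tau 0.
  apply: (@is_derive_squeeze _ tau (fun t => f (line t)) k).
  - exact: tau0.
  - by rewrite line0.
  - by apply: filterS nl => t /tauP[].
  - have df : differentiable f (0 *: w + z).
      by rewrite scale0r add0r; exact: (C21_differentiable fC Wz).
    apply: is_derive_eq (is_derive_line df) _.
    by apply: etrans (congr1 (fun y => 'D_w f y) line0) fw.
exists (fun t : R => tau t *: v + line t); split.
- by rewrite tau0 scale0r add0r line0.
- have D1 := is_derive_scale dtau (is_derive_cst v (0 : R) (1 : R)).
  have D2 : is_derive (0 : R) (1 : R) line w by exact: is_derive_affine.
  apply: is_derive_eq (is_deriveD D1 D2) _.
  by rewrite scaler0 scale0r !add0r.
- by apply: filterS nl => t /tauP[].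
Qed.

End boundary_function.

(** * The boundary of a domain *)

Section domain_boundary.
Context {R : realType} {n : nat} {M : smoothManifold R n}.
Local Notation E := 'rV[R]_n.
Variables (D : set M) (phi : M -> R) (HD : C21_domain D phi).

Let phiC c : atlas c -> Ck1 2 (ccod c) (phi \o cinv c).
Proof. by move=> hc; exact: (domain_C21 HD). Qed.

Lemma chart_function (c : chart R n M) (p : M) : cdom c p ->
  \forall q \near p, (phi \o cinv c) (cto c q) = phi q.
Proof.
by move=> cp; apply: filterS (near_cdom cp) => q cq /=; rewrite ctoK.
Qed.

Lemma domain_function_continuous : continuous phi.
Proof.
move=> p; have hc := chart_at_atlas p; have cp := chart_at_dom p.
have N := chart_function cp.
have c1 : {for p, continuous ((phi \o cinv (chart_at p)) \o cto (chart_at p))}.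
  apply: continuous_comp; first exact: cto_continuous.
  apply: differentiable_continuous.
  exact: (C21_differentiable (phiC hc) (cto_cod cp)).
move=> A; rewrite /nbhs/= -(nbhs_singleton N) => /c1 nA.
by apply: filterS (filterI N nA) => q [/= <-].
Qed.

Lemma bdP x : bd D x <-> phi x = 0.
Proof. by rewrite -(domain_bd HD). Qed.

Lemma closure_domain_gt0 p : closure D p -> phi p != 0 -> D p.
Proof.
move=> cp p0; apply: contrapT => Dp; move/eqP: p0; apply.
apply/bdP; split=> //; have /interior_id -> := domain_open HD; exact: Dp.
Qed.

Lemma closure_domain_ge0 p : closure D p -> 0 <= phi p.
Proof.
move=> cp; have [->//|p0] := eqVneq (phi p) 0.
by apply/ltW/(domain_gt0 HD); exact: closure_domain_gt0.
Qed.

Lemma domain_neq_bd p : D p -> ~ bd D p.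
Proof. by move=> /(domain_gt0 HD) p0 /bdP pe; rewrite pe ltxx in p0. Qed.

Lemma boundary_transverse x : bd D x ->
  exists v, 0 < 'D_v (phi \o cinv (chart_at x)) (cto (chart_at x) x).
Proof.
move=> Dx; have [v] := domain_regular HD Dx; rewrite /differential => v0.
have df : differentiable (phi \o cinv (chart_at x)) (cto (chart_at x) x).
  exact: (C21_differentiable (phiC (chart_at_atlas x)) (cto_cod (chart_at_dom x))).
have DE := deriveE v df; have DN := deriveNv v df.
move: v0; rewrite neq_lt => /orP[v0|v0]; last by exists v; rewrite DE.
by exists (- v); rewrite DN DE oppr_gt0.
Qed.

(** With [tangent_boundary_kernel], this identifies the velocities of curves in the boundary with
    the kernel of the differential of [phi]. The chart is arbitrary because (a) is applied at all
    boundary points near [x] while computing in the chart at [x]. *)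
Lemma tangent_boundary_chart (c : chart R n M) (z w v : E) : atlas c -> ccod c z ->
  (phi \o cinv c) z = 0 -> 0 < 'D_v (phi \o cinv c) z ->
  'D_w (phi \o cinv c) z = 0 ->
  tangent_space (bd D) (cinv c z) (tangent_of c z w).
Proof.
move=> hc cz fz fv fw.
have [zeta [zeta0 dzeta nzeta]] :=
  boundary_curve (@ccod_open _ _ _ c) (phiC hc) cz fz fv fw.
exists (cinv c \o zeta); split.
- by rewrite /= zeta0.
- apply: continuous_comp; first exact: is_derive_continuous dzeta.
  by rewrite zeta0; exact: cinv_continuous.
- by apply: filterS nzeta => t [_ ft]; exact/bdP.
- have dT : differentiable (transition c (chart_at (cinv c z))) (zeta 0).
    by rewrite zeta0; exact: transition_chart_at.
  by apply: is_derive_eq (is_derive_comp dT dzeta) _; rewrite zeta0.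
Qed.

Lemma tangent_boundary_kernel x y : tangent_space (bd D) x y ->
  'D_y (phi \o cinv (chart_at x)) (cto (chart_at x) x) = 0.
Proof.
move=> [gamma [g0 cg bg dg]].
have cx := chart_at_dom x.
have df : differentiable (phi \o cinv (chart_at x))
    ((cto (chart_at x) \o gamma) 0).
  rewrite /= g0.
  exact: (C21_differentiable (phiC (chart_at_atlas x)) (cto_cod cx)).
have D1 := is_derive_comp df dg.
have N : \forall t \near (0 : R), 0 =
    ((phi \o cinv (chart_at x)) \o (cto (chart_at x) \o gamma)) t.
  have nc : \forall q \near gamma 0, cdom (chart_at x) q.
    by rewrite g0; exact: near_cdom.
  have nc' : \forall t \near (0 : R), cdom (chart_at x) (gamma t) by exact: (cg _ nc).
  apply: filterS (filterI nc' bg) => t [ct bt] /=.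
  by rewrite ctoK//; apply: esym; exact/bdP.
have [_ D2] := near_eq_is_derive N (is_derive_cst (0 : R) (0 : R) (1 : R)).
have [_ D3] := D1; move: D3; rewrite D2 /= g0 => <-.
by [].
Qed.

Lemma geodesic_function (F : M -> E -> R) (c : chart R n M) (gamma : R -> M)
    (t : R) : atlas c -> cdom c (gamma t) -> geodesic_eq_at F gamma t ->
  is_derive t (1 : R) (fun s => (phi \o cinv c) (cto c (gamma s)))
    ('D_(derive1 (cto c \o gamma) t) (phi \o cinv c) (cto c (gamma t))) /\
  is_derive t (1 : R) (fun s =>
      'D_(derive1 (cto c \o gamma) s) (phi \o cinv c) (cto c (gamma s)))
    (spray_hessian (phi \o cinv c) (geodesic_coef F c)
       (cto c (gamma t), derive1 (cto c \o gamma) t)).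
Proof.
move=> hc ct gt; have [dz dv] := geodesic_eq_chart hc ct gt.
have cz : ccod c ((cto c \o gamma) t) by exact: cto_cod.
split; first exact: (curve_derive (phiC hc) cz dz).
apply: is_derive_eq (curve_derive2 (@ccod_open _ _ _ c) (phiC hc) cz dz dv) _.
have df := C21_differentiable (phiC hc) cz.
rewrite /spray_hessian/=; congr (_ + _).
exact: deriveNv _ df.
Qed.

Lemma chart_velocity (gamma : R -> M) (c : chart R n M) (z w v : E) : atlas c ->
  ccod c z -> gamma 0 = cinv c z -> {for (0 : R), continuous gamma} ->
  is_derive (0 : R) (1 : R) (cto c \o gamma) v ->
  velocity gamma 0 = tangent_of c z w -> v = w.
Proof.
move=> hc cz g0 cg dz; rewrite /velocity g0; set d := chart_at _ => vel.
have hd : atlas d by exact: chart_at_atlas.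
have oz : overlap c d z by exact: overlap_chart_at.
have z0 : (cto c \o gamma) 0 = z by rewrite /= g0 cinvK.
have dT : differentiable (transition c d) ((cto c \o gamma) 0).
  by rewrite z0; exact: transition_chart_at.
have D1 := is_derive_comp dT dz.
have N : \forall t \near (0 : R),
    (transition c d \o (cto c \o gamma)) t = (cto d \o gamma) t.
  have nc : \forall q \near gamma 0, cdom c q.
    by apply: near_cdom; rewrite g0; exact: cinv_dom.
  have nc' : \forall t \near (0 : R), cdom c (gamma t) by exact: (cg _ nc).
  by apply: filterS nc' => t ct; rewrite /transition /= ctoK.
have D2 := near_eq_is_derive N D1.
have E1 := derive1_is_derive D2.
have E2 : 'D_v (transition c d) z = 'D_w (transition c d) z.
  by rewrite z0 in E1; exact: etrans (esym E1) (etrans vel (tangent_ofE c z w)).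
have K1 := derive_transitionK v hc hd oz.
have K2 := derive_transitionK w hc hd oz.
by rewrite -K1 -K2 E2.
Qed.

(** The equation determines the second derivative at 0 from the initial data, so the value does not
    depend on the geodesic that [the_geodesic] selects; [geodesic_existence] ensures that this is
    not the default constant curve. *)
Lemma finsler_hessian_chart (F : M -> E -> R) (c : chart R n M) (z w : E) :
  finsler_metric F -> atlas c -> ccod c z ->
  finsler_hessian F phi (cinv c z) (tangent_of c z w) =
  spray_hessian (phi \o cinv c) (geodesic_coef F c) (z, w).
Proof.
move=> HF hc cz; rewrite /finsler_hessian.
set x := cinv c z; set y := tangent_of c z w.
have : geodesics_from F [set 0] x y (the_geodesic F [set 0] x y).
  have [d d0 [gamma [g0 gv gg]]] := geodesic_existence x y HF.
  apply: (@xgetPex _ (cst x) (geodesics_from F [set 0] x y)).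
  exists gamma; split=> // t ->.
  have d00 : - d < 0 < d by rewrite oppr_lt0 d0.
  by apply: filterS (near_itv d00) => s /gg.
move: (the_geodesic _ _ _ _) => gamma [gg g0 gv].
have ng : \forall s \near (0 : R), geodesic_eq_at F gamma s by exact: gg.
have [cg _] := nbhs_singleton ng.
have cx : cdom c (gamma 0) by rewrite g0; exact: cinv_dom.
have nc' : \forall t \near (0 : R), cdom c (gamma t).
  exact: (cg _ (near_cdom cx)).
have N1 : \forall s \near (0 : R),
    (phi \o cinv c) (cto c (gamma s)) = (phi \o gamma) s.
  by apply: filterS nc' => t ct; rewrite /= ctoK.
have N2 : \forall s \near (0 : R),
   'D_(derive1 (cto c \o gamma) s) (phi \o cinv c) (cto c (gamma s)) =
   derive1 (phi \o gamma) s.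
  have N3 := near_join N1.
  apply: filterS (filterI (filterI ng nc') N3) => s [[gs cs] Ns].
  have [D1 _] := geodesic_function hc cs gs.
  by apply: esym; apply: derive1_is_derive; exact: near_eq_is_derive Ns D1.
have [_ D2] := geodesic_function hc cx (nbhs_singleton ng).
have D3 := near_eq_is_derive N2 D2.
have [dz _] := geodesic_eq_chart hc cx (nbhs_singleton ng).
have vw := chart_velocity hc cz g0 cg dz gv.
apply: etrans (derive1_is_derive D3) _.
by rewrite vw g0 /x cinvK.
Qed.

(** A point of the closure of [D] with [phi] nonzero belongs to [D], so [D] is open and closed in
    the image of the path, which is connected. *)
Lemma path_in_domain (g : R -> M) :
  (forall t, 0 <= t <= 1 -> {for t, continuous g} /\ phi (g t) != 0) ->
  D (g 0) -> D (g 1).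
Proof.
move=> Hg D0; pose A := [set g t | t in `[0, 1]%classic].
have cA : connected A.
  apply: connected_continuous_connected; first exact: segment_connected.
  apply: continuous_in_subspaceT => t; rewrite inE/= in_itv/= => /Hg[].
  by [].
have A0 : A (g 0) by exists 0 => //; rewrite /= in_itv/= lexx ler01.
have A1 : A (g 1) by exists 1 => //; rewrite /= in_itv/= lexx ler01.
have DE : A `&` D = A.
  apply: cA; first by exists (g 0).
    by exists D => //; exact: (domain_open HD).
  exists (closure D); first exact: closed_closure.
  apply/seteqP; split=> p [Ap Dp]; split=> //; first exact: subset_closure.
  apply: closure_domain_gt0 => //.
  by case: Ap => t; rewrite /= in_itv/= => /Hg[_ ?] <-.
by have : A (g 1) by []; rewrite -DE => -[].
Qed.

Lemma segment_in_domain (c : chart R n M) (p q : E) :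
  (forall h, 0 <= h <= 1 -> ccod c (h *: (q - p) + p) /\
     0 < phi (cinv c (h *: (q - p) + p))) ->
  D (cinv c p) -> D (cinv c q).
Proof.
move=> H; have := @path_in_domain (fun h : R => cinv c (h *: (q - p) + p)).
rewrite scale0r add0r scale1r subrK; apply => h h01.
have [ch fh] := H h h01; split; last by rewrite gt_eqF.
apply: continuous_comp; last exact: cinv_continuous.
exact: is_derive_continuous (is_derive_affine _ _ _).
Qed.

(* From a point where phi > 0 one climbs, without leaving {phi > 0}, into a ball
   on which phi > 0; the same holds for points of D near x. *)
Lemma local_side x : bd D x ->
  \forall z \near cto (chart_at x) x, 0 < phi (cinv (chart_at x) z) ->
    D (cinv (chart_at x) z).
Proof.
move=> Dx; have [v fv] := boundary_transverse Dx.
have hc := chart_at_atlas x; have cx := chart_at_dom x.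
move: (chart_at x) hc cx fv => c hc cx.
set z0 := cto c x => fv; pose f := phi \o cinv c.
have oc : open (ccod c) by exact: ccod_open.
have cz0 : ccod c z0 by exact: cto_cod.
have fz0 : f z0 = 0 by rewrite /f /= ctoK//; exact/bdP.
have [r [s1 [m [r0 s10 m0 Hr]]]] :=
  ascending_direction oc (phiC hc) cz0 fv (near_ccod cz0).
have s1s : 0 <= s1 <= s1 by rewrite (ltW s10) lexx.
pose p1 := s1 *: v + z0.
have [Hz0 Hf0] := Hr z0 (ballxx z0 r0).
have fp1 : 0 < f p1.
  have [up _] := Hf0 s1 s1s.
  by rewrite (lt_le_trans _ up)// -/f fz0 add0r mulr_gt0.
have cp1 : ccod c p1 by have [] := Hz0 s1 _; first by rewrite gtr0_norm.
have cf1 : {for p1, continuous f}.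
  exact: differentiable_continuous (C21_differentiable (phiC hc) cp1).
have N3 : \forall z \near p1, 0 < f z by exact: (cf1 _ (lt_nbhsr fp1)).
have N4 := near_ccod cp1.
have : nbhs p1 [set z | 0 < f z /\ ccod c z] by exact: filterI N3 N4.
move=> /nbhs_ballP[d d0 Hd].
pose B0 := ball z0 (Num.min d r).
have nB0 : nbhs z0 B0 by apply: nbhsx_ballx; rewrite lt_min d0.
have B0r (z : E) : B0 z -> ball z0 r z.
  by apply: le_ball; rewrite ge_min lexx orbT.
have B0d (z : E) : B0 z -> ball p1 d (s1 *: v + z).
  move=> zB; have : ball z0 d z by apply: le_ball zB; rewrite ge_min lexx.
  rewrite -!ball_normE/= /p1.
  by have -> : s1 *: v + z0 - (s1 *: v + z) = z0 - z by rewrite opprD addrACA subrr add0r.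
have climb (z : E) (h : R) : B0 z -> 0 < f z -> 0 <= h <= 1 ->
    ccod c ((h * s1) *: v + z) /\ 0 < f ((h * s1) *: v + z).
  move=> zB fz /andP[h0 h1].
  have hs0 : 0 <= h * s1 by rewrite mulr_ge0// ltW.
  have hs : 0 <= h * s1 <= s1 by rewrite hs0/= ler_piMl// ltW.
  have [Hz Hf] := Hr z (B0r _ zB); have [up _] := Hf _ hs.
  split; last by rewrite (lt_le_trans _ up)// ltr_wpDr// mulr_ge0// ltW.
  by have [] := Hz (h * s1) _; first by rewrite ger0_norm//; case/andP: hs.
(* As [phi] may be positive outside [D], the positive side is recognised by an actual point [q] of
   [D], which exists because [x] is in the closure. Climbing from [q] leads into the ball around
   [p1], whence one descends to any [z] with [f z > 0]. *)
have [q [Dq [cq qB]]] : exists q, D q /\ cdom c q /\ B0 (cto c q).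
  have [cDx _] := Dx.
  have nx : \forall q \near x, cdom c q /\ B0 (cto c q).
    have n2 : \forall q \near x, B0 (cto c q) by exact: (cto_continuous cx nB0).
    exact: filterI (near_cdom cx) n2.
  by have [q [Dq [cq qB]]] := cDx _ nx; exists q.
pose z1 := cto c q.
have fz1 : 0 < f z1 by rewrite /f /= /z1 ctoK//; exact: (domain_gt0 HD).
have D1 : D (cinv c (s1 *: v + z1)).
  apply: (@segment_in_domain c z1); last by rewrite /z1 ctoK.
  move=> h h01; rewrite addrK scalerA; exact: climb.
apply: filterS nB0 => z zB fz.
apply: (@segment_in_domain c (s1 *: v + z)).
  move=> h /andP[h0 h1].
  have -> : h *: (z - (s1 *: v + z)) + (s1 *: v + z) = ((1 - h) * s1) *: v + z.
    rewrite [s1 *: v + z]addrC opprD addNKr scalerN scalerA addrCA.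
    by rewrite [RHS]addrC mulrBl mul1r scalerBl [X in _ = _ + X]addrC.
  by apply: climb => //; rewrite subr_ge0 h1 gerBl.
apply: (@segment_in_domain c (s1 *: v + z1)) => // h h01.
by have [] := Hd _ (ball_segment h01 (B0d _ zB) (B0d _ qB)).
Qed.

End domain_boundary.

(** * Convexity *)

Section convexity.
Context {R : realType} {n : nat} {M : smoothManifold R n}.
Local Notation E := 'rV[R]_n.
Variables (F : M -> E -> R) (HF : finsler_metric F).
Variables (D : set M) (phi : M -> R) (HD : C21_domain D phi).

Let phiC c : atlas c -> Ck1 2 (ccod c) (phi \o cinv c).
Proof. by move=> hc; exact: (domain_C21 HD). Qed.

Definition hessian_bound (G : M -> E -> R) (x : M) : Prop :=
  exists r : R, exists C : R, [/\ 0 < r, 0 <= C & forall z w : E,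
    ball (cto (chart_at x) x) r z ->
    spray_hessian (phi \o cinv (chart_at x)) (geodesic_coef G (chart_at x)) (z, w)
      <= C * (`|(phi \o cinv (chart_at x)) z| * `|w| ^+ 2 +
              `|'D_w (phi \o cinv (chart_at x)) z| * `|w|)].

(** Condition (a) is used at every boundary point near [x], since the estimate at an interior point
    compares with a boundary point that varies. The zero vector, on which (a) is silent, is treated
    apart. *)
Lemma convex_hessian_bound x : infinitesimally_convex F D phi -> bd D x ->
  hessian_bound F x.
Proof.
move=> cvx Dx; have [v fv] := boundary_transverse HD Dx.
have hc := chart_at_atlas x; have cx := chart_at_dom x.
rewrite /hessian_bound; move: (chart_at x) hc cx fv => c hc cx.
set z0 := cto c x => fv; pose f := phi \o cinv c.
have oc : open (ccod c) by exact: ccod_open.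
have cz0 : ccod c z0 by exact: cto_cod.
have fz0 : f z0 = 0 by rewrite /f /= ctoK//; exact/(bdP HD).
have sp := geodesic_spray HF hc.
apply: (hessian_estimate oc (phiC hc) sp cz0 fz0 fv).
apply: filterS (filterI (near_derive_gt (phiC hc) cz0 fv) (near_ccod cz0)) => z [fvz cz] w fz fw.
have [->|w0] := eqVneq w 0.
  rewrite (@spray_hessian0 _ _ (ccod c))//; exact: (spray0 sp).
have H := finsler_hessian_chart HD w HF hc cz.
apply: (le_trans (_ : _ <= finsler_hessian F phi (cinv c z) (tangent_of c z w))).
  by rewrite H.
apply: cvx.
- exact/(bdP HD).
- exact: (tangent_boundary_chart HD hc cz fz fvz fw).
- by apply: contra_neq w0; exact: tangent_of_eq0.
Qed.

Lemma spray_hessian_opp (W : set E) (f : E -> R) (S S' : E * E -> E) (z w : E) :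
  open W -> Ck1 2 W f -> W z -> S' (z, w) = S (z, - w) ->
  spray_hessian f S' (z, w) = spray_hessian f S (z, - w).
Proof.
move=> oW fC Wz SS.
have B1 := derive2_basis oW fC w Wz; have B2 := derive2_basis oW fC (- w) Wz.
have B : 'D_w ('D_w f) z = 'D_(- w) ('D_(- w) f) z.
  apply: etrans B1 _; apply: etrans _ (esym B2).
  apply: eq_bigr => j _; rewrite mxE mulNr -mulrN -sumrN; congr (_ * _).
  by apply: eq_bigr => i _; rewrite mxE mulNr opprK.
have B' := congr1 (fun u => 'D_u f z) SS.
exact: (congr2 (fun x y => x - y) B B').
Qed.

Lemma spray_hessian_reverse (c : chart R n M) (z w : E) : atlas c -> ccod c z ->
  spray_hessian (phi \o cinv c) (geodesic_coef (reverse F) c) (z, w) =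
  spray_hessian (phi \o cinv c) (geodesic_coef F c) (z, - w).
Proof.
move=> hc cz; apply: (spray_hessian_opp (@ccod_open _ _ _ c) (phiC hc) cz).
exact: geodesic_coef_reverse.
Qed.

(** The Hessian of [reverse F] at [w] is that of [F] at [- w], and the right-hand side of the bound
    is even in [w]. *)
Lemma hessian_bound_reverse x : hessian_bound F x -> hessian_bound (reverse F) x.
Proof.
move=> [r [C [r0 C0 H]]].
have hc := chart_at_atlas x; have cx := chart_at_dom x.
have cz0 := cto_cod cx.
move: (near_ccod cz0) => /nbhs_ballP[r' r'0 Hr'].
exists (Num.min r r'), C; split=> //; first by rewrite lt_min r0.
move=> z w zr.
have cz : ccod (chart_at x) z by apply: Hr'; apply: le_ball zr; rewrite ge_min lexx orbT.
have E1 := spray_hessian_reverse w hc cz; rewrite E1.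
have zr1 : ball (cto (chart_at x) x) r z by apply: le_ball zr; rewrite ge_min lexx.
have := H z (- w) zr1.
have E2 := deriveNv w (C21_differentiable (phiC hc) cz).
by rewrite E2 !normrN.
Qed.

(** This allows [F] and [reverse F] to be treated together: for the latter, [S] is the spray of [F]
    at the opposite vector, which agrees with the coefficients over the chart. *)
Definition spray_of (G : M -> E -> R) (c : chart R n M) (S : E * E -> E) : Prop :=
  spray_on (ccod c) S /\
  forall z w, ccod c z -> geodesic_coef G c (z, w) = S (z, w).

Lemma spray_of_finsler c : atlas c -> spray_of F c (geodesic_coef F c).
Proof. by move=> hc; split=> //; exact: geodesic_spray. Qed.

Lemma spray_of_reverse c : atlas c ->
  spray_of (reverse F) c (fun q => geodesic_coef F c (q.1, - q.2)).
Proof.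
move=> hc; split; first by apply: spray_reverse; exact: geodesic_spray.
by move=> z w cz; exact: geodesic_coef_reverse.
Qed.

Lemma small_geodesics (G : M -> E -> R) (x : M) (S : E * E -> E) (U : set E) :
  spray_of G (chart_at x) S -> nbhs (cto (chart_at x) x) U ->
  exists eps : R, exists K : R, [/\ 0 < eps, 0 < K &
  forall (b : R) (y : E) (gamma : R -> M), 0 < b <= eps -> `|y| <= b ->
  geodesics_from G `[0, 1]%classic x y gamma ->
  derive1 (cto (chart_at x) \o gamma) 0 = y /\
  forall t, 0 <= t <= 1 -> [/\ geodesic_eq_at G gamma t,
    cdom (chart_at x) (gamma t), U (cto (chart_at x) (gamma t)),
    `|derive1 (cto (chart_at x) \o gamma) t| <= 2 * b &
    `|derive1 (cto (chart_at x) \o gamma) t - y| <= K * b ^+ 2]].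
Proof.
move=> [HS SE] nU; have hc := chart_at_atlas x; have cx := chart_at_dom x.
have [eps [K [eps0 K0 H]]] := short_geodesics HS cx nU.
exists eps, K; split=> // b y gamma b0 yb [gg g0 gv].
have geq (t : R) : 0 <= t <= 1 -> geodesic_eq_at G gamma t.
  by move=> t01; apply: nbhs_singleton; apply: gg; rewrite /= in_itv.
have v0 : derive1 (cto (chart_at x) \o gamma) 0 = y.
  by rewrite -gv /velocity g0.
split=> // t t01.
have [|||c1 c2 c3 c4] := H b gamma b0 g0 _ _ _ t t01.
- by move=> s /geq[].
- move=> s s01 cs; have [dz dv] := geodesic_eq_chart hc cs (geq _ s01).
  by split=> //; move: dv; rewrite SE//; exact: cto_cod.
- by rewrite v0.
split=> //; first exact: geq.
by rewrite -[X in _ - X]v0.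
Qed.

(* C * (2 * b) is the constant of the comparison principle on [0, 1]. *)
Lemma small_geodesics_outside (G : M -> E -> R) (x : M) (S : E * E -> E) :
  spray_of G (chart_at x) S -> hessian_bound G x -> bd D x ->
  exists2 b : R, 0 < b & forall (y : E) (gamma : R -> M), `|y| <= b ->
    tangent_space (bd D) x y -> geodesics_from G `[0, 1]%classic x y gamma ->
    ~ D (gamma 1).
Proof.
move=> HS [r [C [r0 C0 HC]]] Dx.
have hc := chart_at_atlas x; have cx := chart_at_dom x.
have [eps [K [eps0 K0 H]]] := small_geodesics HS (nbhsx_ballx _ _ r0).
(* Chosen so that [C * (2 * b) <= 8^-1], as [comparison] requires with T = 1, and [2 * b <= 1],
   whence |v|^2 <= 2 b as soon as |v| <= 2 b. *)
pose b := Num.min eps (16 * (C + 1))^-1.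
have C10 : 0 < 16 * (C + 1) by rewrite mulr_gt0// ltr_wpDl.
have b0 : 0 < b by rewrite lt_min eps0 invr_gt0.
have Cb : C * (2 * b) <= 8^-1 /\ 2 * b <= 1.
  have bC : b * (16 * (C + 1)) <= 1.
    by rewrite -ler_pdivlMr// div1r ge_min lexx orbT.
  have Cb : 0 <= C * b by rewrite mulr_ge0// ltW.
  move: bC Cb (ltW b0); clearbody b; clear -C0 => bC Cb b0.
  have -> : C * (2 * b) = 2 * (C * b) by ring.
  have bC' : 16 * (C * b) + 16 * b <= 1.
    by rewrite (le_trans _ bC)// le_eqVlt; apply/orP; left; apply/eqP; ring.
  move: (C * b) Cb bC' => u u0 bC'; split; last by lra.
  by rewrite -[8^-1]mul1r ler_pdivlMr//; lra.
exists b => // y gamma yb ty gg D1.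
have bb : 0 < b <= eps by rewrite b0 ge_min lexx.
have [v0 Hg] := H b y gamma bb yb gg.
have [_ g0 _] := gg.
have ker := tangent_boundary_kernel HD ty.
move: (chart_at x) hc cx HC Hg v0 ker {H HS} => c hc cx HC Hg v0 ker.
pose f := phi \o cinv c.
pose z t := cto c (gamma t); pose v := derive1 (cto c \o gamma).
have [Cb8 b1] := Cb.
have t11 : 0 <= (1 : R) <= 1 by rewrite lexx ler01.
have := @comparison R (fun t => f (z t)) (fun t => 'D_(v t) f (z t))
  (fun t => spray_hessian f (geodesic_coef G c) (z t, v t)) (C * (2 * b)) 1.
have C2b : 0 <= C * (2 * b) by rewrite mulr_ge0// mulr_ge0// ltW.
rewrite mulr1 => /(_ C2b (lexx _) Cb8) comp.
have f0 : f (z 0) = 0 by rewrite /f /z /= g0 ctoK//; exact/(bdP HD).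
have v00 : 'D_(v 0) f (z 0) = 0.
  rewrite /z g0; apply: etrans ker.
  by apply: (congr1 (fun w => 'D_w f (cto c x))).
have : f (z 1) <= 0.
  apply: (comp _ _ _ f0 v00 1 t11) => t t01.
  - by have [gt ct _ _ _] := Hg t t01; have [] := geodesic_function HD hc ct gt.
  - by have [gt ct _ _ _] := Hg t t01; have [] := geodesic_function HD hc ct gt.
  - have [_ _ zr vb _] := Hg t t01.
    rewrite (le_trans (HC _ _ zr))// -mulrA; apply: ler_wpM2l => //.
    rewrite mulrDr lerD//; last by rewrite mulrC ler_wpM2r.
    rewrite mulrC ler_wpM2r// expr2 (@le_trans _ _ (1 * (2 * b)))//; last by rewrite mul1r.
    by rewrite ler_pM// (le_trans vb).
have [_ c1 _ _ _] := Hg 1 t11.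
rewrite /f /z /= ctoK// leNgt; apply/negP/negPn.
exact: domain_gt0 HD _ D1.
Qed.

Lemma the_geodesicP (G : M -> E -> R) (x : M) (y : E) : exp_domain G x y ->
  geodesics_from G `[0, 1]%classic x y (the_geodesic G `[0, 1]%classic x y).
Proof. by move=> H; exact: (@xgetPex _ (cst x)). Qed.

Lemma geodesic_on_unit (G : M -> E -> R) (gamma : R -> M) :
  (forall t, - 2 < t < 2 -> geodesic_eq_at G gamma t) ->
  geodesic_on G `[0, 1]%classic gamma.
Proof.
move=> H t; rewrite /= in_itv/= => /andP[t0 t1].
have t2 : - 2 < t < 2 by apply/andP; split; lra.
by apply: filterS (near_itv t2) => s; exact: H.
Qed.

(** For [reverse F], a geodesic of [F] with velocity [- y] is run backwards. Its interval (-2, 2) is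
    symmetric, so it still covers a neighbourhood of [0, 1], as [geodesic_on] demands. *)
Lemma exp_domain_small (x : M) : exists2 eps : R, 0 < eps &
  forall y, `|y| <= eps -> exp_domain F x y /\ exp_domain (reverse F) x y.
Proof.
have [eps eps0 H] := geodesic_existence_small x HF.
exists eps => // y yeps; split.
  by have [gamma [g0 gv gg]] := H y yeps; exists gamma; split=> //; exact: geodesic_on_unit.
have [|gamma [g0 gv gg]] := H (- y); first by rewrite normrN.
exists (gamma \o -%R); split.
- apply: geodesic_on_unit => t t2; apply: geodesic_reverse => //.
  by apply: gg; move: t2 => /andP[? ?]; apply/andP; split; lra.
- by rewrite /= oppr0.
have g00 : geodesic_eq_at F gamma 0 by apply: gg; rewrite oppr_lt0 ltr0n.
have cx : cdom (chart_at x) (gamma 0) by rewrite g0; exact: chart_at_dom.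
have [[dz _] _] := geodesic_eq_chart (chart_at_atlas x) cx g00.
have vE : derive1 (cto (chart_at x) \o gamma) 0 = - y.
  by rewrite -gv /velocity g0.
rewrite /velocity /= oppr0 g0; apply: derive1_is_derive.
have df : differentiable (cto (chart_at x) \o gamma) (- 0).
  by rewrite oppr0; exact/derivable1_diffP.
apply: is_derive_eq (is_derive_comp_opp (1 : R) df) _.
by rewrite oppr0 -derive1E vE opprK.
Qed.

Lemma infinitesimal_local : infinitesimally_convex F D phi -> locally_convex F D.
Proof.
move=> cvx x Dx; have hc := chart_at_atlas x.
have HB := convex_hessian_bound cvx Dx.
have [b1 b10 H1] := small_geodesics_outside (spray_of_finsler hc) HB Dx.
have [b2 b20 H2] := small_geodesics_outside (spray_of_reverse hc)
  (hessian_bound_reverse HB) Dx.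
have [eps eps0 He] := exp_domain_small x.
pose b := Num.min eps (Num.min b1 b2).
have b0 : 0 < b by rewrite !lt_min eps0 b10.
exists [set y | `|y| <= b] => [|O].
  have N : nbhs (0 : E) (ball (0 : E) b) by exact: nbhsx_ballx.
  by apply: filterS N => y; rewrite -ball_normE/= sub0r normrN => /ltW.
have OE y : O y -> [/\ exp_domain F x y, exp_domain (reverse F) x y,
    `|y| <= b1, `|y| <= b2 & tangent_space (bd D) x y].
  move=> [/= yb ty]; have [|e1 e2] := He y.
    by rewrite (le_trans yb)// ge_min lexx.
  split=> //; first by rewrite (le_trans yb)// !ge_min lexx orbT.
  by rewrite (le_trans yb)// !ge_min lexx !orbT.
split.
- by move=> y /OE[].
- by move=> y /OE[].
- apply/seteqP; split=> // p [[y /OE[e1 e2 y1 y2 ty] <-]].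
  exact: H1 y1 ty (the_geodesicP e1).
- apply/seteqP; split=> // p [[y /OE[e1 e2 y1 y2 ty] <-]].
  exact: H2 y2 ty (the_geodesicP e2).
Qed.

Lemma convex_function_gt0 (rho drho ddrho : R -> R) (a b : R) : a <= 0 <= b ->
  (forall t, a <= t <= b -> is_derive t (1 : R) rho (drho t)) ->
  (forall t, a <= t <= b -> is_derive t (1 : R) drho (ddrho t)) ->
  (forall t, a <= t <= b -> 0 < ddrho t) ->
  rho 0 = 0 -> drho 0 = 0 ->
  forall t, a <= t <= b -> t != 0 -> 0 < rho t.
Proof.
move=> /andP[a0 b0] d1 d2 dd rho0 drho0 t /andP[ta tb] t0.
have inc (r s : R) : a <= r -> r < s -> s <= b -> drho r < drho s.
  move=> ar rs sb.
  have [u /andP[ru us]|u /andP[ru us] H] := @mean_value_lt _ drho ddrho r s rs.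
    by apply: d2; rewrite (le_trans ar ru) (le_trans us sb).
  rewrite -subr_gt0 H mulr_gt0 ?subr_gt0// dd//.
  by rewrite (le_trans ar (ltW ru)) (le_trans (ltW us) sb).
move: t0; rewrite neq_lt => /orP[tn|tp].
  have [s /andP[s0 s1]|c /andP[c0 c1]] := @mean_value_lt _ rho drho t 0 tn.
    by apply: d1; rewrite (le_trans ta s0) (le_trans s1 b0).
  have := inc c 0 (le_trans ta (ltW c0)) c1 b0.
  rewrite drho0 rho0 !sub0r mulrN => dc /oppr_inj ->.
  by rewrite nmulr_rgt0.
have [s /andP[s0 s1]|c /andP[c0 c1]] := @mean_value_lt _ rho drho 0 t tp.
  by apply: d1; rewrite (le_trans a0 s0) (le_trans s1 tb).
have := inc 0 c a0 c0 (le_trans (ltW c1) tb).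
by rewrite drho0 rho0 !subr0 => dc ->; rewrite mulr_gt0.
Qed.

(** [spray_hessian] is continuous at the point and vector given, so positivity extends to nearby
    ones. The same radius serves for [local_side], which turns positivity of [phi] into membership
    in [D]. *)
Lemma positive_hessian (x : M) (y : E) : bd D x -> tangent_space (bd D) x y ->
  0 < finsler_hessian F phi x y ->
  let c := chart_at x in let f := phi \o cinv c in
  'D_y f (cto c x) = 0 /\
  exists2 d : R, 0 < d & forall z w : E, ball (cto c x) d z -> ball y d w ->
  [/\ ccod c z, 0 < f z -> D (cinv c z) &
    0 < spray_hessian f (geodesic_coef F c) (z, w)].
Proof.
move=> Dx ty Hpos c f; split; first exact: (tangent_boundary_kernel HD ty).
have hc : atlas c by exact: chart_at_atlas.
have cx : cdom c x by exact: chart_at_dom.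
have cz0 : ccod c (cto c x) by exact: cto_cod.
have sp := geodesic_spray HF hc.
have xE : cinv c (cto c x) = x by rewrite ctoK.
have yE : tangent_of c (cto c x) y = y.
  rewrite tangent_ofE xE -/c.
  exact: derive_transition_id.
have HE := finsler_hessian_chart HD y HF hc cz0.
rewrite xE yE in HE.
have lH := spray_hessian_lip (@ccod_open _ _ _ c) (phiC hc) cz0 (spray_lip sp y cz0).
have cH := lip_at_continuous lH.
have H0 : 0 < spray_hessian f (geodesic_coef F c) (cto c x, y) by rewrite -HE.
have : \forall q \near (cto c x, y),
    0 < spray_hessian f (geodesic_coef F c) q by exact: (cH _ (lt_nbhsr H0)).
move=> /nbhs_ballP[d1 d10 Hd1].
have : nbhs (cto c x) [set z | ccod c z /\ (0 < f z -> D (cinv c z))].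
  exact: filterI (near_ccod cz0) (local_side HD Dx).
move=> /nbhs_ballP[d2 d20 Hd2].
exists (Num.min d1 d2); first by rewrite lt_min d10.
move=> z w zd wd.
have zd1 : ball (cto c x) d1 z by apply: le_ball zd; rewrite ge_min lexx.
have zd2 : ball (cto c x) d2 z by apply: le_ball zd; rewrite ge_min lexx orbT.
have wd1 : ball y d1 w by apply: le_ball wd; rewrite ge_min lexx.
have [cz Dz] := Hd2 _ zd2; split; [exact: cz|exact: Dz|].
have zw : ball (cto c x, y) d1 (z, w) by split; [exact: zd1|exact: wd1].
exact: Hd1 _ zw.
Qed.

Lemma tangent_boundaryZ (x : M) (y : E) (a : R) : bd D x ->
  tangent_space (bd D) x y -> tangent_space (bd D) x (a *: y).
Proof.
move=> Dx ty; have [v fv] := boundary_transverse HD Dx.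
have ker := tangent_boundary_kernel HD ty.
have hc := chart_at_atlas x; have cx := chart_at_dom x.
have cz0 := cto_cod cx.
have xE : cinv (chart_at x) (cto (chart_at x) x) = x by rewrite ctoK.
have fz0 : (phi \o cinv (chart_at x)) (cto (chart_at x) x) = 0.
  by rewrite /= xE; exact/(bdP HD).
have kera : 'D_(a *: y) (phi \o cinv (chart_at x)) (cto (chart_at x) x) = 0.
  apply: etrans (deriveZv a y (C21_differentiable (phiC hc) cz0)) _.
  by rewrite ker scaler0.
have := tangent_boundary_chart HD hc cz0 fz0 fv kera.
rewrite xE tangent_ofE xE.
by have -> := derive_transition_id (a *: y) cz0.
Qed.

Lemma local_infinitesimal : locally_convex F D -> infinitesimally_convex F D phi.
Proof.
move=> lc x Dx y ty y0; rewrite leNgt; apply/negP => Hpos.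
have [Dy [d d0 Hd]] := positive_hessian Dx ty Hpos.
have hc := chart_at_atlas x; have cx := chart_at_dom x.
have [U nU [e1 _ e3 _]] := lc x Dx.
have [eps [K [eps0 K0 Hs]]] :=
  small_geodesics (spray_of_finsler hc) (nbhsx_ballx (cto (chart_at x) x) _ d0).
move: nU => /nbhs_ballP[rho /= rho0 rhoU].
have N0 : 0 < `|y| by rewrite normr_gt0.
(* [t1] allows [small_geodesics], and [t2] puts [tau *: y] in [U]. [t3] makes the velocity divided
   by [tau] stay within [d] of [y], where the Hessian is positive; it holds for small [tau] because
   its left side is quadratic in [tau]. *)
have [tau [tau0 t1 t2 t3]] : exists tau : R, [/\ 0 < tau, tau * `|y| <= eps,
    tau * `|y| < rho & K * (tau * `|y|) ^+ 2 < tau * d].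
  move: (`|y|) N0 => N N0; exists (Num.min (eps / N) (Num.min (rho / 2 / N) (d / 2 / (K * N ^+ 2)))).
  have KN : 0 < K * N ^+ 2 by rewrite mulr_gt0// exprn_gt0.
  set tau := Num.min _ _.
  have tau0 : 0 < tau by rewrite !lt_min !divr_gt0.
  split=> //.
  - by rewrite -ler_pdivlMr// ge_min lexx.
  - apply: (@le_lt_trans _ _ (rho / 2)); last by rewrite ltr_pdivrMr// ltr_pMr// ltr1n.
    by rewrite -ler_pdivlMr// !ge_min lexx orbT.
  - have H : tau * (K * N ^+ 2) <= d / 2.
      by rewrite -ler_pdivlMr// !ge_min lexx !orbT.
    have -> : K * (tau * N) ^+ 2 = tau * (tau * (K * N ^+ 2)) by ring.
    by rewrite ltr_pM2l// (le_lt_trans H)// ltr_pdivrMr// ltr_pMr// ltr1n.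
have ntau : `|tau *: y| = tau * `|y| by rewrite normrZ gtr0_norm.
have Oy : (U `&` tangent_space (bd D) x) (tau *: y).
  split; last exact: tangent_boundaryZ.
  by apply: rhoU; rewrite -ball_normE/= sub0r normrN ntau.
have gg := the_geodesicP (e1 _ Oy).
have b0 : 0 < tau * `|y| <= eps by rewrite t1 mulr_gt0.
have ntau' : `|tau *: y| <= tau * `|y| by rewrite ntau.
have [v0 Hg] := Hs (tau * `|y|) (tau *: y) _ b0 ntau' gg.
have : D (finsler_exp F x (tau *: y)).
  rewrite /finsler_exp; have [_ g0 _] := gg.
  move: (the_geodesic F _ x (tau *: y)) g0 v0 Hg => gamma g0 v0 Hg.
  have sp := geodesic_spray HF hc.
  move: (chart_at x) hc cx Dy Hd v0 Hg sp {Hs} => c hc cx Dy Hd v0 Hg sp.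
  pose f := phi \o cinv c.
  pose z t := cto c (gamma t); pose v := derive1 (cto c \o gamma).
  have t11 : 0 <= (1 : R) <= 1 by rewrite lexx ler01.
  have cz0 : ccod c (cto c x) by exact: cto_cod.
  have y_d : ball y d y by exact: ballxx.
  have [_ c1 z1 _ _] := Hg 1 t11.
  have [_ D1 _] := Hd _ _ z1 y_d.
  have := D1; rewrite ctoK//; apply.
  rewrite -[X in 0 < X]/((fun t => f (z t)) 1).
  apply: (@convex_function_gt0 (fun t => f (z t)) (fun t => 'D_(v t) f (z t))
    (fun t => spray_hessian f (geodesic_coef F c) (z t, v t)) 0 1) => //.
  - by rewrite lexx ler01.
  - by move=> t /Hg[gt ct _ _ _]; have [] := geodesic_function HD hc ct gt.
  - by move=> t /Hg[gt ct _ _ _]; have [] := geodesic_function HD hc ct gt.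
  - move=> t /Hg[gt ct zt _ vt].
    pose u := tau^-1 *: v t.
    (* Positivity is known near [y] and not near [tau *: y], so the velocity is rescaled to [u]; by
       homogeneity the Hessian is only multiplied by [tau ^+ 2]. *)
    have vE : v t = tau *: u by rewrite scalerA divff ?scale1r// gt_eqF.
    have ud : ball y d u.
      rewrite -ball_normE/= distrC -(ltr_pM2l tau0).
      have -> : tau * `|u - y| = `|v t - tau *: y|.
        by rewrite -[X in X * _](gtr0_norm tau0) -normrZ scalerBr -vE.
      exact: le_lt_trans vt t3.
    have [ct' _ Hpos'] := Hd _ _ zt ud.
    have Z := @spray_hessianZ _ _ (ccod c) f (@ccod_open _ _ _ c) (phiC hc)
       (geodesic_coef F c) (z t) u tau ct' (sprayZ sp u ct' tau0).
    by rewrite vE Z mulr_gt0// exprn_gt0.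
  - by rewrite /f /z /= g0 ctoK//; exact/(bdP HD).
  - rewrite /v v0 /z g0.
    apply: etrans (deriveZv tau y (C21_differentiable (phiC hc) cz0)) _.
    by rewrite Dy scaler0.
move=> De; have : ((finsler_exp F x @` (U `&` tangent_space (bd D) x)) `&` D)
  (finsler_exp F x (tau *: y)) by split=> //; exists (tau *: y).
by rewrite e3.
Qed.

Lemma geometric_infinitesimal :
  geometrically_convex F D -> infinitesimally_convex F D phi.
Proof.
move=> gc x Dx y ty _; rewrite leNgt; apply/negP => Hpos.
have [Dy [d d0 Hd]] := positive_hessian Dx ty Hpos.
have hc := chart_at_atlas x; have cx := chart_at_dom x.
have [d' d'0 [gamma [g0 gv gg]]] := geodesic_existence x y HF.
have v0 : derive1 (cto (chart_at x) \o gamma) 0 = y by rewrite -gv /velocity g0.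
move: (chart_at x) hc cx Dy Hd v0 => c hc cx Dy Hd v0.
pose f := phi \o cinv c.
pose z t := cto c (gamma t); pose v := derive1 (cto c \o gamma).
have g00 : geodesic_eq_at F gamma 0 by apply: gg; rewrite oppr_lt0 d'0.
have cg0 : cdom c (gamma 0) by rewrite g0.
have [dz dv] := geodesic_eq_chart hc cg0 g00.
have n1 : \forall t \near (0 : R), ball (cto c x) d (z t).
  by apply: (is_derive_continuous dz); rewrite /= g0; exact: nbhsx_ballx.
have n2 : \forall t \near (0 : R), ball y d (v t).
  by apply: (is_derive_continuous dv); rewrite v0; exact: nbhsx_ballx.
have n3 : \forall t \near (0 : R), cdom c (gamma t).
  by have [cg _] := g00; exact: (cg _ (near_cdom cg0)).
have n4 : \forall t \near (0 : R), geodesic_eq_at F gamma t.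
  have d00 : - d' < 0 < d' by rewrite oppr_lt0 d'0.
  by apply: filterS (near_itv d00) => t; exact: gg.
have [e e0 He] : exists2 e : R, 0 < e & forall t, - e <= t <= e ->
    [/\ ball (cto c x) d (z t), ball y d (v t), cdom c (gamma t) &
       \forall s \near t, geodesic_eq_at F gamma s].
  have n4' := near_join n4.
  have : nbhs (0 : R) [set t | [/\ ball (cto c x) d (z t), ball y d (v t),
      cdom c (gamma t) & \forall s \near t, geodesic_eq_at F gamma s]].
    by apply: filterS (filterI (filterI n1 n2) (filterI n3 n4')) => t [[? ?] [? ?]].
  move=> /nbhs_ballP[e e0 H]; exists (e / 2); first by rewrite divr_gt0.
  move=> t te; apply: H; rewrite -ball_normE/= sub0r normrN.
  rewrite (@le_lt_trans _ _ (e / 2))//; first by rewrite ler_norml.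
  by rewrite ltr_pdivrMr// ltr_pMr// ltr1n.
have e00 : - e <= 0 <= e by rewrite oppr_le0 ltW.
have pos (t : R) : - e <= t <= e -> t != 0 -> 0 < f (z t).
  apply: (@convex_function_gt0 (fun t => f (z t)) (fun t => 'D_(v t) f (z t))
    (fun t => spray_hessian f (geodesic_coef F c) (z t, v t)) (- e) e) => //.
  - move=> s /He[_ _ cs /nbhs_singleton gs].
    by have [] := geodesic_function HD hc cs gs.
  - move=> s /He[_ _ cs /nbhs_singleton gs].
    by have [] := geodesic_function HD hc cs gs.
  - by move=> s /He[zs vs _ _]; have [] := Hd _ _ zs vs.
  - by rewrite /f /z /= g0 ctoK//; exact/(bdP HD).
  - by rewrite /v v0 /z g0.
have Dt (t : R) : - e <= t <= e -> t != 0 -> D (gamma t).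
  move=> te t0; have [zt vt ct _] := He t te.
  have [_ H _] := Hd _ _ zt vt.
  by have := H (pos t te t0); rewrite /z ctoK.
have De : D (gamma 0).
  have ee : - e <= e by rewrite (@le_trans _ _ 0)// ?oppr_le0 ltW.
  apply: (gc (- e) e gamma) => //.
  - by move=> t; rewrite /= in_itv/= => /He[].
  - move=> t; rewrite inE/= in_itv/= => te.
    have [->|t0] := eqVneq t 0; first by rewrite g0; case: Dx.
    by apply: subset_closure; exact: Dt.
  - by apply: Dt; rewrite ?lexx// oppr_eq0 gt_eqF.
  - by apply: Dt; rewrite ?lexx ?andbT// gt_eqF.
  - by rewrite inE/= in_itv/=.
by apply: (domain_neq_bd HD De); rewrite g0.
Qed.

Lemma is_derive_shift (g : R -> R) (c s dg : R) : is_derive (c + s) (1 : R) g dg ->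
  is_derive s (1 : R) (fun t : R => g (c + t)) dg.
Proof.
move=> dgs.
have D1 : is_derive s (1 : R) (fun t : R => c + t) 1.
  have H := is_deriveD (is_derive_cst c s (1 : R)) (is_derive_id s (1 : R)).
  by apply: is_derive_eq H _; rewrite add0r.
have D2 := @is_derive1_comp R g (fun t : R => c + t) s dg 1 dgs D1.
by apply: is_derive_eq D2 _; rewrite mulr1.
Qed.

(* The comparison principle is applied after the last contact c of the geodesic
   with the boundary; phi along the geodesic is minimal at c, so its derivative
   vanishes there. *)
Lemma infinitesimal_geometric :
  infinitesimally_convex F D phi -> geometrically_convex F D.
Proof.
move=> cvx a b gamma ab gg cD Da Db t0; rewrite inE/= in_itv/= => /andP[at0 t0b].
apply: contrapT => nD.
have clD (t : R) : a <= t <= b -> closure D (gamma t).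
  by move=> tab; apply: cD; rewrite inE/= in_itv.
have geq (t : R) : a <= t <= b -> \forall s \near t, geodesic_eq_at F gamma s.
  by move=> tab; apply: gg; rewrite /= in_itv.
pose rho t := phi (gamma t).
have rho_ge0 (t : R) : a <= t <= b -> 0 <= rho t.
  by move=> /clD; exact: (closure_domain_ge0 HD).
have rho0 : rho t0 <= 0.
  rewrite leNgt; apply/negP => r0; apply: nD.
  apply: (closure_domain_gt0 HD); last by rewrite gt_eqF.
  by apply: clD; rewrite at0.
have crho (t : R) : t0 <= t <= b -> {for t, continuous rho}.
  move=> /andP[t0t tb]; apply: continuous_comp.
    by have [] := nbhs_singleton (geq t _); first by rewrite (le_trans at0).
  exact: (domain_function_continuous HD).
have [c [t0c cb rc rpos]] := last_nonpos t0b crho rho0 (domain_gt0 HD Db).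
have cab : a <= c <= b by rewrite (le_trans at0 t0c) ltW.
have rc0 : rho c = 0 by apply/eqP; rewrite eq_le rc rho_ge0.
have ac : a < c.
  rewrite lt_neqAle (le_trans at0 t0c) andbT; apply/eqP => acE.
  by have := domain_gt0 HD Da; rewrite acE -/(rho c) rc0 ltxx.
have Dx : bd D (gamma c) by exact/(bdP HD).
have [r [C [r0 C0 HC]]] := convex_hessian_bound cvx Dx.
have hc := chart_at_atlas (gamma c); have cx := chart_at_dom (gamma c).
move: (chart_at (gamma c)) hc cx HC => ch hc cx HC.
pose f := phi \o cinv ch.
pose z t := cto ch (gamma t); pose v := derive1 (cto ch \o gamma).
have gc := nbhs_singleton (geq c cab).
have [dz dv] := geodesic_eq_chart hc cx gc.
have n1 : \forall t \near c, ball (z c) r (z t).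
  by apply: (is_derive_continuous dz); exact: nbhsx_ballx.
have n2 : \forall t \near c, ball (v c) 1 (v t).
  by apply: (is_derive_continuous dv); exact: nbhsx_ballx.
have n3 : \forall t \near c, cdom ch (gamma t).
  by have [cg _] := gc; exact: (cg _ (near_cdom cx)).
have acb : a < c < b by rewrite ac.
have [e e0 He] : exists2 e : R, 0 < e & forall t, c - e < t < c + e ->
    [/\ ball (z c) r (z t), ball (v c) 1 (v t), cdom ch (gamma t),
       geodesic_eq_at F gamma t & a <= t <= b].
  have : nbhs c [set t | [/\ ball (z c) r (z t), ball (v c) 1 (v t),
      cdom ch (gamma t), geodesic_eq_at F gamma t & a <= t <= b]].
    apply: filterS (filterI (filterI n1 n2) (filterI n3 (filterI (geq c cab) (near_itv acb)))).
    move=> t [[? ?] [? [? /andP[t1 t2]]]]; split=> //.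
    by rewrite !ltW.
  move=> /nbhs_ballP[e e0 H]; exists e => // t te; apply: H.
  by rewrite -ball_normE/= distrC ltr_distl.
have df (t : R) : c - e < t < c + e ->
    is_derive t (1 : R) (fun t => f (z t)) ('D_(v t) f (z t)) /\
    is_derive t (1 : R) (fun t => 'D_(v t) f (z t))
      (spray_hessian f (geodesic_coef F ch) (z t, v t)).
  by move=> /He[_ _ ct gt _]; exact: (geodesic_function HD hc ct gt).
have rE (t : R) : c - e < t < c + e -> f (z t) = rho t.
  by move=> /He[_ _ ct _ _]; rewrite /f /z /rho /= ctoK.
have ce : c - e < c < c + e by rewrite ltrDl ltrBlDr ltrDl e0.
have drho0 : 'D_(v c) f (z c) = 0.
  have ee : c - e <= c + e by rewrite lerD2l (@le_trans _ _ 0)// ?oppr_le0 ltW.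
  have D1 : is_derive c (1 : R) (fun t => f (z t)) 0.
    apply: (derive1_at_min ee).
    - by move=> t; rewrite in_itv/= => /df[[]].
    - by rewrite in_itv.
    - move=> t; rewrite in_itv/= => te; rewrite !rE// rc0 rho_ge0//.
      by have [] := He t te.
  have [D2 _] := df c ce.
  by have [_ <-] := D2; have [_ ->] := D1.
pose V := `|v c| + 1.
have V1 : 1 <= V by rewrite lerDr.
(* The speed is at most [V] within the window, so the factors |v|^2 and |v| in [hessian_bound] are
   both at most [V ^+ 2 + V]. *)
pose C' := C * (V ^+ 2 + V).
have V0 : 0 <= V by rewrite (le_trans ler01).
have C'0 : 0 <= C' by rewrite mulr_ge0// addr_ge0// exprn_ge0.
(* [T] meets the smallness conditions of [comparison] and, being less than [e], keeps c + [0, T] in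
   the window where the chart and the bounds are valid. *)
have [T [T0 T1 CT Te]] : exists T : R, [/\ 0 < T, T <= 1, C' * T <= 8^-1 & T < e].
  clearbody C'; clear - C'0 e0.
  have C80 : 0 < 8 * (C' + 1) by rewrite mulr_gt0// ltr_wpDl.
  exists (Num.min (Num.min 1 (e / 2)) (8 * (C' + 1))^-1).
  have T0 : 0 < Num.min (Num.min 1 (e / 2)) (8 * (C' + 1))^-1.
    by rewrite !lt_min ltr01 divr_gt0// invr_gt0.
  split=> //.
  - by rewrite !ge_min lexx.
  - set T := Num.min _ _.
    have : T * (8 * (C' + 1)) <= 1.
      by rewrite -ler_pdivlMr// div1r !ge_min lexx !orbT.
    have -> : T * (8 * (C' + 1)) = (C' * T) * 8 + 8 * T by ring.
    move=> H; rewrite -[8^-1]mul1r ler_pdivlMr// (le_trans _ H)// lerDl.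
    by rewrite mulr_ge0// ltW.
  - rewrite (@le_lt_trans _ _ (e / 2))//; first by rewrite !ge_min lexx orbT.
    by rewrite ltr_pdivrMr// ltr_pMr// ltr1n.
have inT (s : R) : 0 <= s <= T -> c - e < c + s < c + e.
  move=> /andP[s0 sT]; rewrite ltrD2l ltrD2l (le_lt_trans sT Te) andbT.
  by rewrite (@lt_le_trans _ _ 0)// oppr_lt0.
have T00 : 0 <= T <= T by rewrite (ltW T0) lexx.
have : f (z (c + T)) <= 0.
  apply: (@comparison R (fun s => f (z (c + s))) (fun s => 'D_(v (c + s)) f (z (c + s)))
    (fun s => spray_hessian f (geodesic_coef F ch) (z (c + s), v (c + s))) C' T) => //.
  - move=> s /inT/df[D1 _].
    exact: (@is_derive_shift (fun t => f (z t))).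
  - move=> s /inT/df[_ D1].
    exact: (@is_derive_shift (fun t => 'D_(v t) f (z t))).
  - move=> s /inT/He[zs vs _ _ _].
    have vV : `|v (c + s)| <= V.
      rewrite -[v (c + s)](subKr (v c)) (le_trans (ler_normB _ _))// lerD2l.
      by move: vs; rewrite -ball_normE/= => /ltW.
    rewrite (le_trans (HC _ _ zs))// /C' -mulrA; apply: ler_wpM2l => //.
    have v2 : `|v (c + s)| ^+ 2 <= V ^+ 2 by rewrite lerXn2r// nnegrE.
    have V20 : 0 <= V ^+ 2 by rewrite exprn_ge0.
    rewrite mulrDr lerD//.
      by rewrite mulrC ler_wpM2r// (le_trans v2)// lerDl.
    by rewrite mulrC ler_wpM2r// (le_trans vV)// lerDr.
  - by rewrite addr0 rE.
  - by rewrite addr0.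
have cTe := inT T T00.
rewrite rE// leNgt; apply/negP/negPn; apply: rpos.
have [_ _ _ _ /andP[_ cTb]] := He _ cTe.
by rewrite ltrDl T0.
Qed.

End convexity.

Theorem corollary1p2 (R : realType) (n : nat) (M : smoothManifold R n)
    (F : M -> 'rV[R]_n -> R) (F_finsler : finsler_metric F)
    (D : set M) (phi : M -> R) (D_domain : C21_domain D phi) :
  (infinitesimally_convex F D phi <-> geometrically_convex F D) /\
  (geometrically_convex F D <-> locally_convex F D).
Proof.
have ab := infinitesimal_geometric F_finsler D_domain.
have ba := geometric_infinitesimal F_finsler D_domain.
have ac := infinitesimal_local F_finsler D_domain.
have ca := local_infinitesimal F_finsler D_domain.
by split; split=> [H|H]; [exact: ab|exact: ba|exact/ac/ba|exact/ab/ca].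
Qed.
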